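(* For every saturated algebraically closed field $K$ of characteristic $0$ there exist a function $E:K\to K^\times$ and a field automorphism $\sigma$ of $K$ of order two with $\sigma\circ E=E\circ\sigma$, such that $K_E$ satisfies (E), (LOG), (STD), (SP) and (CCP), and $E$ is continuous with respect to the topology induced by $\sigma$.
   Context: The topology induced by $\sigma$: $R=K^\sigma$ is a real closed field with its order topology; choosing $i\in K$ with $i^2=-1$, $K=R\oplus iR$ is identified with $R^2$ and given the product topology, $K^\times$ the subspace topology. Notation: $\mathbb{G}=\mathbb{G}_a\times\mathbb{G}_m$; $\langle\bar z;\bar w\rangle=((z_1,w_1),\dots,(z_n,w_n))$; integer matrices $M=(m_{ij})$ act by $M\cdot\langle\bar z;\bar w\rangle=\langle(\sum_jm_{ij}z_j)_i;(\prod_jw_j^{m_{ij}})_i\rangle$, $M\cdot V$ being the Zariski closure of the image. An irreducible $V\subseteq\mathbb{G}^n$ is rotund if $\dim M\cdot V\geq\mathrm{rank}\,M$ for all $M\in\mathcal{M}_{n,n}(\mathbb{Z})$; absolutely free if for every nonzero $M\in\mathcal{M}_{1,n}(\mathbb{Z})$ both projections of $M\cdot V$ to $\mathbb{G}_a,\mathbb{G}_m$ have dimension $1$; depth $=\dim V-n$. $V$ is $E$-defined over finite $\bar c$ if defined over the field generated by $\bar c\cup E(\bar c)$; a generic solution over $\bar c$ is $\bar z$ with $\langle\bar z;E(\bar z)\rangle\in V$ of transcendence degree $\dim V$ over $\mathbb{Q}(\bar cE(\bar c))$. Axioms: (E) $E:(K,+)\to(K^\times,\cdot)$ is a homomorphism;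 (LOG) $E$ is surjective; (STD) $\ker E=\omega\mathbb{Z}$ for some $\omega\in K^\times$; (SP) for $\mathbb{Q}$-linearly independent $z_1,\dots,z_n$, $\mathrm{tr.deg.}_\mathbb{Q}(z_1,\dots,z_n,E(z_1),\dots,E(z_n))\geq n$; (CCP) every absolutely free rotund $V\subseteq\mathbb{G}^n$ of depth $0$ $E$-defined over a finite $\bar c$ has at most countably many generic solutions over $\bar c$. *)

(* Defs.v *)
From HB Require Import structures.
From mathcomp Require Import all_boot all_order all_algebra.
From mathcomp Require Import mpoly.
From Stdlib Require List.

Set Implicit Arguments.
Unset Strict Implicit.
Unset Printing Implicit Defensive.

Import GRing.Theory.
Local Open Scope ring_scope.

Section ExpDefs.
Variable K : fieldType.

Fixpoint term_consts (t : GRing.term K) : seq K :=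
  match t with
  | GRing.Const c => [:: c]
  | GRing.Add t1 t2 => term_consts t1 ++ term_consts t2
  | GRing.Mul t1 t2 => term_consts t1 ++ term_consts t2
  | GRing.Opp t1 => term_consts t1
  | GRing.NatMul t1 _ => term_consts t1
  | GRing.Inv t1 => term_consts t1
  | GRing.Exp t1 _ => term_consts t1
  | _ => [::]
  end.

Fixpoint formula_consts (f : GRing.formula K) : seq K :=
  match f with
  | GRing.Bool _ => [::]
  | GRing.Equal t1 t2 => term_consts t1 ++ term_consts t2
  | GRing.Unit t1 => term_consts t1
  | GRing.And f1 f2 => formula_consts f1 ++ formula_consts f2
  | GRing.Or f1 f2 => formula_consts f1 ++ formula_consts f2
  | GRing.Implies f1 f2 => formula_consts f1 ++ formula_consts f2
  | GRing.Not f1 => formula_consts f1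
  | GRing.Exists _ f1 => formula_consts f1
  | GRing.Forall _ f1 => formula_consts f1
  end.

(* |A| < |K| : there is no injection of K into A *)
Definition small_subset (A : K -> Prop) : Prop :=
  ~ exists f : K -> K, injective f /\ forall x, A (f x).

Definition saturated : Prop :=
  forall (A : K -> Prop), small_subset A ->
  forall (p : GRing.formula K -> Prop),
    (forall f, p f -> forall c, c \in formula_consts f -> A c) ->
    (forall fs : seq (GRing.formula K), List.Forall p fs ->
       exists x : K, List.Forall (GRing.holds [:: x]) fs) ->
    exists x : K, forall f, p f -> GRing.holds [:: x] f.

Definition subfield (F : K -> Prop) : Prop :=
  [/\ F 0, F 1,
      (forall x y, F x -> F y -> F (x - y) /\ F (x * y)) &
      (forall x, F x -> x != 0 -> F x^-1)].

Definition in_gen_field_over (k : K -> Prop) (s : seq K) (x : K) : Prop :=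
  forall F : K -> Prop, subfield F -> (forall c, k c -> F c) ->
    (forall c, c \in s -> F c) -> F x.

Definition in_gen_field (s : seq K) (x : K) : Prop :=
  in_gen_field_over (fun _ => False) s x.

Definition alg_indep (k : K -> Prop) (d : nat) (y : 'I_d -> K) : Prop :=
  forall p : {mpoly K[d]}, (forall m, k p@_m) -> p.@[y] = 0 -> p = 0.

Definition trdeg_ge (k : K -> Prop) (s : seq K) (d : nat) : Prop :=
  exists y : 'I_d -> K, (forall i, in_gen_field_over k s (y i)) /\ alg_indep k y.

Definition trdeg (k : K -> Prop) (s : seq K) (d : nat) : Prop :=
  trdeg_ge k s d /\ ~ trdeg_ge k s d.+1.

Definition zeros (N : nat) (D : ('I_N -> K) -> Prop)
    (S : {mpoly K[N]} -> Prop) (v : 'I_N -> K) : Prop :=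
  D v /\ forall p, S p -> p.@[v] = 0.

Definition zclosed (N : nat) (D : ('I_N -> K) -> Prop)
    (X : ('I_N -> K) -> Prop) : Prop :=
  exists S : {mpoly K[N]} -> Prop, forall v, X v <-> zeros D S v.

Definition zclosed_over (k : K -> Prop) (N : nat) (D : ('I_N -> K) -> Prop)
    (X : ('I_N -> K) -> Prop) : Prop :=
  exists S : {mpoly K[N]} -> Prop,
    (forall p, S p -> forall m, k p@_m) /\ forall v, X v <-> zeros D S v.

Definition zclosure (N : nat) (D : ('I_N -> K) -> Prop)
    (X : ('I_N -> K) -> Prop) (v : 'I_N -> K) : Prop :=
  D v /\ forall p : {mpoly K[N]}, (forall u, X u -> p.@[u] = 0) -> p.@[v] = 0.

Definition zirreducible (N : nat) (D : ('I_N -> K) -> Prop)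
    (X : ('I_N -> K) -> Prop) : Prop :=
  [/\ zclosed D X, exists v, X v &
      forall Y Z, zclosed D Y -> zclosed D Z ->
        (forall v, X v -> Y v \/ Z v) ->
        (forall v, X v -> Y v) \/ (forall v, X v -> Z v)].

Definition zdim_ge (N : nat) (D : ('I_N -> K) -> Prop)
    (X : ('I_N -> K) -> Prop) (d : nat) : Prop :=
  exists C : nat -> ('I_N -> K) -> Prop,
    (forall i, (i <= d)%N -> zirreducible D (C i) /\ forall v, C i v -> X v) /\
    (forall i, (i < d)%N ->
       (forall v, C i v -> C i.+1 v) /\ exists v, C i.+1 v /\ ~ C i v).

Definition zdim (N : nat) (D : ('I_N -> K) -> Prop)
    (X : ('I_N -> K) -> Prop) (d : nat) : Prop :=
  zdim_ge D X d /\ ~ zdim_ge D X d.+1.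

Definition setdim (N : nat) (D : ('I_N -> K) -> Prop)
    (X : ('I_N -> K) -> Prop) (d : nat) : Prop :=
  zdim D (zclosure D X) d.

(* G^n = G_a^n x G_m^n, seen inside K^(n+n)                             *)

Definition Gpt (n : nat) (z w : 'I_n -> K) : 'I_(n + n) -> K :=
  fun i => match split i with inl j => z j | inr j => w j end.

Definition Gdom (n : nat) (v : 'I_(n + n) -> K) : Prop :=
  forall j : 'I_n, v (rshift n j) != 0.

Definition Gaction (m n : nat) (M : 'M[int]_(m, n))
    (V : ('I_(n + n) -> K) -> Prop) : ('I_(m + m) -> K) -> Prop :=
  zclosure (@Gdom m) (fun v' => exists z w : 'I_n -> K,
      V (Gpt z w) /\
      v' = Gpt (fun i => \sum_j (M i j)%:~R * z j)
               (fun i => \prod_j (w j) ^ (M i j))).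

Definition rotund (n : nat) (V : ('I_(n + n) -> K) -> Prop) : Prop :=
  forall M : 'M[int]_(n, n),
    zdim_ge (@Gdom n) (Gaction M V) (\rank (map_mx intr M : 'M[rat]_(n, n))).

Definition proj_Ga (X : ('I_(1 + 1) -> K) -> Prop) (u : 'I_1 -> K) : Prop :=
  exists v, X v /\ u ord0 = v (lshift 1 ord0).

Definition proj_Gm (X : ('I_(1 + 1) -> K) -> Prop) (u : 'I_1 -> K) : Prop :=
  exists v, X v /\ u ord0 = v (rshift 1 ord0).

Definition absolutely_free (n : nat) (V : ('I_(n + n) -> K) -> Prop) : Prop :=
  forall M : 'M[int]_(1, n), M != 0 ->
    setdim (fun _ => True) (proj_Ga (Gaction M V)) 1 /\
    setdim (fun u => u ord0 != 0) (proj_Gm (Gaction M V)) 1.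

(* depth V = dim V - n; depth 0 means dim V = n *)
Definition depth0 (n : nat) (V : ('I_(n + n) -> K) -> Prop) : Prop :=
  zdim (@Gdom n) V n.

Variable E : K -> K.

Definition E_defined (c : seq K) (n : nat) (V : ('I_(n + n) -> K) -> Prop) :=
  zclosed_over (in_gen_field (c ++ map E c)) (@Gdom n) V.

Definition generic_solution (c : seq K) (n : nat)
    (V : ('I_(n + n) -> K) -> Prop) (z : 'I_n -> K) : Prop :=
  V (Gpt z (fun i => E (z i))) /\
  exists d, zdim (@Gdom n) V d /\
    trdeg (in_gen_field (c ++ map E c))
          ([seq z i | i <- enum 'I_n] ++ [seq E (z i) | i <- enum 'I_n]) d.

Definition countable_set (T : Type) (X : T -> Prop) : Prop :=
  exists f : nat -> T, forall x, X x -> exists k, f k = x.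

Definition axiom_E : Prop := forall x y, E (x + y) = E x * E y.

Definition axiom_LOG : Prop := forall y, y != 0 -> exists x, E x = y.

Definition axiom_STD : Prop :=
  exists omega : K, omega != 0 /\
    forall x, E x = 1 <-> exists k : int, x = omega *~ k.

Definition Qlin_indep (n : nat) (z : 'I_n -> K) : Prop :=
  forall q : 'I_n -> rat, \sum_i ratr (q i) * z i = 0 -> forall i, q i = 0.

Definition axiom_SP : Prop :=
  forall (n : nat) (z : 'I_n -> K), Qlin_indep z ->
    trdeg_ge (in_gen_field [::])
      ([seq z i | i <- enum 'I_n] ++ [seq E (z i) | i <- enum 'I_n]) n.

Definition axiom_CCP : Prop :=
  forall (n : nat) (V : ('I_(n + n) -> K) -> Prop) (c : seq K),
    zirreducible (@Gdom n) V -> absolutely_free V -> rotund V ->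
    depth0 V -> E_defined c V ->
    countable_set (generic_solution c V).

End ExpDefs.

(* Topology induced by an involution sigma and a square root i of -1   *)

Section Topology.
Variables (K : fieldType) (sigma : K -> K) (i : K).

Definition in_R (x : K) : Prop := sigma x = x.

(* the (unique) field order of the real closed field R = K^sigma *)
Definition ltR (a b : K) : Prop := a != b /\ exists s, in_R s /\ b - a = s ^+ 2.

Definition box (a1 a2 b1 b2 : K) (w : K) : Prop :=
  exists a b, [/\ in_R a, in_R b, w = a + i * b &
                 [/\ ltR a1 a, ltR a a2, ltR b1 b & ltR b b2]].

Definition sopen (U : K -> Prop) : Prop :=
  forall z, U z -> exists a1 a2 b1 b2,
    [/\ in_R a1, in_R a2, in_R b1, in_R b2 &
        box a1 a2 b1 b2 z /\ forall w, box a1 a2 b1 b2 w -> U w].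

(* continuity of f : K -> K^x, K^x with the subspace topology *)
Definition scontinuous (f : K -> K) : Prop :=
  forall U, sopen U -> sopen (fun z => U (f z) /\ f z != 0).

End Topology.

(* Main.v *)
Require Import Defs.
From HB Require Import structures.
From mathcomp Require Import all_boot all_order all_algebra.
From mathcomp Require Import mpoly.
From mathcomp Require Import boolp.
From mathcomp Require classical_sets.
From mathcomp Require Import complex ring zify.

Set Implicit Arguments.
Unset Strict Implicit.
Unset Printing Implicit Defensive.

Import Order.TTheory GRing.Theory Num.Theory.
Local Open Scope ring_scope.

(** Fix a transcendence basis B of K. Saturation gives an injection of K into B, hence infinitely
    many elements of B reserved for each element of K. Split B into levels B_0, B_1, ... and build
    a chain of real closed fields R_n with acl(B_n) = K_n = R_n(i), such that R_(n+1) contains a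
    positive eps_n that is infinitesimal over K_n; sigma is the conjugation of the union.

    E is prescribed on a Q-basis. An element a completing the part of K_n on which E is known is
    sent to 1 + e, or to (1 + ie)/(1 - ie) if a is imaginary, with e = eps_n b/(1 + b) and b a
    fresh element of B. An element y of K_n that is not yet a value, positive or on the unit
    circle, gets the logarithm r/eps_n + b/(1 + b), or i times it, with b, r in B and b fresh.
    Choosing the a's adapted to the filtration by infinitesimals, E sends infinitesimals over K_j
    to elements infinitely close to 1 over K_j, which is continuity.

    For a basis element x with fresh variable b, exactly one of x, E x is transcendental over
    B - b. Hence m elements that are Q-independent modulo an exponentially closed C, together with
    their exponentials, have transcendence degree at least m over C, and m + 1 if C is also closed
    under logarithms and m > 0. The case C = acl(omega) gives SP. For CCP let C be a countable
    closed set containing the parameters: if a generic solution z has coordinates outside C,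
    rotundity applied to the matrix of its Q-linear relations modulo C supplies the rank inside C,
    and the total transcendence degree exceeds n, the dimension of V. So every generic solution
    has its coordinates in C. *)

(** * Algebraic closure and independence *)

(** Continuity is what shapes the construction. The elements [eps n] are coinitial among the
    positive ones, so continuity says level by level that E z is infinitely close to 1 over K_j
    whenever z is infinitesimal over K_j. A new exponential chosen near 1 over K_n respects this for
    all j <= n, and for j > n no nonzero element of K_n is infinitesimal over K_j. A new logarithm
    cannot be treated so, because its value y is given and need not be near 1: the term r/eps_n
    makes it infinite over K_n, and the independence of the elements r prevents combinations of such
    logarithms from becoming small. The bounded term b/(1 + b) carries the fresh variable, as the
    size of b itself is not controlled. What remains is cancellation: d + a may be infinitesimal
    although d is not, and adaptedness excludes this. As E lives on a Q-vector space, each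
    prescribed value comes with compatible roots, again near 1 and on the same axis. On Q omega the
    roots are those of unity, with kernel exactly Z. Dimension is given by chains of irreducible
    closed sets and transcendence degree by polynomials; places and residue fields connect the
    two. *)

Section SubFieldType.
Variables (L : fieldType) (F : L -> Prop).

(** The boolean form of [F], with the closure proof [h] as a parameter, so that the closure lemmas
    on predicates and a field type of elements of [F] become available. *)
Definition sfpred (h : subfield F) : {pred L} := fun x => `[< F x >].

Lemma sfpredP h x : reflect (F x) (x \in sfpred h).
Proof. exact: asboolP. Qed.

Lemma sfpred_divring h : divring_closed (sfpred h).
Proof.
have [F0 F1 Fs Fi] := h; split; first by apply/sfpredP.
  by move=> x y /sfpredP Fx /sfpredP Fy; apply/sfpredP; case: (Fs x y).
move=> x y /sfpredP Fx /sfpredP Fy; apply/sfpredP.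
have [->|y0] := eqVneq y 0; first by rewrite invr0 mulr0.
by apply Fs => //; apply: Fi.
Qed.

HB.instance Definition _ h :=
  GRing.isDivringClosed.Build L (sfpred h) (sfpred_divring h).

Record sfield (h : subfield F) := SField { sfval : L; _ : sfval \in sfpred h }.
HB.instance Definition _ h := [isSub for @sfval h].
HB.instance Definition _ h := [Choice of sfield h by <:].
HB.instance Definition _ h := [SubChoice_isSubIntegralDomain of sfield h by <:].
HB.instance Definition _ h := [SubIntegralDomain_isSubField of sfield h by <:].

Lemma sfvalP h (x : sfield h) : F (sfval x).
Proof. by case: x => x /= /sfpredP. Qed.

End SubFieldType.

Section AlgClosure.
Variable L : fieldType.
Implicit Types (F A S T : L -> Prop) (s t : seq L) (p q : {poly L}).

Definition pover F p := forall i, F p`_i.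
Definition gen S x := forall F, subfield F -> (forall c, S c -> F c) -> F x.
Definition algover F x := exists p, [/\ p != 0, pover F p & p.[x] = 0].
Definition acl S := algover (gen S).
Definition adds A s x := A x \/ x \in s.
(** Read from the tail: each element is transcendental over [A] together with the elements after
    it. *)
Fixpoint indep A s :=
  if s is y :: s' then ~ acl (adds A s') y /\ indep A s' else True.

Lemma subfieldV F x : subfield F -> F x -> F x^-1.
Proof.
by case=> F0 _ _ Fi Fx; have [->|/Fi] := eqVneq x 0; [rewrite invr0|exact].
Qed.

Lemma poverP F (h : subfield F) p : pover F p <-> p \is a polyOver (sfpred h).
Proof.
split=> [Fp|/polyOverP Fp i]; last by apply/(sfpredP h).
by apply/polyOverP=> i; apply/sfpredP.
Qed.

Lemma subfield_gen S : subfield (gen S).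
Proof.
split; try by move=> F [].
  by move=> x y Sx Sy; split=> F hF SF; case: (hF) => _ _ Fs _;
     case: (Fs x y (Sx F hF SF) (Sy F hF SF)).
by move=> x Sx x0 F hF SF; case: (hF) => _ _ _; apply=> //; apply: Sx.
Qed.

Lemma gen_incl S x : S x -> gen S x.
Proof. by move=> Sx F _; apply. Qed.

Lemma gen_sub S T : (forall x, S x -> gen T x) -> forall x, gen S x -> gen T x.
Proof. by move=> ST x; apply=> //; apply: subfield_gen. Qed.

Lemma gen_mono S T : (forall x, S x -> T x) -> forall x, gen S x -> gen T x.
Proof. by move=> ST; apply: gen_sub => x /ST/gen_incl. Qed.

Lemma algoverP F (h : subfield F) x :
  algover F x <-> algebraicOver (val : sfield h -> L) x.
Proof.
split=> [[p [p0 Fp px]]|[p p0 px]]; last first.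
  exists (map_poly (val : sfield h -> L) p); split; first by rewrite map_poly_eq0.
    by move=> i; rewrite coef_map /=; apply: sfvalP.
  exact/rootP.
pose f x : sfield h := insubd 0 x.
have fp : map_poly (val : sfield h -> L) (map_poly f p) = p.
  apply/polyP=> i; rewrite coef_map coef_map_id0 /=.
    by rewrite /f val_insubd; case: ifPn => // /sfpredP /(_ (Fp i)).
  by apply: val_inj; rewrite val_insubd; case: ifP.
exists (map_poly f p); last by rewrite fp; apply/rootP.
by apply: contraNneq p0 => pe; rewrite -fp pe rmorph0.
Qed.

Lemma algover_incl F x : subfield F -> F x -> algover F x.
Proof.
move=> h Fx; exists ('X - x%:P); split; first by rewrite polyXsubC_eq0.
  by apply/(poverP h); rewrite polyOverXsubC; apply/sfpredP.
by rewrite hornerXsubC subrr.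
Qed.

Lemma subfield_algover F : subfield F -> subfield (algover F).
Proof.
move=> h; split.
- by apply/(algoverP h)/algebraic0.
- by apply/(algoverP h)/algebraic1.
- move=> x y /(algoverP h) ax /(algoverP h) ay; split; apply/(algoverP h).
    exact: algebraic_sub.
  exact: algebraic_mul.
by move=> x /(algoverP h) ax _; apply/(algoverP h)/algebraic_inv.
Qed.

Lemma algover_trans F x : subfield F -> algover (algover F) x -> algover F x.
Proof.
move=> h [p [p0 Fp px]]; apply/(algoverP h)/integral_algebraic.
apply: (@integral_root _ _ _ p) => //; first exact/rootP.
move=> c /nthP-/(_ 0)[i _ <-]; apply/integral_algebraic/(algoverP h).
exact: Fp.
Qed.

Lemma algover_mono F F' : (forall x, F x -> F' x) ->
  forall x, algover F x -> algover F' x.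
Proof. by move=> FF x [p [p0 Fp px]]; exists p; split=> // i; apply: FF. Qed.

Lemma subfield_acl S : subfield (acl S).
Proof. exact/subfield_algover/subfield_gen. Qed.

Lemma acl_gen S x : gen S x -> acl S x.
Proof. by apply: algover_incl; apply: subfield_gen. Qed.

Lemma acl_incl S x : S x -> acl S x.
Proof. by move=> Sx; apply: acl_gen; apply: gen_incl. Qed.

Lemma acl_root S x p : p != 0 -> pover (acl S) p -> p.[x] = 0 -> acl S x.
Proof.
by move=> p0 Sp px; apply: algover_trans; [apply: subfield_gen|exists p].
Qed.

Lemma acl_sub S T : (forall x, S x -> acl T x) -> forall x, acl S x -> acl T x.
Proof.
move=> ST x [p [p0 Sp px]]; apply: (acl_root p0) => // i.
exact: (Sp i _ (subfield_acl T) ST).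
Qed.

Lemma acl_mono S T : (forall x, S x -> T x) -> forall x, acl S x -> acl T x.
Proof. by move=> ST; apply: acl_sub => x /ST/acl_incl. Qed.

(** The elements generated by finite parts of [S] already form a subfield containing [S]. *)
Lemma gen_fin S x : gen S x ->
  exists s, (forall y, y \in s -> S y) /\ gen (fun y => y \in s) x.
Proof.
move=> Sx; apply: (Sx (fun x => exists s,
  (forall y, y \in s -> S y) /\ gen (fun y => y \in s) x)); last first.
  by move=> c Sc; exists [:: c]; split;
    [move=> y /[!inE]/eqP->|apply: gen_incl; rewrite inE].
split.
- by exists [::]; split=> //; case: (subfield_gen (fun y => y \in [::])).
- by exists [::]; split=> //; case: (subfield_gen (fun y => y \in [::])).
- move=> u v [s [Ss gu]] [t [St gv]].
  have gst z : gen (fun y => y \in s) z -> gen (fun y => y \in s ++ t) z.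
    by apply: gen_mono => y ys; rewrite mem_cat ys.
  have gts z : gen (fun y => y \in t) z -> gen (fun y => y \in s ++ t) z.
    by apply: gen_mono => y ys; rewrite mem_cat ys orbT.
  have Sst y : y \in s ++ t -> S y by rewrite mem_cat => /orP[/Ss|/St].
  have [_ _ gs _] := subfield_gen (fun y => y \in s ++ t).
  have [g1 g2] := gs _ _ (gst _ gu) (gts _ gv).
  by split; exists (s ++ t).
by move=> u [s [Ss gu]] _; exists s; split=> //; apply: subfieldV gu; apply: subfield_gen.
Qed.

Lemma acl_fin S x : acl S x ->
  exists s, (forall y, y \in s -> S y) /\ acl (fun y => y \in s) x.
Proof.
case=> p [p0 Sp px].
suff [s [Ss ps]] : exists s, (forall y, y \in s -> S y) /\
    forall i, (i < size p)%N -> gen (fun y => y \in s) p`_i.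
  exists s; split=> //; exists p; split=> // i.
  have [/ps//|le] := ltnP i (size p).
  by rewrite nth_default //; case: (subfield_gen (fun y => y \in s)).
elim: (size p) => [|n [s [Ss ps]]]; first by exists [::].
have [t [St pt]] := gen_fin (Sp n).
exists (s ++ t); split=> [y|i]; first by rewrite mem_cat => /orP[/Ss|/St].
rewrite ltnS leq_eqVlt => /orP[/eqP->|/ps].
  by apply: gen_mono pt => y ys; rewrite mem_cat ys orbT.
by apply: gen_mono => y ys; rewrite mem_cat ys.
Qed.

Definition subring A :=
  A 1 /\ forall x y, A x -> A y -> A (x - y) /\ A (x * y).

Lemma subring_closed_ops A : subring A -> [/\ A 0, forall x, A x -> A (- x),
  forall x y, A x -> A y -> A (x + y) & forall x y, A x -> A y -> A (x * y)].
Proof.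
move=> [A1 As]; have A0 : A 0 by rewrite -(subrr 1); case: (As 1 1).
have AN x : A x -> A (- x) by move=> Ax; rewrite -sub0r; case: (As 0 x).
split=> // x y Ax Ay; last by case: (As x y).
by rewrite -[y]opprK; case: (As x (- y)) => //; apply: AN.
Qed.

Lemma clear_denominators A (f : nat -> L) n : subring A ->
  (forall i, (i < n)%N -> exists a b, [/\ A a, A b, b != 0 & f i = a / b]) ->
  exists d, [/\ A d, d != 0 & forall i, (i < n)%N -> A (d * f i)].
Proof.
move=> hA; have [A0 AN AD AM] := subring_closed_ops hA.
elim: n => [|n IH] fn; first by exists 1; split; rewrite ?oner_eq0 //; case: hA.
have [d [Ad d0 Adf]] := IH (fun i li => fn i (ltnW li)).
have [a [b [Aa Ab b0 fab]]] := fn n (ltnSn n).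
exists (d * b); split; [exact: AM|by rewrite mulf_neq0|move=> i].
rewrite ltnS leq_eqVlt => /orP[/eqP->|/Adf Adi].
  suff -> : d * b * f n = d * a by apply: AM.
  by rewrite fab -mulrA [b * _]mulrC divfK.
by rewrite mulrAC; apply: AM.
Qed.

(** Elements of [gen S] are fractions over the ring [A], so a relation over the field becomes one
    over [A] once its finitely many denominators are cleared. It is applied to rings of polynomial
    values such as k[a]. *)
Lemma acl_ring A S x : subring A -> (forall y, S y -> A y) -> acl S x ->
  exists p, [/\ p != 0, pover A p & p.[x] = 0].
Proof.
move=> hA SA [p [p0 Sp px]]; have [A0 AN AD AM] := subring_closed_ops hA.
have A1 : A 1 by case: hA.
have fr y : gen S y -> exists a b, [/\ A a, A b, b != 0 & y = a / b].
  move=> Sy; apply: (Sy (fun y => exists a b, [/\ A a, A b, b != 0 & y = a / b])).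
    2: by move=> c /SA Ac; exists c, 1; split; rewrite ?oner_eq0 // divr1.
  split.
  - by exists 0, 1; rewrite oner_eq0 mul0r.
  - by exists 1, 1; rewrite oner_eq0 divr1.
  - move=> _ _ [a [b [Aa Ab b0 ->]]] [c [d [Ac Ad d0 ->]]]; split.
      exists (a * d + - (c * b)), (b * d); split; last by field; rewrite ?b0 ?d0.
      + by apply: AD; [|apply: AN]; apply: AM.
      + exact: AM.
      + by rewrite mulf_neq0.
    exists (a * c), (b * d); split; last by field; rewrite ?b0 ?d0.
    + exact: AM.
    + exact: AM.
    + by rewrite mulf_neq0.
  move=> _ [a [b [Aa Ab b0 ->]]] ab0; exists b, a; split=> //.
    by apply: contra_neq ab0 => ->; rewrite mul0r.
  by rewrite invf_div.
have [d [Ad d0 Adp]] := clear_denominators hA (fun i (_ : (i < size p)%N) => fr _ (Sp i)).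
exists (d *: p); split; first by rewrite scaler_eq0 negb_or d0.
  move=> i; rewrite coefZ; have [/Adp//|le] := ltnP i (size p).
  by rewrite nth_default // mulr0.
by rewrite hornerZ px mulr0.
Qed.

(** A relation for [b] with coefficients polynomial in [a] is a polynomial in two variables. Reread
    as a polynomial [Q] in [a], its coefficients are polynomials in [b]; if [Q] were zero,
    transcendence of [b] would kill the leading coefficient of the original relation. *)
Lemma acl_exchange S a b :
  acl (adds S [:: a]) b -> ~ acl S b -> acl (adds S [:: b]) a.
Proof.
move=> Sab Sb; have hS := subfield_gen S.
pose A y := exists f, pover (gen S) f /\ y = f.[a].
have hA : subring A.
  split; first by exists 1; rewrite hornerC; split=> //; apply/(poverP hS)/rpred1.
  move=> _ _ [f [/(poverP hS) Sf ->]] [g [/(poverP hS) Sg ->]]; split.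
    by exists (f - g); rewrite hornerD hornerN; split=> //; apply/(poverP hS)/rpredB.
  by exists (f * g); rewrite hornerM; split=> //; apply/(poverP hS)/rpredM.
have SA y : adds S [:: a] y -> A y.
  case=> [Sy|/[!inE]/eqP->].
    exists y%:P; rewrite hornerC; split=> //; apply/(poverP hS).
    by rewrite polyOverC; apply/sfpredP; apply: gen_incl.
  by exists 'X; rewrite hornerX; split=> //; apply/(poverP hS)/polyOverX.
have [p [p0 Ap pb]] := acl_ring hA SA Sab.
have [f fP] := choice Ap.
pose Q := \sum_(i < size p) (b ^+ i) *: f i.
have coefQ k : Q`_k = (\poly_(i < size p) (f i)`_k).[b].
  rewrite coef_sum horner_poly; apply: eq_bigr => i _.
  by rewrite coefZ mulrC.
have [/eqP Q0|Q0] := boolP (Q == 0).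
  case/negP: p0; rewrite -lead_coef_eq0 /lead_coef.
  have [->|] := eqVneq p 0; first by rewrite coef0.
  rewrite -size_poly_gt0 => sp; rewrite [_`__](fP _).2.
  suff -> : f (size p).-1 = 0 by rewrite horner0.
  apply/polyP=> k; rewrite coef0.
  have rk : \poly_(i < size p) (f i)`_k = 0.
    apply/eqP; apply: contrapT => /negP r0; apply: Sb.
    exists (\poly_(i < size p) (f i)`_k); split=> //.
      move=> i; rewrite coef_poly; case: ifP => _; last by case: hS.
      exact: (fP i).1.
    by rewrite -coefQ Q0 coef0.
  have := congr1 (fun r : {poly L} => r`_(size p).-1) rk.
  by rewrite coef_poly prednK // leqnn coef0.
exists Q; split=> //.
  have hSb := subfield_gen (adds S [:: b]).
  apply/(poverP hSb)/rpred_sum => i _; apply: polyOverZ.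
    by apply/rpredX/sfpredP; apply: gen_incl; right; rewrite inE.
  by apply/(poverP hSb) => j; apply: gen_mono ((fP i).1 j) => y; left.
rewrite /Q horner_sum -[RHS]pb [RHS]horner_coef; apply: eq_bigr => i _.
by rewrite hornerZ -(fP i).2 mulrC.
Qed.

Lemma adds_sub A s t : {subset s <= t} -> forall x, adds A s x -> adds A t x.
Proof. by move=> st x [|/st]; [left|right]. Qed.

Lemma acl_adds A s t x :
  acl (adds A (s ++ t)) x <-> acl (adds (adds A t) s) x.
Proof.
by split; apply: acl_mono => y; rewrite /adds mem_cat; [case=> [|/orP[]]|case=> [[]|]];
   move=> h; rewrite ?h ?orbT; auto.
Qed.

Lemma indep_cat A s t : indep A (s ++ t) <-> indep A t /\ indep (adds A t) s.
Proof.
elim: s => [|y s IH] /=; first by split=> // -[].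
by split=> [[ny /IH[it is_]]|[it [ny is_]]]; split=> //; try split=> //;
   try apply/IH; rewrite ?acl_adds // => /acl_adds.
Qed.

Lemma indep_mono A A' s : (forall x, A x -> acl A' x) -> indep A' s -> indep A s.
Proof.
move=> AA; elim: s => //= y s IH [ny /IH]; split=> // ay; apply: ny.
move: ay; apply: acl_sub => x [/AA|xs]; last by apply: acl_incl; right.
by apply: acl_mono => z; left.
Qed.

Lemma indep_adds A a s : indep A s -> ~ acl (adds A s) a -> indep (adds A [:: a]) s.
Proof.
elim: s => //= y s IH [ny is_] na; split; last first.
  apply: IH => // /(acl_mono (adds_sub (t := y :: s) _)) h; apply: na; apply: h.
  by move=> z zs; rewrite inE zs orbT.
move/acl_adds => ay; apply: na; apply/(@acl_adds A [:: y] s).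
apply: acl_exchange => //; apply: acl_mono ay => z.
by rewrite /adds mem_cat inE; case=> [|/orP[]] h; rewrite ?h; auto.
Qed.

(** The exchange step of Steinitz: moving one element into the base costs at most one member of an
    independent list. *)
Lemma indep_drop1 A a s : indep A s ->
  exists s', [/\ {subset s' <= s}, (size s <= (size s').+1)%N &
                 indep (adds A [:: a]) s'].
Proof.
elim: s => [_|y s IH] /=; first by exists [::].
move=> [ny is_]; have [s' [ss sz is']] := IH is_.
have [ay|nay] := EM (acl (adds (adds A [:: a]) s) y); last first.
  exists (y :: s'); split=> /=.
  - by move=> z /[!inE]/orP[->//|/ss->]; rewrite orbT.
  - by rewrite ltnS.
  - split=> // ay; apply: nay; apply: acl_mono ay => z [h|/ss h]; rewrite /adds; auto.
exists s; split=> //; first by move=> z zs; rewrite inE zs orbT.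
apply: indep_adds => // as_; apply: ny.
move/acl_adds: ay; apply: acl_sub => z [h|]; first by apply: acl_incl; left.
rewrite mem_cat inE => /orP[h|/eqP->//]; by apply: acl_incl; right.
Qed.

Lemma steinitz A s t : indep A s -> (forall x, x \in s -> acl (adds A t) x) ->
  (size s <= size t)%N.
Proof.
elim: t A s => [|a t IH] A s is_ st.
  case: s is_ st => //= y s [ny _] /(_ y (mem_head _ _)) ay; case: ny.
  by apply: acl_mono ay => z [|//]; left.
have [s' [ss sz is']] := indep_drop1 a is_.
apply: leq_trans sz _; rewrite ltnS; apply: IH is' _ => x /ss/st ax.
by apply/acl_adds; apply: acl_mono ax => z [|]; rewrite /adds mem_cat !inE;
   [left|rewrite orbC; right].
Qed.

Lemma indep_basis A t : exists s, [/\ subseq s t, indep A s &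
  forall x, x \in t -> acl (adds A s) x].
Proof.
elim: t => [|a t [s [st is_ ts]]]; first by exists [::].
have [as_|nas] := EM (acl (adds A s) a).
  exists s; split=> //; first exact: subseq_trans st (subseq_cons _ _).
  by move=> x /[!inE]/orP[/eqP->|/ts].
exists (a :: s); split=> //=; first by rewrite eqxx.
move=> x /[!inE]/orP[/eqP->|/ts]; first by apply: acl_incl; right; rewrite inE eqxx.
by apply: acl_mono => z [|h]; [left|right; rewrite inE h orbT].
Qed.

(** Replaces independent auxiliary elements by equally many members of [t]. This carries every rank
    computation back to the coordinates of a point, as the definition of transcendence degree
    requires. *)
Lemma indep_sub A s t : indep A s -> (forall x, x \in s -> acl (adds A t) x) ->
  exists s', [/\ subseq s' t, indep A s' & size s' = size s].
Proof.
move=> is_ st; have [s' [ss is' ts]] := indep_basis A t.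
have le : (size s <= size s')%N.
  apply: steinitz is_ _ => x /st; apply: acl_sub => y [Ay|/ts//].
  by apply: acl_incl; left.
exists (drop (size s' - size s) s'); split.
- exact: subseq_trans (drop_subseq _ _) ss.
- by move: is'; rewrite -{1}(cat_take_drop (size s' - size s) s') => /indep_cat[].
- by rewrite size_drop subKn.
Qed.

End AlgClosure.

(** * Independent lists and algebraically independent families of polynomial variables *)

Section AlgIndepPolynomials.
Variables (L : fieldType) (N : nat) (y : 'I_N -> L).
Implicit Types (k : L -> Prop) (v : seq 'I_N) (p q : {mpoly L[N]}).

Definition mover k p := forall m, k p@_m.
Definition onlyvars v p :=
  forall m, m \in msupp p -> forall i, i \notin v -> m i = 0%N.
(** Variables are selected by index inside a fixed polynomial ring, so that an induction on [v]
    never changes the number of variables. *)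
Definition avars k v :=
  forall p, mover k p -> onlyvars v p -> p.@[y] = 0 -> p = 0.

Lemma moverP k (h : subfield k) p : mover k p <-> p \is a mpolyOver N (sfpred h).
Proof.
split=> [kp|/mpolyOverP kp m]; last by apply/(sfpredP h).
by apply/mpolyOverP=> m; apply/sfpredP.
Qed.

Lemma mover_meval k p : subfield k -> mover k p -> (forall i, k (y i)) -> k p.@[y].
Proof.
move=> h /(moverP h) kp ky; apply/(sfpredP h); apply: rpred_mhorner => //.
by apply/forallP => i; apply/sfpredP.
Qed.

Lemma onlyvarsB v p q : onlyvars v p -> onlyvars v q -> onlyvars v (p - q).
Proof. by move=> vp vq m /msuppB_le; rewrite mem_cat => /orP[/vp|/vq]. Qed.

Lemma onlyvarsM v p q : onlyvars v p -> onlyvars v q -> onlyvars v (p * q).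
Proof.
move=> vp vq _ /msuppM_le/allpairsP[[m1 m2] /= [/vp v1 /vq v2 ->]] i iv.
by rewrite mnmDE v1 ?v2.
Qed.

Lemma onlyvars1 v : onlyvars v 1.
Proof. by move=> m; rewrite msupp1 inE => /eqP-> i _; rewrite mnm0E. Qed.

Lemma onlyvarsC v c : onlyvars v c%:MP.
Proof.
by move=> m; rewrite msuppC; case: ifP => // _ /[!inE]/eqP-> i _; rewrite mnm0E.
Qed.

Lemma onlyvarsX v i : i \in v -> onlyvars v 'X_i.
Proof.
move=> iv m; rewrite msuppX inE => /eqP-> j jv; rewrite mnm1E.
by case: eqP iv jv => // -> ->.
Qed.

(** The coefficient of the [e]-th power of the variable [i], as a polynomial in the other
    variables. *)
Let slice (i : 'I_N) (e : nat) p : {mpoly L[N]} :=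
  \sum_(m <- msupp p | m i == e) p@_m *: 'X_[m - U_(i) *+ e].

Let slice_coef i e p m :
  (slice i e p)@_m = if m i == 0%N then p@_(m + U_(i) *+ e) else 0.
Proof.
rewrite /slice raddf_sum /=; have inj (m' : 'X_{1..N}) : m' i == e ->
    ((m' - U_(i) *+ e)%MM == m) = (m i == 0%N) && (m' == (m + U_(i) *+ e)%MM).
  move=> /eqP m'e; apply/eqP/andP => [<-|[/eqP m0 /eqP->]]; last by rewrite addmK.
  rewrite mnmBE mulmnE mnm1E eqxx mul1n m'e subnn; split=> //.
  rewrite submK //; apply/mnm_lepP => j; rewrite mulmnE mnm1E.
  by case: eqP => [<-|]; rewrite ?mul1n ?mul0n ?m'e.
under eq_bigr => m' m'e do rewrite mcoeffZ mcoeffX (inj _ m'e).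
case: ifP => [m0|_]; last by apply: big1 => m' _; rewrite mulr0.
have mie : (m + U_(i) *+ e)%MM i == e.
  by rewrite mnmDE mulmnE mnm1E eqxx mul1n (eqP m0).
have [ms|ms] := boolP ((m + U_(i) *+ e)%MM \in msupp p).
  rewrite big_mkcond (bigD1_seq (m + U_(i) *+ e)%MM) ?msupp_uniq //= mie.
  by rewrite eqxx mulr1 big1 ?addr0 // => m' ne; rewrite (negbTE ne) mulr0 if_same.
rewrite (memN_msupp_eq0 ms) big_seq_cond; apply: big1 => m' /andP[m's _].
by case: eqP m's ms => [-> -> //|_ _ _]; rewrite mulr0.
Qed.

(** Evaluating all variables but one turns [p] into a univariate polynomial [q] at [y i].
    Transcendence of [y i] makes [q] zero, hence every slice of [p] vanishes at [y] and is zero by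
    induction. *)
Lemma indep_avars k v : k 0 -> indep k [seq y i | i <- v] -> avars k v.
Proof.
move=> k0; elim: v => [|i v IH] /=.
  move=> _ p kp vp py; have pc : p = (p@_0)%:MP.
    apply/mpolyP=> m; rewrite mcoeffC; have [<-|m0] := eqVneq 0%MM m; first by rewrite mulr1.
    rewrite mulr0; apply: memN_msupp_eq0; apply: contraNN m0 => /vp mv.
    by apply/eqP/mnmP => i; rewrite mnm0E mv.
  by move: py; rewrite pc mevalC => ->; rewrite mpolyC0.
move=> [nyi /IH kv] p kp vp py.
have sl0 e : slice i e p = 0; last first.
  apply/mpolyP=> m; rewrite mcoeff0.
  have := congr1 (mcoeff (m - U_(i) *+ m i)) (sl0 (m i)).
  rewrite slice_coef mcoeff0 mnmBE mulmnE mnm1E eqxx mul1n subnn eqxx submK //.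
  by apply/mnm_lepP=> j; rewrite mulmnE mnm1E; case: eqP => [->|]; rewrite ?mul1n ?mul0n.
pose q : {poly L} := \sum_(m <- msupp p)
  (p@_m * \prod_(j | j != i) y j ^+ m j) *: 'X^(m i).
have qy : q.[y i] = 0.
  rewrite -py mevalE horner_sum; apply: eq_bigr => m _.
  by rewrite hornerZ hornerXn -mulrA [in RHS](bigD1 i) //= [y i ^+ _ * _]mulrC.
have coefq d : q`_d = (slice i d p).@[y].
  rewrite /slice raddf_sum coef_sum [RHS]big_mkcond /=; apply: eq_bigr => m _.
  rewrite coefZ coefXn eq_sym; case: eqP => [me|_]; last by rewrite mulr0.
  rewrite mulr1 mevalZ mevalX [in RHS](bigD1 i) //= mnmBE mulmnE mnm1E eqxx mul1n.
  rewrite me subnn expr0 mul1r; congr (_ * _); apply: eq_bigr => j ji.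
  by rewrite mnmBE mulmnE mnm1E eq_sym (negbTE ji) mul0n subn0.
have q0 : q = 0.
  apply/eqP; apply: contrapT => /negP qn0; apply: nyi; exists q; split=> //.
  have h := subfield_gen (adds k [seq y i | i <- v]).
  apply/(poverP h); rewrite /q big_seq; apply: rpred_sum => m mp.
  apply: polyOverZ; last exact/rpredX/polyOverX.
  apply: rpredM; first by apply/sfpredP; apply: gen_incl; left.
  apply: rpred_prod => j ji; have [jv|jv] := boolP (j \in v).
    by apply/rpredX/sfpredP; apply: gen_incl; right; apply/map_f.
  by rewrite (vp m mp) ?inE ?negb_or ?ji // expr0 rpred1.
apply: kv; last by rewrite -coefq q0 coef0.
  by move=> m; rewrite slice_coef; case: ifP.
move=> m; rewrite mcoeff_msupp slice_coef; case: ifP; rewrite ?eqxx // => /eqP m0.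
rewrite -mcoeff_msupp => /vp h j jv; have [->//|ji] := eqVneq j i.
have := h j; rewrite inE negb_or ji mnmDE mulmnE mnm1E eq_sym (negbTE ji).
by rewrite mul0n addn0; apply.
Qed.

(** The indices must be distinct: repeating one leaves [avars] true but makes the list of values
    dependent. *)
Lemma avars_indep k v : subfield k -> uniq v -> avars k v ->
  indep k [seq y i | i <- v].
Proof.
move=> h; elim: v => //= i v IH /andP[iv uv] kv; split; last first.
  apply: IH => // p kp vp; apply: kv => // m /vp mv j; rewrite inE negb_or => /andP[_].
  exact: mv.
pose A x := exists p, [/\ mover k p, onlyvars v p & x = p.@[y]].
have hA : subring A.
  split; first by exists 1; rewrite meval1; split=> //;
    [apply/(moverP h)/rpred1|apply: onlyvars1].
  move=> _ _ [p [/(moverP h) kp vp ->]] [q [/(moverP h) kq vq ->]]; split.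
    by exists (p - q); rewrite mevalB; split=> //; [apply/(moverP h)/rpredB|apply: onlyvarsB].
  by exists (p * q); rewrite mevalM; split=> //; [apply/(moverP h)/rpredM|apply: onlyvarsM].
have kA x : adds k [seq y i | i <- v] x -> A x.
  case=> [kx|/mapP[j jv ->]].
    exists x%:MP; rewrite mevalC; split=> //; last exact: onlyvarsC.
    by apply/(moverP h); rewrite mpolyOverC; apply/sfpredP.
  exists 'X_j; rewrite mevalXU; split=> //; last exact: onlyvarsX.
  exact/(moverP h)/mpolyOverX.
move/(acl_ring hA kA) => [P [P0 AP Py]]; have [f fP] := choice AP.
pose r := \sum_(e < size P) f e * 'X_[U_(i) *+ e].
have r0 : r = 0.
  apply: kv.
  - apply/(moverP h)/rpred_sum => e _; apply: rpredM; last exact: mpolyOverX.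
    by apply/(moverP h); case: (fP e).
  - rewrite /r; elim/big_ind: _ => [|p q hp hq|e _]; first by rewrite -mpolyC0; apply: onlyvarsC.
      by rewrite -[q]opprK; apply: onlyvarsB => //; rewrite -sub0r; apply: onlyvarsB => //;
         rewrite -mpolyC0; apply: onlyvarsC.
    apply: onlyvarsM; first by case: (fP e) => _ vf _ m /vf mv j; rewrite inE negb_or => /andP[_];
      apply: mv.
    move=> m; rewrite msuppX inE => /eqP-> j; rewrite inE negb_or => /andP[ji _].
    by rewrite mulmnE mnm1E eq_sym (negbTE ji).
  - rewrite raddf_sum /= -[RHS]Py [RHS]horner_coef; apply: eq_bigr => e _.
    rewrite mevalM mevalX (bigD1 i) //= mulmnE mnm1E eqxx mul1n big1 ?mulr1.
      by case: (fP e) => _ _ ->.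
    by move=> j ji; rewrite mulmnE mnm1E eq_sym (negbTE ji) mul0n expr0.
case/negP: P0; apply/eqP/polyP => e; rewrite coef0.
have [le|/(nth_default 0)//] := ltnP e (size P).
have [_ vf ->] := fP e; suff -> : f e = 0 by rewrite meval0.
apply/mpolyP => m; rewrite mcoeff0.
have [mi|mi] := eqVneq (m i) 0%N; last first.
  by apply: memN_msupp_eq0; apply: contra_neqN mi => /vf; apply.
have := congr1 (mcoeff (m + U_(i) *+ e)) r0; rewrite mcoeff0 raddf_sum /=.
rewrite (bigD1 (Ordinal le)) //= addmC mcoeffMX big1 ?addr0 // => e' ne.
apply: memN_msupp_eq0; apply/negP; rewrite (perm_mem (msuppMX _ _)) => /mapP[m' m's].
have [_ vf' _] := fP e'; have m'i := vf' _ m's _ iv.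
move/(congr1 (fun m : 'X_{1..N} => m i)); rewrite !mnmDE !mulmnE mnm1E eqxx !mul1n m'i mi !addn0.
by move=> ee; case/eqP: ne; apply: val_inj.
Qed.

End AlgIndepPolynomials.

Lemma indep_trdeg_ge (L : fieldType) (k : L -> Prop) (s t : seq L) d :
  k 0 -> indep k t -> size t = d -> (forall x, x \in t -> x \in s) ->
  trdeg_ge k s d.
Proof.
move=> k0 it <- ts; exists (fun i : 'I_(size t) => nth 0 t i); split=> [i|].
  by move=> F _ _; apply; apply: ts; apply: mem_nth.
move=> p kp py; apply: (@indep_avars _ _ _ k (enum 'I_(size t)) k0 _ p kp _ py).
  suff -> : [seq nth 0 t (i : 'I_(size t)) | i <- enum 'I_(size t)] = t by [].
  by rewrite (map_comp (nth 0 t) val) val_enum_ord map_nth_iota0 // take_size.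
by move=> m _ i; rewrite mem_enum.
Qed.

Lemma trdeg_ge_indep (L : fieldType) (k : L -> Prop) (s : seq L) d :
  subfield k -> trdeg_ge k s d ->
  exists t, [/\ indep k t, size t = d & forall x, x \in t -> x \in s].
Proof.
move=> h [y [sy ky]].
have it : indep k [seq y i | i <- enum 'I_d].
  by apply: avars_indep => //; [apply: enum_uniq|move=> p kp _; apply: ky].
have [|t [ts it' st]] := indep_sub (t := s) it.
  move=> _ /mapP[i _ ->]; apply: acl_gen => F hF kF.
  by apply: sy => // c ?; apply: kF; [left|right].
exists t; split=> //; first by rewrite st size_map size_enum_ord.
by move=> x; apply: (mem_subseq ts).
Qed.

(** * Transcendence bases *)

(** Zorn's lemma for properties of subsets stable under unions of nonempty chains. Bases, maximal
    preorders and maximal homomorphisms are all obtained from it. *)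
Lemma zorn_sets (T : Type) (Q : (T -> Prop) -> Prop) (A0 : T -> Prop) :
  Q A0 ->
  (forall Ch : (T -> Prop) -> Prop, (exists A, Ch A) -> (forall A, Ch A -> Q A) ->
     (forall A B, Ch A -> Ch B -> (forall x, A x -> B x) \/ (forall x, B x -> A x)) ->
     Q (fun x => exists A, Ch A /\ A x)) ->
  exists M, [/\ Q M, forall x, A0 x -> M x &
    forall A, Q A -> (forall x, M x -> A x) -> forall x, A x -> M x].
Proof.
move=> Q0 Qch; pose S := {A : T -> Prop | Q A /\ forall x, A0 x -> A x}.
pose mk A (QA : Q A) (AA : forall x, A0 x -> A x) : S :=
  exist (fun A => Q A /\ forall x, A0 x -> A x) A (conj QA AA).
pose R (a b : S) : bool := `[< forall x, sval a x -> sval b x >].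
have inj (a b : S) : (forall x, sval a x <-> sval b x) -> a = b.
  case: a b => [A hA] [A' hA'] /= ab; have e : A = A' by apply/funext => x; apply: propext.
  by rewrite e in hA *; congr exist; apply: Prop_irrelevance.
have [|a b c /asboolP ab /asboolP bc|a b /asboolP ab /asboolP ba|Ch tot|M mM] :=
  @classical_sets.Zorn S R.
- by move=> a; apply/asboolP.
- by apply/asboolP => x /ab/bc.
- by apply: inj => x; split=> [/ab|/ba].
- have [[a0 Cha0]|noch] := EM (exists a, Ch a); last first.
    by exists (mk A0 Q0 (fun x Ax => Ax)) => s Chs; case: noch; exists s.
  have QU : Q (fun x => exists A, (exists a, Ch a /\ sval a = A) /\ A x).
    apply: Qch; first by exists (sval a0), a0.
      by move=> _ [a [_ <-]]; case: (svalP a).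
    move=> _ _ [a [Cha <-]] [b [Chb <-]].
    by have [/asboolP|/asboolP] := tot a b Cha Chb; [left|right].
  have A0U x : A0 x -> exists A, (exists a, Ch a /\ sval a = A) /\ A x.
    move=> A0x; exists (sval a0); split; first by exists a0.
    by case: (svalP a0) => _; apply.
  exists (mk _ QU A0U) => s Chs; apply/asboolP => x /= sx.
  by exists (sval s); split=> //; exists s.
exists (sval M); case: (svalP M) => QM AM; split=> // A QA MA x Ax.
have A0A y : A0 y -> A y by move=> /AM/MA.
by rewrite -(mM (mk A QA A0A)) //; apply/asboolP.
Qed.

Lemma chain_list (T : eqType) (Ch : (T -> Prop) -> Prop) (s : seq T) :
  (exists A, Ch A) ->
  (forall A B, Ch A -> Ch B -> (forall x, A x -> B x) \/ (forall x, B x -> A x)) ->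
  (forall x, x \in s -> exists A, Ch A /\ A x) ->
  exists A, Ch A /\ forall x, x \in s -> A x.
Proof.
move=> [A0 ChA0] tot; elim: s => [|y s IH] sU; first by exists A0.
have [A [ChA sA]] := IH (fun x xs => sU x (mem_behead (s := y :: s) xs)).
have [B [ChB By]] := sU y (mem_head _ _).
have [AB|BA] := tot A B ChA ChB.
  by exists B; split=> // x /[!inE]/orP[/eqP->//|/sA/AB].
by exists A; split=> // x /[!inE]/orP[/eqP->|/sA//]; apply: BA.
Qed.

Definition indepset (L : fieldType) (B : L -> Prop) :=
  forall b, B b -> ~ acl (fun x => B x /\ x <> b) b.

Lemma transcendence_basis (L : fieldType) :
  exists B : L -> Prop, indepset B /\ forall x, acl B x.
Proof.
have [Ch [A ChA] iCh tot b [A1 [ChA1 A1b]] /acl_fin[s [sU sb]]|B [iB _ mB]] :=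
    @zorn_sets L (@indepset L) (fun _ => False) (fun b (h : False) => match h with end).
  have [|A2 [ChA2 sA2]] := @chain_list _ Ch (b :: s) (ex_intro _ A ChA) tot.
    by move=> x /[!inE]/orP[/eqP->|/sU[]//]; exists A1.
  apply: (iCh _ ChA2 b); first by apply: sA2; rewrite mem_head.
  by apply: acl_mono sb => x xs; split; [apply: sA2; rewrite inE xs orbT|case: (sU x xs)].
exists B; split=> // x; apply: contrapT => Bx; apply: (Bx).
have nBx : ~ B x by move/acl_incl.
apply/acl_incl/(mB (fun y => B y \/ y = x)); [|by left|by right].
move=> b [Bb|->] ab; last first.
  by apply: Bx; apply: acl_mono ab => y [[//|->]].
have bx : b <> x by move=> e; apply: nBx; rewrite -e.
have abx : acl (adds (fun y => B y /\ y <> b) [:: x]) b.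
  by apply: acl_mono ab => y [[By|->] yb]; [left|right; rewrite inE].
apply: Bx; have := acl_exchange abx (iB b Bb); apply: acl_sub => y [[By _]|/[!inE]/eqP->];
  exact: acl_incl.
Qed.

Lemma poly_nonroot (K : closedFieldType) (p : {poly K}) : p != 0 -> exists x, p.[x] != 0.
Proof. by move/closed_nonrootP => [x rx]; exists x. Qed.

(* Otherwise B would be small and saturation would give an element transcendental over B. *)
Lemma saturated_basis_inj (K : closedFieldType) (B : K -> Prop) :
  saturated K -> (forall x, acl B x) -> exists f : K -> K, injective f /\ forall x, B (f x).
Proof.
move=> sat aB; apply: contrapT => small.
(* The type of an element that is a root of no nonzero polynomial over [B]. Zero is written
   [NatConst K 0], because [Const 0] would count 0 among the parameters, which must lie in [B]. *)
pose P (g : GRing.formula K) := exists (t : GRing.term K) (q : {poly K}),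
  [/\ g = (GRing.Not (GRing.Equal t (GRing.NatConst K 0))),
      forall c, c \in term_consts t -> B c, q != 0 &
      forall x, GRing.eval [:: x] t = q.[x]].
have [g|fs Pfs|x xP] := sat B small P.
- by move=> [t [q [-> tB _ _]]] c /=; rewrite cats0; apply: tB.
- suff [q [q0 qfs]] : exists q : {poly K}, q != 0 /\
      forall x, q.[x] != 0 -> List.Forall (GRing.holds [:: x]) fs.
    by have [x] := poly_nonroot q0; exists x; apply: qfs.
  elim: Pfs => [|g gs [t [q [-> _ q0 tq]]] _ [r [r0 rgs]]].
    by exists 1; rewrite oner_eq0.
  exists (q * r); rewrite mulf_neq0 //; split=> // x; rewrite hornerM mulf_eq0 negb_or.
  move=> /andP[qx rx]; constructor; last exact: rgs.
  by rewrite /= tq; apply/eqP.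
(* The coefficients of a relation have to be named by terms over [B]. Values of closed terms form a
   ring, so [acl_ring] gives a relation of this kind. *)
pose A c := exists t : GRing.term K, (forall c, c \in term_consts t -> B c) /\
   forall e, GRing.eval e t = c.
have hA : subring A.
  split; first by exists (GRing.NatConst K 1).
  move=> c d [t [tB tc]] [u [uB ud]]; split.
    exists (GRing.Add t (GRing.Opp u)); split=> [z|e] /=; last by rewrite tc ud.
    by rewrite mem_cat => /orP[/tB|/uB].
  exists (GRing.Mul t u); split=> [z|e] /=; last by rewrite tc ud.
  by rewrite mem_cat => /orP[/tB|/uB].
have BA c : B c -> A c.
  by move=> Bc; exists (GRing.Const c); split=> // d /= /[!inE]/eqP->.
have [p [p0 Ap px]] := acl_ring hA BA (aB x).
have [t [tB tp]] : exists t : GRing.term K, (forall c, c \in term_consts t -> B c) /\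
    forall z, GRing.eval [:: z] t = p.[z].
  suff [t [tB tp]] : exists t : GRing.term K, (forall c, c \in term_consts t -> B c) /\
      forall z, GRing.eval [:: z] t = \sum_(i < size p) p`_i * z ^+ i.
    by exists t; split=> // z; rewrite tp horner_coef.
  elim: (size p) => [|n [t [tB tp]]].
    by exists (GRing.NatConst K 0); split=> // z; rewrite big_ord0.
  have [u [uB up]] := Ap n.
  exists (GRing.Add t (GRing.Mul u (GRing.Exp (GRing.Var K 0) n))); split=> [c|z] /=.
    by rewrite cats0 mem_cat => /orP[/tB|/uB].
  by rewrite tp up big_ord_recr.
have /= := xP (GRing.Not (GRing.Equal t (GRing.NatConst K 0))).
by rewrite tp px; apply=> //; exists t, p.
Qed.

(** One injection into an independent set gives countably many with disjoint images, because two
    powers of independent elements coincide only trivially. The exponent is shifted by one to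
    exclude the power 1. *)
Lemma indepset_double_inj (L : fieldType) (B : L -> Prop) (f : L -> L) :
  indepset B -> injective f -> (forall x, B (f x)) ->
  injective (fun u : L * nat => f (f u.1 ^+ u.2.+1)).
Proof.
move=> iB injf Bf [x m] [y n] /= /injf fxy.
have hS (S : L -> Prop) := subfield_gen S.
have [e|ne] := eqVneq (f x) (f y); last first.
  case: (iB (f x) (Bf x)); exists ('X^(m.+1) - (f y ^+ n.+1)%:P); split.
  - by rewrite -size_poly_gt0 size_XnsubC.
  - apply/(poverP (hS _)); apply: rpredB; first exact/rpredX/polyOverX.
    rewrite polyOverC; apply/rpredX/sfpredP; apply: gen_incl; split=> //.
    by move=> e; rewrite e eqxx in ne.
  - by rewrite hornerD hornerN hornerXn hornerC fxy subrr.
have xy : x = y by apply: injf.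
rewrite -xy in fxy *; congr pair.
have [//|mn] := eqVneq m n.
case: (iB (f x) (Bf x)); exists ('X^(m.+1) - 'X^(n.+1)); split.
- apply: contraNneq mn => /eqP; rewrite subr_eq0 => /eqP/(congr1 (fun p : {poly L} => size p)).
  by rewrite !size_polyXn => -[->].
- by apply/(poverP (hS _)); apply: rpredB; apply/rpredX/polyOverX.
- by rewrite hornerD hornerN !hornerXn fxy subrr.
Qed.

(** * Preorders and real closed fields *)

Section Preorders.
Variable K : fieldType.
Implicit Types (T N : K -> Prop) (x y z : K).

(** The positive cone of a preordering, not of all of [K] but of the field [psub T] of its
    differences; [po_S] puts the squares of that field into the cone. *)
Record preord T : Prop := Preord {
  po_1 : T 1;
  po_D : forall x y, T x -> T y -> T (x + y);
  po_M : forall x y, T x -> T y -> T (x * y);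
  po_V : forall x, T x -> T x^-1;
  po_N1 : ~ T (-1);
  po_S : forall x y, T x -> T y -> T ((x - y) ^+ 2) }.

Definition psub T x := exists u v, [/\ T u, T v & x = u - v].

Lemma po_0 T : preord T -> T 0.
Proof. by move=> h; have := po_S h (po_1 h) (po_1 h); rewrite subrr expr0n. Qed.

Lemma po_psub T x : preord T -> T x -> psub T x.
Proof. by move=> h Tx; exists x, 0; rewrite subr0; split=> //; apply: po_0. Qed.

Lemma psub_sq T x : preord T -> psub T x -> T (x ^+ 2).
Proof. by move=> h [u [v [Tu Tv ->]]]; apply: po_S. Qed.

Lemma subfield_psub T : preord T -> subfield (psub T).
Proof.
move=> h; have M x y : psub T x -> psub T y -> psub T (x * y).
  move=> [a [b [Ta Tb ->]]] [c [d [Tc Td ->]]].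
  exists (a * c + b * d), (a * d + b * c).
  by split; [apply: (po_D h); apply: (po_M h)..|ring].
split; first by apply: (po_psub h); apply: po_0.
- by apply: (po_psub h); apply: po_1.
- move=> x y px py; split; last exact: M.
  case: px py => [a [b [Ta Tb ->]]] [c [d [Tc Td ->]]].
  by exists (a + d), (b + c); split; [apply: (po_D h)..|ring].
- move=> x px x0; have -> : x^-1 = x * (x ^+ 2)^-1 by field.
  by apply: M => //; apply: (po_psub h); apply: (po_V h); apply: psub_sq.
Qed.

Lemma po_anti T x : preord T -> T x -> T (- x) -> x = 0.
Proof.
move=> h Tx TNx; apply/eqP; apply: contrapT => /negP x0; apply: (po_N1 h).
by rewrite -(divff x0) -mulNr; apply: (po_M h) => //; apply: (po_V h).
Qed.

Lemma po_2neq0 T : preord T -> 2%:R != 0 :> K.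
Proof.
move=> h; apply/eqP => e; apply: (po_N1 h); suff -> : -1 = 1 :> K by apply: po_1.
by apply/eqP; rewrite eq_sym -addr_eq0 -mulr2n e.
Qed.

Lemma po_chain (Ch : (K -> Prop) -> Prop) : (exists T, Ch T) ->
  (forall T, Ch T -> preord T) ->
  (forall A B, Ch A -> Ch B -> (forall x, A x -> B x) \/ (forall x, B x -> A x)) ->
  preord (fun x => exists T, Ch T /\ T x).
Proof.
move=> [T0 Ch0] hT tot; pose U x := exists T, Ch T /\ T x.
have two x y : U x -> U y -> exists T, [/\ Ch T, T x & T y].
  move=> [A [ChA Ax]] [B [ChB By]].
  by have [AB|BA] := tot A B ChA ChB; [exists B; split=> //; apply: AB|
    exists A; split=> //; apply: BA].
split.
- by exists T0; split=> //; apply: po_1; apply: hT.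
- move=> x y Ux Uy; have [T [ChT Tx Ty]] := two x y Ux Uy; exists T; split=> //.
  exact: (po_D (hT T ChT)).
- move=> x y Ux Uy; have [T [ChT Tx Ty]] := two x y Ux Uy; exists T; split=> //.
  exact: (po_M (hT T ChT)).
- by move=> x [T [ChT Tx]]; exists T; split=> //; apply: (po_V (hT T ChT)).
- by move=> [T [ChT Tx]]; case: (po_N1 (hT T ChT)).
- move=> x y Ux Uy; have [T [ChT Tx Ty]] := two x y Ux Uy; exists T; split=> //.
  exact: (po_S (hT T ChT)).
Qed.

(** The cone generated over [T] by the squares of a larger field [N]; it is a preorder of [N] unless
    it contains -1. *)
Definition sqcone T N x := exists l : seq (K * K),
  (forall u, u \in l -> T u.1 /\ N u.2) /\ x = \sum_(u <- l) u.1 * u.2 ^+ 2.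

Section SqCone.
Variables (T N : K -> Prop).
Hypotheses (hT : preord T) (hN : subfield N) (TN : forall x, T x -> N x).

Lemma sqcone_1 t s : T t -> N s -> sqcone T N (t * s ^+ 2).
Proof.
by move=> Tt Ns; exists [:: (t, s)]; rewrite big_seq1; split=> // u /[!inE]/eqP->.
Qed.

Lemma sqcone_D x y : sqcone T N x -> sqcone T N y -> sqcone T N (x + y).
Proof.
move=> [l [hl ->]] [m [hm ->]]; exists (l ++ m); rewrite big_cat; split=> // u.
by rewrite mem_cat => /orP[/hl|/hm].
Qed.

Lemma sqcone_N x : sqcone T N x -> N x.
Proof.
move=> [l [hl ->]]; apply/(sfpredP hN); rewrite big_seq; apply: rpred_sum => u /hl[Tu Nu].
by apply: rpredM; [apply/sfpredP/TN|apply/rpredX/sfpredP].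
Qed.

Lemma sqcone_Msq x t s : T t -> N s -> sqcone T N x -> sqcone T N (t * s ^+ 2 * x).
Proof.
move=> Tt Ns [l [hl ->]]; exists [seq (t * u.1, s * u.2) | u <- l]; split.
  move=> _ /mapP[u /hl[Tu Nu] ->] /=; split; first exact: (po_M hT).
  by case: hN => _ _ Ns' _; case: (Ns' s u.2).
by rewrite big_map mulr_sumr; apply: eq_bigr => u _ /=; ring.
Qed.

Lemma sqcone_M x y : sqcone T N x -> sqcone T N y -> sqcone T N (x * y).
Proof.
move=> [l [hl ->]] cy; elim: l hl => [|u l IH] hl.
  rewrite big_nil mul0r -(mul0r ((1 : K) ^+ 2)); apply: sqcone_1; first exact: po_0.
  by case: hN.
rewrite big_cons mulrDl; apply: sqcone_D.
  by have [Tu Nu] := hl u (mem_head _ _); apply: sqcone_Msq.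
by apply: IH => v vl; apply: hl; rewrite inE vl orbT.
Qed.

Lemma preord_sqcone : ~ sqcone T N (-1) -> preord (sqcone T N).
Proof.
move=> n1; have [N0 N1 Ns Ni] := hN; have T1 := po_1 hT; split=> //.
- by rewrite -[1]mulr1 -[X in _ * X](expr1n _ 2); apply: sqcone_1.
- exact: sqcone_D.
- exact: sqcone_M.
- move=> x cx; have [->|x0] := eqVneq x 0.
    by rewrite invr0 -(mul0r ((1 : K) ^+ 2)); apply: sqcone_1 => //; apply: po_0.
  have -> : x^-1 = 1 * x^-1 ^+ 2 * x by field.
  by apply: sqcone_Msq => //; apply: Ni => //; apply: sqcone_N.
- move=> x y /sqcone_N Nx /sqcone_N Ny; rewrite -[_ ^+ 2]mul1r; apply: sqcone_1 => //.
  by case: (Ns x y).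
Qed.

Lemma sqcone_incl x : T x -> sqcone T N x.
Proof.
move=> Tx; rewrite -[x]mulr1 -(expr1n _ 2); apply: sqcone_1 => //; by case: hN.
Qed.

(** By the identity s = ((s + 1)/2)^2 - ((s - 1)/2)^2. *)
Lemma sqcone_psub s : N s -> psub (sqcone T N) s.
Proof.
move=> Ns; have [N0 N1 Nb Ni] := hN; have c2 := po_2neq0 hT; have T1 := po_1 hT.
have ND x y : N x -> N y -> N (x + y).
  by move=> Nx Ny; rewrite -[y]opprK -[- y]sub0r; apply Nb => //; apply Nb.
have N2 : N 2%:R^-1 by apply: Ni => //; apply: ND.
exists (1 * ((s + 1) * 2%:R^-1) ^+ 2), (1 * ((s - 1) * 2%:R^-1) ^+ 2); split.
- by apply: sqcone_1 => //; apply Nb => //; apply: ND.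
- by apply: sqcone_1 => //; apply Nb => //; apply Nb.
- by field.
Qed.

End SqCone.

(** Maximality is tested only against preorders algebraic over [T]. This is enough for real
    closedness and adds no transcendental elements. *)
Definition algmax T := forall T', preord T' -> (forall x, T x -> T' x) ->
  (forall x, T' x -> acl T x) -> forall x, T' x -> T x.

(** Artin and Schreier: if [x] is not in [T], then T - xT is again a preorder, since -1 = s - xt
    would give x = (1 + s)/t in [T]. Maximality puts -x into [T]. *)
Lemma algmax_total T x : preord T -> algmax T -> psub T x -> T x \/ T (- x).
Proof.
move=> h mT px; have [Tx|nTx] := EM (T x); [by left|right].
have hp := subfield_psub h.
pose T' z := exists s t, [/\ T s, T t & z = s - x * t].
have T'p z : T' z -> psub T z.
  move=> [s [t [Ts Tt ->]]]; have [_ _ Fb _] := hp.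
  have /Fb := po_psub h Ts; case/(_ (x * t)) => //.
  by case: (Fb x t px (po_psub h Tt)).
have T'M z u : T' z -> psub T u -> T' (z * u ^+ 2).
  move=> [s [t [Ts Tt ->]]] pu; exists (s * u ^+ 2), (t * u ^+ 2).
  by split; [apply: (po_M h) => //; apply: psub_sq..|ring].
apply: (mT T').
- split.
  + by exists 1, 0; split; [apply: po_1|apply: po_0|ring].
  + move=> _ _ [s [t [Ts Tt ->]]] [s' [t' [Ts' Tt' ->]]]; exists (s + s'), (t + t').
    by split; [apply: (po_D h)..|ring].
  + move=> _ _ [s [t [Ts Tt ->]]] [s' [t' [Ts' Tt' ->]]].
    exists (s * s' + x ^+ 2 * (t * t')), (s * t' + t * s').
    have Tx2 := psub_sq h px.
    by split; last ring; apply: (po_D h); apply: (po_M h) => //; apply: (po_M h).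
  + move=> z T'z; have [->|z0] := eqVneq z 0.
      by rewrite invr0; exists 0, 0; split; [apply: po_0..|ring].
    have -> : z^-1 = z * z^-1 ^+ 2 by field.
    by apply: T'M => //; apply: subfieldV => //; apply: T'p.
  + move=> [s [t [Ts Tt e]]]; apply: nTx; have e1 : x * t = 1 + s.
      by rewrite -[s](subrK (x * t)) -e; ring.
    have s0 : 1 + s != 0.
      apply/eqP => s0; apply: (po_N1 h); suff -> : -1 = s by [].
      by apply/eqP; rewrite eq_sym -addr_eq0 addrC s0.
    have t0 : t != 0 by apply: contraNneq s0 => t0; rewrite -e1 t0 mulr0.
    rewrite -[x](mulfK t0) e1; apply: (po_M h); last exact: (po_V h).
    by apply: (po_D h) => //; apply: po_1.
  + move=> y z /T'p py /T'p pz; exists ((y - z) ^+ 2), 0.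
    split; [|exact: po_0|ring]; apply: psub_sq => //; by case: hp => _ _ Fb _; case: (Fb y z).
- by move=> y Ty; exists y, 0; split=> //; [apply: po_0|ring].
- move=> z /T'p [u [v [Tu Tv ->]]]; have [_ _ Fb _] := subfield_acl T.
  by case: (Fb u v) => //; apply: acl_incl.
- by exists 0, 1; split; [apply: po_0|apply: po_1|ring].
Qed.

(** An algebraic extension [N] to which the order extends is no extension at all; it is used with N
    = R(al) for a root [al] of an irreducible polynomial. *)
Lemma algmax_sqcone T N x : preord T -> algmax T -> subfield N ->
  (forall y, T y -> N y) -> (forall y, N y -> acl T y) ->
  ~ sqcone T N (-1) -> N x -> psub T x.
Proof.
move=> h mT hN TN NT n1 Nx; have [u [v [cu cv ->]]] := sqcone_psub h hN Nx.
have cT y : sqcone T N y -> T y.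
  apply: mT; first exact: preord_sqcone.
    by move=> z; apply: sqcone_incl.
  by move=> z /(sqcone_N hN TN)/NT.
by exists u, v; split=> //; apply: cT.
Qed.

End Preorders.

Section RealClosed.
Variable (K : closedFieldType) (T : K -> Prop).

Definition rcl (h : preord T /\ algmax T) := sfield (subfield_psub h.1).
HB.instance Definition _ h := GRing.Field.on (rcl h).

Section Order.
Variable h : preord T /\ algmax T.
Local Notation R := (rcl h).
Local Notation vl := (val : R -> K).

Definition rcl_le (x y : R) : bool := `[< T (vl y - vl x) >].
Definition rcl_norm (x : R) : R := if rcl_le 0 x then x else - x.

Let le0P (x : R) : reflect (T (vl x)) (rcl_le 0 x).
Proof. by apply: (iffP (asboolP _)); rewrite rmorph0 subr0. Qed.

Let lex0 (x : R) : rcl_le x 0 = rcl_le 0 (- x).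
Proof. by rewrite /rcl_le !rmorph0 rmorphN sub0r subr0. Qed.

Lemma rcl_le0D x y : rcl_le 0 x -> rcl_le 0 y -> rcl_le 0 (x + y).
Proof. by move=> /le0P x0 /le0P y0; apply/le0P; rewrite rmorphD; apply: (po_D h.1). Qed.
Lemma rcl_le0M x y : rcl_le 0 x -> rcl_le 0 y -> rcl_le 0 (x * y).
Proof. by move=> /le0P x0 /le0P y0; apply/le0P; rewrite rmorphM; apply: (po_M h.1). Qed.
Lemma rcl_anti x : rcl_le 0 x -> rcl_le x 0 -> x = 0.
Proof.
rewrite lex0 => /le0P Tx /le0P; rewrite rmorphN => TNx.
by apply: val_inj; rewrite rmorph0; apply: (po_anti h.1).
Qed.
Lemma rcl_sub_ge0 x y : rcl_le 0 (y - x) = rcl_le x y.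
Proof. by rewrite /rcl_le rmorph0 subr0 rmorphB. Qed.
Lemma rcl_tot x : rcl_le 0 x || rcl_le x 0.
Proof.
rewrite lex0; have [Tx|TNx] := algmax_total h.1 h.2 (sfvalP x).
  by apply/orP; left; apply/le0P.
by apply/orP; right; apply/le0P; rewrite rmorphN.
Qed.
Lemma rcl_normN x : rcl_norm (- x) = rcl_norm x.
Proof.
rewrite /rcl_norm opprK -lex0; have := rcl_tot x.
have [|xn] := boolP (rcl_le 0 x); have [|] := boolP (rcl_le x 0) => //.
by move=> x0 /rcl_anti/(_ x0)->; rewrite oppr0.
Qed.
Lemma rcl_ge0_norm x : rcl_le 0 x -> rcl_norm x = x.
Proof. by rewrite /rcl_norm => ->. Qed.

End Order.

HB.instance Definition _ h := Num.IntegralDomain_isLeReal.Build (rcl h)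
  (@rcl_le0D h) (@rcl_le0M h) (@rcl_anti h) (@rcl_sub_ge0 h) (@rcl_tot h)
  (@rcl_normN h) (@rcl_ge0_norm h) (fun _ _ => erefl).

Lemma rcl_ge0P h (x : rcl h) : reflect (T (val x)) (0 <= x).
Proof. by apply: (iffP (asboolP _)); rewrite rmorph0 subr0. Qed.

End RealClosed.

Section IVT.
Variables (K : closedFieldType) (T : K -> Prop) (h : preord T /\ algmax T).
Local Notation R := (rcl h).
Local Notation vl := (val : R -> K).
Local Notation ev a := (fun g : {poly R} => (map_poly vl g).[a]).
Implicit Types (p g : {poly R}) (l : seq (R * {poly R})).

Let irred_coprime p g a : irreducible_poly p -> (map_poly vl p).[a] = 0 ->
  (map_poly vl g).[a] != 0 -> coprimep p g.
Proof.
move=> [_ ip] pa; apply: contraNT => ncop; apply/eqP.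
have /ip : size (gcdp p g) != 1%N by [].
move=> /(_ (dvdp_gcdl _ _)) /andP[_ /dvdp_trans/(_ (dvdp_gcdr p g))].
by case/dvdpP=> q ->; rewrite rmorphM hornerM pa mulr0.
Qed.

Let irred_dvd p g a : irreducible_poly p -> (map_poly vl p).[a] = 0 ->
  (map_poly vl g).[a] = 0 -> p %| g.
Proof.
move=> ip pa ga; apply: contraT => pg; have [_ ip'] := ip.
have cop : coprimep p g.
  apply: contraNT pg => /ip'/(_ (dvdp_gcdl _ _)) /andP[_ /dvdp_trans].
  by apply; apply: dvdp_gcdr.
have /Bezout_eq1_coprimepP[[u v] /= e] := cop.
have /eqP := congr1 (ev a) e; rewrite rmorphD !rmorphM rmorph1 /= hornerD !hornerM hornerC.
by rewrite pa ga !mulr0 addr0 eq_sym oner_eq0.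
Qed.

Lemma subfield_ev p a : irreducible_poly p -> (map_poly vl p).[a] = 0 ->
  subfield (fun x => exists g, x = (map_poly vl g).[a]).
Proof.
move=> ip pa; split.
- by exists 0; rewrite rmorph0 horner0.
- by exists 1; rewrite rmorph1 hornerC.
- move=> _ _ [f ->] [g ->]; split.
    by exists (f - g); rewrite rmorphB hornerD hornerN.
  by exists (f * g); rewrite rmorphM hornerM.
- move=> _ [g ->] g0.
  have /Bezout_eq1_coprimepP[[u v] /= e] := irred_coprime ip pa g0.
  exists v; have := congr1 (ev a) e.
  rewrite rmorphD !rmorphM rmorph1 /= hornerD !hornerM hornerC pa mulr0 add0r => e1.
  by apply: (mulIf g0); rewrite mulVf.
Qed.

Let sos l : {poly R} := \sum_(u <- l) u.1 *: u.2 ^+ 2.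

Let sos_horner l x : (sos l).[x] = \sum_(u <- l) u.1 * u.2.[x] ^+ 2.
Proof. by rewrite horner_sum; apply: eq_bigr => u _; rewrite hornerZ horner_exp. Qed.

(** The bound is 2n - 3. If a polynomial of size n divides the sum, the cofactor has size at most n
    - 2, which lets the induction in [no_sos] apply to it. *)
Let size_sos l n : (forall u, u \in l -> (size u.2 < n)%N) ->
  (size (sos l) <= n.*2.-2.-1)%N.
Proof.
move=> ln; rewrite /sos big_seq; elim/big_ind: _ => [|p q hp hq|u /ln un].
- by rewrite size_poly0.
- by rewrite (leq_trans (size_polyD _ _)) // geq_max hp.
- apply: leq_trans (size_scale_leq _ _) _; apply: leq_trans (size_polyMleq _ _) _.
  by case: (size u.2) un; lia.
Qed.

(* If f has a sign change and no root, and every smaller polynomial with a sign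
   change has a root, then f divides no nontrivial positive combination of squares:
   the cofactor would again change sign, and its root is common to all the squares. *)
Let no_sos f a b : irreducible_poly f -> (2 < size f)%N -> f.[a] * f.[b] < 0 ->
  (forall g, (size g < size f)%N -> g.[a] * g.[b] < 0 -> exists x, root g x) ->
  forall n l, (forall u, u \in l -> 0 < u.1 /\ (size u.2 < size f)%N) ->
  (exists2 u, u \in l & u.2 != 0) -> (\sum_(u <- l) size u.2 <= n)%N -> ~~ (f %| sos l).
Proof.
move=> [_ irf] sf fab IH; elim=> [|n IHn] l hl [u0 u0l u00] szl.
  exfalso; move: szl; rewrite (big_rem u0) //= leqn0 addn_eq0 => /andP[].
  by rewrite size_poly_eq0 (negbTE u00).
have [[r rl]|nor] := EM (exists r, forall u, u \in l -> root u.2 r).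
  pose l' := [seq (u.1, u.2 %/ ('X - r%:P)) | u <- l].
  have dl u : u \in l -> u.2 = u.2 %/ ('X - r%:P) * ('X - r%:P).
    by move=> /rl; rewrite root_factor_theorem => /divpK.
  have sz u : u \in l -> size (u.2 %/ ('X - r%:P)) = (size u.2).-1.
    by move=> _; rewrite size_divp ?polyXsubC_eq0 // size_XsubC subn1.
  have sl : sos l = sos l' * ('X - r%:P) ^+ 2.
    rewrite /sos big_map mulr_suml big_seq [RHS]big_seq; apply: eq_bigr => u ul /=.
    by rewrite {1}(dl u ul) exprMn scalerAl.
  rewrite sl Gauss_dvdpl; last first.
    apply: coprimep_expr; rewrite coprimep_XsubC.
    apply/negP; rewrite root_factor_theorem => /irf; rewrite size_XsubC => /(_ isT)/eqp_size.
    by rewrite size_XsubC => e; move: sf; rewrite -e.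
  apply: IHn.
  - by move=> _ /mapP[u ul ->] /=; have [u1 us] := hl u ul; split=> //; rewrite sz // (leq_ltn_trans (leq_pred _)).
  - exists (u0.1, u0.2 %/ ('X - r%:P)); first exact/map_f.
    by apply: contraNneq u00 => /= e; rewrite (dl u0 u0l) e mul0r.
  - rewrite big_map /=; rewrite (big_rem u0) //= in szl.
    rewrite (big_rem u0) //= sz // -ltnS; apply: leq_trans szl.
    rewrite -addSn prednK ?size_poly_gt0 // leq_add2l.
    by rewrite !big_seq; apply: leq_sum => u /mem_rem ul; rewrite sz ?leq_pred.
have pos x : 0 < (sos l).[x].
  have ge0 u : u \in l -> 0 <= u.1 * u.2.[x] ^+ 2.
    by move=> /hl[/ltW u1 _]; rewrite mulr_ge0 // sqr_ge0.
  rewrite lt_def sos_horner big_seq sumr_ge0 // andbT.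
  apply/eqP => /eqP; rewrite psumr_eq0 // => /allP e; apply: nor; exists x => u ul.
  have := e u ul; rewrite ul mulf_eq0 sqrf_eq0 (gt_eqF (hl u ul).1) /=.
  exact.
apply/negP => /dvdpP[g e].
have gf x : 0 < g.[x] * f.[x] by rewrite -hornerM -e.
have [] := IH g.
- have g0 : g != 0 by apply: contraTneq (gf 0) => ->; rewrite horner0 mul0r ltxx.
  have f0 : f != 0 by rewrite -size_poly_gt0; lia.
  have aux (s t : nat) : (2 < t)%N -> ((s + t).-1 <= t.*2.-2.-1)%N -> (s < t)%N by lia.
  by apply: aux sf _; rewrite -size_mul // -e; apply: size_sos => u /hl[].
- have := mulr_gt0 (gf a) (gf b); rewrite mulrACA.
  by rewrite nmulr_lgt0 // nmulr_llt0.
- by move=> x /rootP gx; have := gf x; rewrite gx mul0r ltxx.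
Qed.

(** Induction on the size of [p]. A [p] without root in the interval is irreducible, since in a
    factorisation some factor changes sign and has a root by induction. If its degree exceeds 1,
    then by [no_sos] the element -1 is not a positive sum of squares in R(al), so [al] lies in R,
    against irreducibility. *)
Lemma sign_change_root p a b : a < b -> p.[a] * p.[b] < 0 ->
  exists x, a < x < b /\ root p x.
Proof.
have [n] := ubnP (size p); elim: n => // n IH in p a b *; rewrite ltnS => sp ab pab.
apply: contrapT => nor.
have p0 : p != 0 by apply: contraTneq pab => ->; rewrite !horner0 mul0r ltxx.
have irp : irreducible_poly p.
  split.
    rewrite ltnNge; apply: contraTN pab => /size1_polyC ->.
    by rewrite !hornerC -leNgt -expr2 sqr_ge0.
  move=> q sq /dvdpP[g e].
  have q0 : q != 0 by apply: contra_neq p0 => q0; rewrite e q0 mulr0.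
  have g0 : g != 0 by apply: contra_neq p0 => g0; rewrite e g0 mul0r.
  have szp : size p = (size g + size q).-1 by rewrite e size_mul.
  have sq0 : (0 < size q)%N by rewrite size_poly_gt0.
  have sg0 : (0 < size g)%N by rewrite size_poly_gt0.
  have [sg1|sg1] := eqVneq (size g) 1%N.
    have /size_poly1P[c c0 gc] : size g == 1%N by rewrite sg1.
    by rewrite e gc mul_polyC eqp_sym eqp_scale.
  have aux (s t u : nat) : s = (t + u).-1 -> u != 1%N -> (0 < t)%N -> (0 < u)%N ->
    (s <= n)%N -> (t < n)%N by lia.
  exfalso; move: pab; rewrite e !hornerM mulrACA => pab.
  have [gab|gab] := ltP (g.[a] * g.[b]) 0.
    have [|x [xab gx]] := IH g a b _ ab gab; first exact: aux szp sq sg0 sq0 sp.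
    by apply: nor; exists x; rewrite xab e rootM gx.
  have qab : q.[a] * q.[b] < 0.
    by move: pab; apply: contraTT; rewrite -!leNgt; apply: mulr_ge0.
  have [|x [xab qx]] := IH q a b _ ab qab.
    by apply: aux sg1 sq0 sg0 sp; rewrite addnC.
  by apply: nor; exists x; rewrite xab e rootM qx orbT.
have noroot x : (2 < size p)%N -> ~~ root p x.
  move=> sp2; apply/negP; rewrite root_factor_theorem => /irp.2.
  by rewrite size_XsubC => /(_ isT)/eqp_size; rewrite size_XsubC => e2; move: sp2; rewrite -e2.
have [sp2|sp2] := leqP (size p) 2.
  have sp2' : size p = 2%N by apply/eqP; rewrite eqn_leq sp2; case: irp.
  have [c c0 [r pr]] : exists2 c, c != 0 & exists r, p = c *: ('X - r%:P).
    exists p`_1; first by rewrite -[1%N]/(2.-1) -sp2' -lead_coefE lead_coef_eq0.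
    exists (- p`_0 / p`_1); apply/polyP => i; rewrite coefZ coefB coefX coefC.
    have c0 : p`_1 != 0 by rewrite -[1%N]/(2.-1) -sp2' -lead_coefE lead_coef_eq0.
    case: i => [|[|i]] /=; rewrite ?sub0r ?subr0 ?mulr1 //.
      by rewrite mulNr opprK mulrCA divff // mulr1.
    by rewrite oppr0 mulr0 nth_default // sp2'.
  apply: nor; exists r; rewrite pr rootZ // root_XsubC eqxx; split=> //.
  move: pab; rewrite pr !hornerZ !hornerXsubC mulrACA pmulr_rlt0 ?mulf_gt0; last first.
    by rewrite -expr2 exprn_even_gt0.
  apply: contraTT; rewrite -leNgt negb_and -!leNgt => /orP[ra|br].
    by rewrite mulr_ge0 // subr_ge0 // (le_trans ra) // ltW.
  by rewrite mulr_le0 // subr_le0 // (le_trans _ br) // ltW.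
have /closed_rootP[al /rootP pal] : size (map_poly vl p) != 1%N.
  by rewrite size_map_poly; apply: contraTneq sp2 => ->.
pose N x := exists g, x = (map_poly vl g).[al].
have hN : subfield N by apply: subfield_ev pal.
have RN (x : R) : N (vl x) by exists x%:P; rewrite map_polyC hornerC.
have RT x : psub T x -> exists r : R, x = vl r.
  move=> px; have xs : x \in sfpred (subfield_psub h.1) by apply/sfpredP.
  by exists (SField xs).
suff /RT[r re] : psub T al.
  case/negP: (noroot r sp2); apply/rootP/(fmorph_inj vl).
  by rewrite rmorph0 -horner_map /= -re.
apply: (algmax_sqcone h.1 h.2 hN).
- by move=> x Tx; have [r ->] := RT x (po_psub h.1 Tx).
- move=> _ [g ->]; have hTal := subfield_acl T.
  have vT (r : R) : acl T (vl r).
    change (acl T (sfval r)); have [u [v [Tu Tv ->]]] := sfvalP r; have [_ _ Fb _] := hTal.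
    by case: (Fb u v) => //; apply: acl_incl.
  apply/(sfpredP hTal); apply: rpred_horner.
    by apply/polyOverP => i; rewrite coef_map; apply/sfpredP; apply: vT.
  apply/sfpredP; apply: (acl_root (p := map_poly vl p)) => //; first by rewrite map_poly_eq0.
  by move=> i; rewrite coef_map; apply: vT.
- have mz (c : R) g : map_poly vl (c *: g ^+ 2) = vl c *: (map_poly vl g) ^+ 2.
    by rewrite map_polyZ rmorphXn.
  move=> [l [hl e]].
  have [l' [hl' e']] : exists l' : seq (R * {poly R}),
      (forall u, u \in l' -> 0 < u.1 /\ (size u.2 < size p)%N) /\
      \sum_(u <- l) u.1 * u.2 ^+ 2 = (map_poly vl (sos l')).[al].
    elim: l hl {e} => [|[t s] l IHl] hl.
      by exists [::]; rewrite /sos !big_nil rmorph0 horner0.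
    have [l' [hl' e']] := IHl (fun u ul => hl u (mem_behead (s := _ :: l) ul)).
    have [Tt [g sg]] : T t /\ N s by apply: (hl (t, s)); rewrite mem_head.
    have [->|t0] := eqVneq t 0; first by exists l'; rewrite big_cons mul0r add0r.
    have [r tr] := RT t (po_psub h.1 Tt).
    exists ((r, g %% p) :: l'); split=> [u|].
      rewrite inE => /orP[/eqP-> /=|/hl'//]; rewrite ltn_modp p0; split=> //.
      rewrite lt_def; apply/andP; split; last by apply/rcl_ge0P; rewrite /= -tr.
      by apply: contraNneq t0 => r0; rewrite tr r0 rmorph0.
    rewrite big_cons e' /sos big_cons.
    rewrite rmorphD hornerD; congr (_ + _); apply/esym.
    transitivity (map_poly vl (r *: (g %% p) ^+ 2)).[al] => //.
    rewrite mz hornerZ horner_exp -tr; congr (t * _ ^+ 2).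
    by rewrite sg [in RHS](divp_eq g p) rmorphD rmorphM hornerD hornerM pal mulr0 add0r.
  (* An expression of -1 as a positive sum of squares in R(al) lifts, after reduction modulo [p], to
     a sum 1 + ... divisible by [p]. *)
  have : p %| sos ((1, 1) :: l').
    apply: irred_dvd irp pal _; rewrite {1}/sos big_cons rmorphD hornerD -/(sos l') -e' -e.
    transitivity ((map_poly vl (1 *: 1 ^+ 2)).[al] - 1) => //.
    by rewrite mz hornerZ horner_exp !rmorph1 hornerC expr1n mul1r subrr.
  apply/negP; apply: (no_sos irp sp2 pab _ _ _ (leqnn _)).
  - move=> g sg /(IH g a b) []// ; first exact: leq_trans sg sp.
    by move=> x [_ gx]; exists x.
  - move=> u /[!inE]/orP[/eqP-> /=|/hl'//]; rewrite ltr01 size_poly1; split=> //.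
    exact: leq_trans sp2.
  - by exists (1, 1); rewrite ?mem_head ?oner_eq0.
- by exists 'X; rewrite map_polyX hornerX.
Qed.

Lemma rcl_ivt : Num.real_closed_axiom R.
Proof.
move=> p a b le_ab /andP[pa pb].
have [ra|ra] := boolP (root p a); first by exists a; rewrite ?lexx.
have [rb|rb] := boolP (root p b); first by exists b; rewrite ?lexx ?andbT.
have ltab : a < b.
  rewrite lt_neqAle le_ab andbT; apply: contraNneq ra => e; apply/rootP/eqP.
  by rewrite eq_le pa e.
have [|x [/andP[ax xb] px]] := @sign_change_root p a b ltab.
  by rewrite nmulr_rlt0 lt_def ?pb ?pa ?andbT // eq_sym.
by exists x; rewrite ?ltW.
Qed.

End IVT.

HB.instance Definition _ (K : closedFieldType) (T : K -> Prop) h :=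
  Num.RealField_isClosed.Build (@rcl K T h) (@rcl_ivt K T h).

Section ComplexEmbedding.
Variables (K : closedFieldType) (T : K -> Prop) (h : preord T /\ algmax T).
Variables (i : K) (hi : i ^+ 2 = -1).
Local Notation R := (rcl h).
Local Notation vl := (val : R -> K).

Definition cembed (_ : i ^+ 2 = -1) (z : R[i]) : K :=
  vl (complex.Re z) + i * vl (complex.Im z).

Lemma cembed_zmod : zmod_morphism (cembed hi).
Proof.
move=> [a b] [c d]; change (vl (a - c) + i * vl (b - d) = vl a + i * vl b - (vl c + i * vl d)).
by rewrite !rmorphB; ring.
Qed.

Lemma cembed_monoid : monoid_morphism (cembed hi).
Proof.
split.
  by change (vl 1 + i * vl 0 = 1); rewrite rmorph1 rmorph0 mulr0 addr0.
move=> [a b] [c d]; change (vl (a * c - b * d) + i * vl (a * d + b * c) =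
  (vl a + i * vl b) * (vl c + i * vl d)); rewrite !(rmorphB, rmorphD, rmorphM).
have -> : (vl a + i * vl b) * (vl c + i * vl d) =
  vl a * vl c + i ^+ 2 * (vl b * vl d) + i * (vl a * vl d + vl b * vl c) by ring.
by rewrite hi; ring.
Qed.

HB.instance Definition _ := GRing.isZmodMorphism.Build _ _ (cembed hi) cembed_zmod.
HB.instance Definition _ := GRing.isMonoidMorphism.Build _ _ (cembed hi) cembed_monoid.

Lemma gen_psub x : gen T x -> psub T x.
Proof. by apply; [apply: subfield_psub h.1|move=> y; apply: (po_psub h.1)]. Qed.

(** R[i] is algebraically closed because R is real closed. A polynomial over R therefore splits in
    R[i], and [cembed] maps its roots onto all its roots in [K]. *)
Lemma acl_re_im z : acl T z -> exists x y, [/\ psub T x, psub T y & z = x + i * y].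
Proof.
move=> /(algover_mono gen_psub)/(algoverP (subfield_psub h.1))[p p0 /rootP pz].
pose p' : {poly R} := p; pose q := map_poly (real_complex R) p'.
have q0 : q != 0 by rewrite map_poly_eq0.
have qz : (map_poly (cembed hi) q).[z] = 0.
  rewrite -[RHS]pz -map_poly_comp; congr (_.[z]); apply: eq_map_poly => x.
  by change (vl x + i * vl 0 = vl x); rewrite rmorph0 mulr0 addr0.
have [rs qrs] := closed_field_poly_normal q.
move/eqP: qz; rewrite qrs map_polyZ hornerZ mulf_eq0 fmorph_eq0 lead_coef_eq0 (negbTE q0) /=.
rewrite rmorph_prod horner_prod prodf_seq_eq0 => /hasP[c _ /=].
rewrite rmorphB /= map_polyX map_polyC hornerXsubC subr_eq0 => /eqP->.
by exists (vl (complex.Re c)), (vl (complex.Im c)); split=> //; apply: sfvalP.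
Qed.

End ComplexEmbedding.

(** * Adjoining a positive infinitesimal *)

Section InfinitesimalExtension.
Variables (K : fieldType) (T : K -> Prop) (b : K).
Hypotheses (h : preord T) (nb : ~ acl T b).
Implicit Types f g u v : {poly K}.
Let F := psub T.
Let hF : subfield F := subfield_psub h.

(** The lowest nonzero coefficient of [f] is positive, which is the sign of f(b) for a positive
    infinitesimal [b]. *)
Let pos f := exists k u, [/\ f = 'X^k * u, T u.[0] & u.[0] != 0].

Let posD f g : pos f -> pos g -> pos (f + g).
Proof.
move=> [k [u [-> Tu u0]]] [l [v [-> Tv v0]]].
wlog le : k l u v Tu Tv u0 v0 / (k <= l)%N.
  by move=> H; have [kl|/ltnW lk] := leqP k l; [|rewrite addrC]; apply: H.
exists k, (u + 'X^(l - k) * v); split.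
- by rewrite mulrDr mulrA -exprD subnKC.
- rewrite hornerD hornerM hornerXn expr0n; case: (l - k)%N => [|n]; rewrite ?mul1r ?mul0r ?addr0 //.
  exact: (po_D h).
- rewrite hornerD hornerM hornerXn expr0n; case: (l - k)%N => [|n]; rewrite ?mul1r ?mul0r ?addr0 //.
  apply: contra_neq u0 => e; apply: (po_anti h) => //.
  by move/eqP: e; rewrite addr_eq0 => /eqP->; rewrite opprK.
Qed.

Let posM f g : pos f -> pos g -> pos (f * g).
Proof.
move=> [k [u [-> Tu u0]]] [l [v [-> Tv v0]]]; exists (k + l)%N, (u * v).
by rewrite exprD mulrACA !hornerM mulf_neq0 //; split=> //; apply: (po_M h).
Qed.

Let pos_neq0 f : pos f -> f != 0.
Proof.
move=> [k [u [-> _ u0]]]; rewrite mulf_neq0 ?expf_neq0 ?polyX_eq0 //.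
by apply: contra_neq u0 => ->; rewrite horner0.
Qed.

Let pos_sq g : pover F g -> g != 0 -> pos (g ^+ 2).
Proof.
move=> Fg g0; have [k [u nu e]] := multiplicity_XsubC g 0.
rewrite subr0 in e; exists (k * 2)%N, (u ^+ 2); rewrite !horner_exp.
have u0 : u.[0] != 0 by move: nu; rewrite g0.
rewrite expf_neq0 //; split=> //; first by rewrite e exprMn mulrC -exprM.
apply: psub_sq => //; have -> : u.[0] = g`_k; last exact: Fg.
by rewrite e mulrC coefXnM ltnn subnn horner_coef0.
Qed.

(** The order on F(b) in which [b] is a positive infinitesimal. Squared denominators spare a
    discussion of their sign. *)
Definition inf_ext x := exists f g,
  [/\ pover F f, pover F g, g != 0, f = 0 \/ pos f & x = f.[b] / g.[b] ^+ 2].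

Let nz g : pover F g -> g != 0 -> g.[b] != 0.
Proof.
move=> Fg g0; apply/eqP => gb; apply: nb; exists g; split=> // i.
have [u [v [Tu Tv ->]]] := Fg i; have [_ _ s _] := subfield_gen T.
by case: (s u v) => //; apply: gen_incl.
Qed.

Let FP f : pover F f <-> f \is a polyOver (sfpred hF).
Proof. exact: poverP. Qed.

Lemma inf_ext_gen x : inf_ext x -> gen (adds T [:: b]) x.
Proof.
move=> [f [g [Ff Fg g0 _ ->]]]; have hG := subfield_gen (adds T [:: b]).
have G p : pover F p -> gen (adds T [:: b]) p.[b].
  move=> Fp; apply/(sfpredP hG); apply: rpred_horner; last first.
    by apply/sfpredP; apply: gen_incl; right; rewrite inE.
  apply/polyOverP => j; apply/sfpredP; have [u [v [Tu Tv ->]]] := Fp j.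
  by have [_ _ s _] := hG; case: (s u v) => //; apply: gen_incl; left.
by apply/(sfpredP hG); apply: rpred_div; [|apply: rpredX]; apply/sfpredP; apply: G.
Qed.

Let inf_const c : F c -> pover F c%:P.
Proof. by move=> Fc; apply/FP; rewrite polyOverC; apply/sfpredP. Qed.

Let F1 : pover F 1.
Proof. by apply: inf_const; case: hF. Qed.

Lemma inf_ext_incl x : T x -> inf_ext x.
Proof.
move=> Tx; exists x%:P, 1; rewrite !hornerC expr1n divr1 oner_eq0; split=> //.
  by apply: inf_const; apply: po_psub.
have [->|x0] := eqVneq x 0; first by left.
by right; exists 0%N, x%:P; rewrite mul1r hornerC.
Qed.

Lemma inf_ext_gt0 : inf_ext b.
Proof.
exists 'X, 1; rewrite hornerC hornerX expr1n divr1 oner_eq0; split=> //.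
  by apply/FP/polyOverX.
by right; exists 1%N, 1; rewrite mulr1 hornerC oner_eq0; split=> //; apply: po_1.
Qed.

Lemma inf_ext_lt p : T p -> p != 0 -> inf_ext (p - b).
Proof.
move=> Tp p0; exists (p%:P - 'X), 1.
rewrite !hornerC expr1n divr1 oner_eq0 hornerD hornerN hornerX hornerC; split=> //.
  by apply/FP/rpredB; [apply/FP; apply: inf_const; apply: po_psub|apply: polyOverX].
by right; exists 0%N, (p%:P - 'X); rewrite mul1r hornerD hornerN hornerX hornerC subr0.
Qed.

Lemma preord_inf_ext : preord inf_ext.
Proof.
have M x y : inf_ext x -> inf_ext y -> inf_ext (x * y).
  move=> [f [g [Ff Fg g0 pf ->]]] [f' [g' [Ff' Fg' g'0 pf' ->]]].
  exists (f * f'), (g * g'); rewrite !hornerM exprMn mulf_neq0 //; split=> //.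
  - by apply/FP/rpredM; apply/FP.
  - by apply/FP/rpredM; apply/FP.
  - by case: pf pf' => [->|pf] [->|pf']; rewrite ?mul0r ?mulr0; auto; right; apply: posM.
  - by field; rewrite !nz.
split=> //.
- by apply: inf_ext_incl; apply: po_1.
- move=> x y [f [g [Ff Fg g0 pf ->]]] [f' [g' [Ff' Fg' g'0 pf' ->]]].
  exists (f * g' ^+ 2 + f' * g ^+ 2), (g * g').
  rewrite hornerD !hornerM mulf_neq0 //; split=> //.
  - by apply/FP/rpredD; apply/rpredM; try apply/rpredX; apply/FP.
  - by apply/FP/rpredM; apply/FP.
  - have pg := pos_sq Fg g0; have pg' := pos_sq Fg' g'0.
    case: pf pf' => [->|pf] [->|pf']; rewrite ?mul0r ?addr0 ?add0r; [by left|right..];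
      try exact: posM; by apply: posD; apply: posM.
  - by field; rewrite !nz.
- move=> x [f [g [Ff Fg g0 pf ->]]]; case: pf => [->|pf].
    by rewrite horner0 mul0r invr0; apply: inf_ext_incl; apply: po_0.
  have f0 := pos_neq0 pf; exists (f * g ^+ 2), f; split=> //.
  - by apply/FP/rpredM; [apply/FP|apply/rpredX/FP].
  - by right; apply: posM => //; apply: pos_sq.
  - by rewrite hornerM horner_exp; field; rewrite !nz.
- move=> [f [g [Ff Fg g0 pf e]]].
  have fg0 : f + g ^+ 2 != 0.
    case: pf => [->|pf]; first by rewrite add0r expf_neq0.
    by apply: pos_neq0; apply: posD => //; apply: pos_sq.
  have : pover F (f + g ^+ 2) by apply/FP/rpredD; [|apply/rpredX]; apply/FP.
  move/nz/(_ fg0)/eqP; apply; rewrite hornerD horner_exp.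
  have gb := nz Fg g0; have -> : f.[b] = - g.[b] ^+ 2; last by rewrite addNr.
  by rewrite -mulN1r e divfK // expf_neq0.
- move=> x y [f [g [Ff Fg g0 _ ->]]] [f' [g' [Ff' Fg' g'0 _ ->]]].
  pose d := f * g' ^+ 2 - f' * g ^+ 2.
  have Fd : pover F d by apply/FP/rpredB; apply/rpredM; try apply/rpredX; apply/FP.
  exists (d ^+ 2), (g ^+ 2 * g' ^+ 2); split.
  - by apply/FP/rpredX/FP.
  - by apply/FP/rpredM; apply/rpredX/FP.
  - by rewrite mulf_neq0 // expf_neq0.
  - by have [->|d0] := eqVneq d 0; [left; rewrite expr0n|right; apply: pos_sq].
  - rewrite /d !(hornerM, hornerD, hornerN).
    by field; rewrite !nz.
Qed.

End InfinitesimalExtension.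

(** The maximal preorder is sought among those algebraic over [A] and the members of [B] that they
    already contain. A member of [B] left out would then be transcendental over the cone and could
    be adjoined as an infinitesimal, against maximality. So all of [B] becomes positive. *)
Lemma algmax_extension (K : fieldType) (A B T0 : K -> Prop) :
  preord T0 -> (forall x, T0 x -> acl A x) ->
  (forall b, B b -> ~ acl (fun x => A x \/ (B x /\ x <> b)) b) ->
  exists T, [/\ preord T /\ algmax T, forall x, T0 x -> T x, forall b, B b -> T b &
    forall x, T x -> acl (fun x => A x \/ B x) x].
Proof.
move=> h0 T0A iB.
pose Q T := preord T /\ forall x, T x -> acl (fun y => A y \/ (B y /\ T y)) x.
have Q0 : Q T0 by split=> // x /T0A; apply: acl_mono => y; left.
have [Ch [T1 ChT1] ChQ tot|M [[hM MA] T0M mM]] := zorn_sets Q0.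
  split; first by apply: po_chain => //; [exists T1|move=> T /ChQ[]].
  move=> x [T [ChT Tx]]; have [_ TA] := ChQ T ChT; apply: acl_mono (TA x Tx) => y.
  by case=> [|[By Ty]]; [left|right; split=> //; exists T].
have mxM : algmax M.
  move=> T' hT' MT' T'M; apply: mM => //; split=> // x /T'M; apply: acl_sub => y /MA.
  by apply: acl_mono => z [|[Bz Mz]]; [left|right; split=> //; apply: MT'].
have BM b : B b -> M b.
  move=> Bb; apply: contrapT => nMb.
  have nb : ~ acl M b.
    move=> Mb; apply: (iB b Bb); move: Mb; apply: acl_sub => y /MA; apply: acl_mono => z.
    by case=> [|[Bz Mz]]; [left|right; split=> // e; apply: nMb; rewrite -e].
  apply: nMb; apply: (mM (inf_ext M b)); [|exact: inf_ext_incl|exact: inf_ext_gt0].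
  split; first exact: preord_inf_ext.
  move=> x /inf_ext_gen/acl_gen; apply: acl_sub => y [/MA|/[!inE]/eqP->].
    by apply: acl_mono => z [|[Bz Mz]]; [left|right; split=> //; apply: inf_ext_incl].
  by apply: acl_incl; right; split=> //; apply: inf_ext_gt0.
exists M; split=> // x /MA; apply: acl_mono => y; tauto.
Qed.

Lemma rational_preord (K : fieldType) : [pchar K] =i pred0 ->
  exists T : K -> Prop, preord T /\ forall A x, T x -> acl A x.
Proof.
move=> /pcharf0P ch; pose T (x : K) := exists m n : nat, n != 0 /\ x = m%:R / n%:R.
have nz n : n != 0%N -> n%:R != 0 :> K by rewrite ch.
exists T; split; last first.
  move=> A _ [m [n [n0 ->]]]; have hA := subfield_acl A.
  by apply/(sfpredP hA)/rpred_div; apply: rpred_nat.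
split.
- by exists 1%N, 1%N; rewrite divr1.
- move=> _ _ [m [n [n0 ->]]] [m' [n' [n'0 ->]]].
  exists (m * n' + m' * n)%N, (n * n')%N; rewrite muln_eq0 negb_or n0; split=> //.
  by rewrite !(natrD, natrM); field; rewrite !nz.
- move=> _ _ [m [n [n0 ->]]] [m' [n' [n'0 ->]]].
  exists (m * m')%N, (n * n')%N; rewrite muln_eq0 negb_or n0; split=> //.
  by rewrite !natrM; field; rewrite !nz.
- move=> _ [m [n [n0 ->]]]; have [->|m0] := eqVneq m 0%N.
    by exists 0%N, 1%N; rewrite mul0r invr0 mul0r.
  by exists n, m; rewrite invf_div.
- move=> [m [n [n0 e]]]; have : (m + n)%:R == 0 :> K.
    by rewrite natrD -[m%:R](divfK (nz n n0)) -e mulN1r addNr.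
  by rewrite ch addn_eq0 (negbTE n0) andbF.
- move=> _ _ [m [n [n0 ->]]] [m' [n' [n'0 ->]]].
  pose a := (m * n')%N; pose c := (m' * n)%N.
  exists ((a - c) ^ 2 + (c - a) ^ 2)%N, ((n * n') ^ 2)%N.
  rewrite expn_eq0 muln_eq0 !negb_or n0 n'0; split=> //.
  have -> : ((a - c) ^ 2 + (c - a) ^ 2)%:R = (a%:R - c%:R) ^+ 2 :> K.
    have [ac|/ltnW ca] := leqP a c.
      by rewrite (eqP ac) add0n natrX natrB // -sqrrN opprB.
    by rewrite (eqP ca) addn0 natrX natrB.
  by rewrite /a /c natrX !natrM; field; rewrite !nz.
Qed.

(** * A chain of real closed fields *)

Lemma dependent_sequence (A : Type) (Inv : nat -> A -> Prop) (Rel : nat -> A -> A -> Prop) :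
  (exists a, Inv 0%N a) ->
  (forall n a, Inv n a -> exists b, Inv n.+1 b /\ Rel n a b) ->
  exists f : nat -> A, forall n, Inv n (f n) /\ Rel n (f n) (f n.+1).
Proof.
move=> [a0 Inv0] step.
have /choice[g gP] (u : nat * A) :
    exists b, Inv u.1 u.2 -> Inv u.1.+1 b /\ Rel u.1 u.2 b.
  have [/step[b hb]|nI] := EM (Inv u.1 u.2); first by exists b.
  by exists u.2.
pose f := fix f n := if n is m.+1 then g (m, f m) else a0.
have If n : Inv n (f n) by elim: n => //= n /(gP (n, f n))[].
by exists f => n; split=> //; case: (gP (n, f n) (If n)).
Qed.

(** The infinitesimal [t n] is adjoined first, directly over T_n. The inequalities between it and
    the positive elements of T_n then survive, because the later extension only enlarges the
    cone. *)
Lemma real_closed_chain (K : fieldType) (B : nat -> K -> Prop) (t : nat -> K) (C : K -> Prop) :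
  [pchar K] =i pred0 -> indepset C -> (forall n x, B n x -> C x) ->
  (forall n x, B n x -> B n.+1 x) -> (forall n, B n.+1 (t n)) -> (forall n, ~ B n (t n)) ->
  exists T : nat -> K -> Prop, forall n,
    [/\ preord (T n) /\ algmax (T n), forall x, T n x -> acl (B n) x,
        forall x, B n x -> T n x, forall x, T n x -> T n.+1 x &
        forall p, T n p -> p != 0 -> T n.+1 (p - t n)].
Proof.
move=> ch iC BC BS Bt nBt.
pose Inv n T := [/\ preord T /\ algmax T, forall x, T x -> acl (B n) x & forall x, B n x -> T x].
pose Rel n (T T' : K -> Prop) := (forall x, T x -> T' x) /\
  (forall p, T p -> p != 0 -> T' (p - t n)).
have iB n b : B n b -> ~ acl (fun x => C x /\ x <> b) b by move=> /BC/iC.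
have [||T hT] := @dependent_sequence _ Inv Rel.
- have [Q [hQ Qacl]] := rational_preord ch.
  have [||T [hT QT BT TB]] := @algmax_extension _ (fun _ => False) (B 0%N) Q hQ.
  + by move=> x; apply: Qacl.
  + move=> b Bb ab; apply: (iB 0%N b Bb); apply: acl_mono ab => x [//|[/BC]]; by split.
  by exists T; split=> // x /TB; apply: acl_mono => y [].
- move=> n T [[hT mT] TB BT].
  have nTt : ~ acl T (t n).
    move=> at_; apply: (iB n.+1 (t n) (Bt n)); move: at_; apply: acl_sub => x /TB.
    by apply: acl_mono => y By; split; [apply: BC By|move=> e; apply: (nBt n); rewrite -e].
  (* Only the variables that are new at this step and different from [t n] are still to be made
     positive. *)
  pose A x := B n x \/ x = t n; pose B' x := B n.+1 x /\ ~ A x.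
  have [||T' [hT' TT' BT' T'B]] := @algmax_extension _ A B' _ (preord_inf_ext hT nTt).
  + move=> x /inf_ext_gen/acl_gen; apply: acl_sub => y [/TB|/[!inE]/eqP->].
      by apply: acl_mono => z; left.
    by apply: acl_incl; right.
  + move=> b [Bb nAb] ab; apply: (iB n.+1 b Bb); apply: acl_mono ab => x [Ax|[[Bx _] xb]].
      split; last by move=> e; apply: nAb; rewrite -e.
      by case: Ax => [/BC//|->]; apply: BC (Bt n).
    by split=> //; apply: BC Bx.
  exists T'; split.
    split=> // x.
      move=> /T'B; apply: acl_mono => y [[/BS//|->]|[]//]; exact: Bt.
    move=> Bx; have [Ax|nAx] := EM (A x); last exact: BT'.
    apply: TT'; case: Ax => [/BT|->]; first exact: inf_ext_incl.
    exact: inf_ext_gt0.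
  split=> [x Tx|p Tp p0]; apply: TT'; first exact: inf_ext_incl.
  exact: inf_ext_lt.
by exists T => n; have [[h1 h2 h3] [h4 h5]] := hT n.
Qed.

(** What the union of the chain must supply in order to turn [K] into a numerical closed field: a
    total cone on its real part, real and imaginary parts, and square roots for the norm. *)
Record rcstruct (K : closedFieldType) := RCStruct {
  rc_T : K -> Prop; rc_i : K;
  rc_preord : preord rc_T;
  rc_sqri : rc_i ^+ 2 = -1;
  rc_total : forall x, psub rc_T x -> rc_T x \/ rc_T (- x);
  rc_reim : forall z, exists x y, [/\ psub rc_T x, psub rc_T y & z = x + rc_i * y];
  rc_sqrt : forall x, rc_T x -> exists y, rc_T y /\ x = y ^+ 2 }.

Definition numK (K : closedFieldType) (S : rcstruct K) : Type := K.
HB.instance Definition _ (K : closedFieldType) (S : rcstruct K) :=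
  GRing.ClosedField.copy (numK S) K.

Section NumClosed.
Variables (K : closedFieldType) (S : rcstruct K).
Local Notation T := (rc_T S).
Local Notation i := (rc_i S).
Let h : preord T := rc_preord S.
Let hF := subfield_psub h.
Implicit Types x y z : numK S.

Let reim_ex z : exists p : K * K, [/\ psub T p.1, psub T p.2 & z = p.1 + i * p.2].
Proof. by have [x [y [hx hy e]]] := rc_reim S z; exists (x, y). Qed.

Let re z : K := (sval (cid (reim_ex z))).1.
Let im z : K := (sval (cid (reim_ex z))).2.
Let re_psub z : psub T (re z). Proof. by case: (svalP (cid (reim_ex z))). Qed.
Let im_psub z : psub T (im z). Proof. by case: (svalP (cid (reim_ex z))). Qed.
Let reimE z : z = re z + i * im z. Proof. by case: (svalP (cid (reim_ex z))). Qed.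

Let FB x y : psub T x -> psub T y -> psub T (x - y).
Proof. by have [_ _ s _] := hF; move=> hx /(s x _ hx)[]. Qed.
Let FM x y : psub T x -> psub T y -> psub T (x * y).
Proof. by have [_ _ s _] := hF; move=> hx /(s x _ hx)[]. Qed.
Let FT x : T x -> psub T x. Proof. exact: po_psub. Qed.
Let FN x : psub T x -> psub T (- x).
Proof. by move=> hx; rewrite -sub0r; apply: FB => //; apply: FT; apply: po_0. Qed.
Let FD x y : psub T x -> psub T y -> psub T (x + y).
Proof. by move=> hx hy; rewrite -[y]opprK; apply: FB => //; apply: FN. Qed.
Let sq x : psub T x -> T (x ^+ 2). Proof. exact: psub_sq. Qed.

Let reim_uniq (a b c d : K) : psub T a -> psub T b -> psub T c -> psub T d ->
  a + i * b = c + i * d -> a = c /\ b = d.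
Proof.
move=> ha hb hc hd e; have e1 : a - c = i * (d - b).
  by apply/eqP; rewrite -subr_eq0; apply/eqP; transitivity (a + i * b - (c + i * d));
    [ring|rewrite e subrr].
have ac : (a - c) ^+ 2 = 0.
  apply: (po_anti h); first by apply: sq; apply: FB.
  by rewrite e1 exprMn rc_sqri mulN1r opprK; apply: sq; apply: FB.
have {}ac : a = c by apply/eqP; rewrite -subr_eq0 -sqrf_eq0 ac.
split=> //; move/eqP: e1; rewrite ac subrr eq_sym mulf_eq0 subr_eq0.
have /negbTE-> : i != 0 by rewrite -sqrf_eq0 rc_sqri oppr_eq0 oner_eq0.
by move/eqP.
Qed.

Let reK (a b : K) : psub T a -> psub T b -> re (a + i * b) = a /\ im (a + i * b) = b.
Proof. by move=> ha hb; apply: reim_uniq => //; rewrite -reimE. Qed.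

Definition numK_conj z : numK S := re z - i * im z.

Lemma numK_conj_zmod : zmod_morphism numK_conj.
Proof.
move=> x y; have e : x - y = (re x - re y) + i * (im x - im y).
  by rewrite {1}[x]reimE {1}[y]reimE; ring.
have [e1 e2] := reK (FB (re_psub x) (re_psub y)) (FB (im_psub x) (im_psub y)).
by rewrite /numK_conj e e1 e2; ring.
Qed.

Lemma numK_conj_monoid : monoid_morphism numK_conj.
Proof.
have h0 : psub T 0 by apply: FT; apply: po_0.
have h1 : psub T 1 by apply: FT; apply: po_1.
split.
  have [] := reK h1 h0; rewrite mulr0 addr0 /numK_conj => -> ->.
  by rewrite mulr0 subr0.
move=> x y; set a := re x * re y - im x * im y; set b := re x * im y + im x * re y.
have e : x * y = a + i * b.
  transitivity (re x * re y + i ^+ 2 * (im x * im y) + i * b).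
    by rewrite {1}[x]reimE {1}[y]reimE /b; ring.
  by rewrite rc_sqri /a; ring.
have [e1 e2] : re (x * y) = a /\ im (x * y) = b.
  by rewrite e; apply: reK; [apply: FB|apply: FD]; apply: FM.
rewrite /numK_conj e1 e2.
transitivity (re x * re y + i ^+ 2 * (im x * im y) - i * b).
  by rewrite rc_sqri /a; ring.
by rewrite /b; ring.
Qed.

HB.instance Definition _ := GRing.isZmodMorphism.Build _ _ numK_conj numK_conj_zmod.
HB.instance Definition _ := GRing.isMonoidMorphism.Build _ _ numK_conj numK_conj_monoid.

Let nm z : K := re z ^+ 2 + im z ^+ 2.
Let nm_conj z : nm z = z * numK_conj z.
Proof.
transitivity (re z ^+ 2 - i ^+ 2 * im z ^+ 2); first by rewrite rc_sqri /nm; ring.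
by rewrite {3}[z]reimE /numK_conj; ring.
Qed.
Let nmM x y : nm (x * y) = nm x * nm y.
Proof. by rewrite !nm_conj rmorphM; ring. Qed.
Let nm_T z : T (nm z). Proof. by apply: (po_D h); apply: sq. Qed.

Let norm_ex z : exists y : K, T y /\ nm z = y ^+ 2. Proof. apply: rc_sqrt; apply: nm_T. Qed.
Definition numK_norm z : numK S := sval (cid (norm_ex z)).
Let norm_T z : T (numK_norm z). Proof. by case: (svalP (cid (norm_ex z))). Qed.
Let norm_sq z : numK_norm z ^+ 2 = nm z.
Proof. by case: (svalP (cid (norm_ex z))). Qed.

Let sqT_inj (a b : K) : T a -> T b -> a ^+ 2 = b ^+ 2 -> a = b.
Proof.
move=> Ta Tb /eqP; rewrite eqf_sqr => /orP[/eqP//|/eqP e].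
have b0 : b = 0.
  by apply: (po_anti h Tb); rewrite -e.
by rewrite e b0 oppr0.
Qed.

(** Only elements with real difference are comparable, the usual partial order of the complex
    numbers. *)
Definition numK_le x y : bool := `[< T (y - x) >].
Definition numK_lt x y : bool := (y != x) && numK_le x y.

Lemma numK_normM : {morph numK_norm : x y / x * y}.
Proof.
move=> x y; apply: sqT_inj => //; first by apply: (po_M h).
by rewrite exprMn !norm_sq nmM.
Qed.

Lemma numK_norm_eq0 x : numK_norm x = 0 -> x = 0.
Proof.
move=> x0; have := norm_sq x; rewrite x0 expr0n /= => e.
have r0 : re x ^+ 2 = 0.
  apply: (po_anti h); first exact: sq.
  have -> : - re x ^+ 2 = im x ^+ 2; last exact: sq.
  by apply/eqP; rewrite eq_sym -addr_eq0 addrC -[_ + _]e.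
have i0 : im x ^+ 2 = 0 by have := e; rewrite /nm r0 add0r => <-.
have {}r0 : re x = 0 by apply/eqP; rewrite -sqrf_eq0 r0.
have {}i0 : im x = 0 by apply/eqP; rewrite -sqrf_eq0 i0.
by rewrite [x]reimE r0 i0 mulr0 addr0.
Qed.

Let re_le z : T (numK_norm z - re z).
Proof.
have [//|T1] : T (numK_norm z - re z) \/ T (- (numK_norm z - re z : K)).
  by apply: rc_total; apply: FB => //; apply: FT.
rewrite opprB in T1; have Tr : T (re z).
  by rewrite -[re z](subrK (numK_norm z)); apply: (po_D h).
have e : (re z - numK_norm z) * (re z + numK_norm z) = - im z ^+ 2.
  transitivity (re z ^+ 2 - numK_norm z ^+ 2); first by ring.
  by rewrite norm_sq /nm; ring.
have i0 : im z ^+ 2 = 0.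
  apply: (po_anti h); first exact: sq.
  by rewrite -e; apply: (po_M h) => //; apply: (po_D h).
have -> : numK_norm z = re z by apply: sqT_inj => //; rewrite norm_sq /nm i0 addr0.
by rewrite subrr; apply: po_0.
Qed.

(** With w = x conj(y), the square of |x + y| minus the square of |x| + |y| is 2(Re w - |w|), which
    is at most 0 by [re_le]. If |x + y| were the larger, both squares would be equal. *)
Lemma numK_normD x y : numK_le (numK_norm (x + y)) (numK_norm x + numK_norm y).
Proof.
apply/asboolP; set a := numK_norm x + numK_norm y; set b := numK_norm (x + y).
have Ta : T a by apply: (po_D h).
have Tb : T b by apply: norm_T.
have [//|T1] : T (a - b) \/ T (- (a - b : K)).
  by apply: rc_total; apply: FB; apply: FT.
rewrite opprB in T1.
pose w : numK S := x * numK_conj y.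
have nw : numK_norm w = numK_norm x * numK_norm y.
  rewrite numK_normM; congr (_ * _); apply: sqT_inj => //; rewrite !norm_sq !nm_conj.
  have -> : numK_conj (numK_conj y) = y; last by rewrite mulrC.
  have [] := reK (re_psub y) (FN (im_psub y)); rewrite mulrN -/(numK_conj y) => e1 e2.
  by rewrite {1}/numK_conj e1 e2 mulrN opprK -reimE.
have rew : re w = re x * re y + im x * im y.
  have e : w = (re x * re y + im x * im y) + i * (im x * re y - re x * im y).
    transitivity (re x * re y - i ^+ 2 * (im x * im y) + i * (im x * re y - re x * im y)).
      by rewrite /w {1}[x]reimE /numK_conj; ring.
    by rewrite rc_sqri; ring.
  by rewrite e; apply: (reK _ _).1; [apply: FD|apply: FB]; apply: FM.
have [e1 e2] : re (x + y) = re x + re y /\ im (x + y) = im x + im y.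
  have -> : x + y = (re x + re y) + i * (im x + im y).
    by rewrite {1}[x]reimE {1}[y]reimE; ring.
  by apply: reK; apply: FD.
have e : b ^+ 2 - a ^+ 2 = 2%:R * (re w - numK_norm w).
  transitivity (b ^+ 2 - numK_norm x ^+ 2 - numK_norm y ^+ 2 - 2%:R * numK_norm w).
    by rewrite nw /a; ring.
  by rewrite !norm_sq rew /nm e1 e2; ring.
have T2 : T (b ^+ 2 - a ^+ 2).
  by rewrite subr_sqr; apply: (po_M h) => //; apply: (po_D h).
have ab : b ^+ 2 - a ^+ 2 = 0.
  apply: (po_anti h T2); rewrite e -mulrN opprB; apply: (po_M h) => //.
  by rewrite -[2%:R]/(1 + 1); apply: (po_D h); apply: po_1.
have -> : b = a by apply: sqT_inj => //; apply/eqP; rewrite -subr_eq0 ab.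
by rewrite subrr; apply: po_0.
Qed.

Lemma numK_addr_gt0 x y : numK_lt 0 x -> numK_lt 0 y -> numK_lt 0 (x + y).
Proof.
rewrite /numK_lt /numK_le !subr0 => /andP[x0 /asboolP Tx] /andP[y0 /asboolP Ty].
apply/andP; split; last by apply/asboolP; apply: (po_D h).
apply: contra_neq x0 => e; apply: (po_anti h) => //.
by move/eqP: e; rewrite addrC addr_eq0 => /eqP <-.
Qed.

Lemma numK_ger_total x y : numK_le 0 x -> numK_le 0 y -> numK_le x y || numK_le y x.
Proof.
rewrite /numK_le !subr0 => /asboolP Tx /asboolP Ty.
have [Td|Td] : T (y - x) \/ T (- (y - x : K)).
- by apply: rc_total; apply: FB; apply: FT.
- by apply/orP; left; apply/asboolP.
- by rewrite opprB in Td; apply/orP; right; apply/asboolP.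
Qed.

Lemma numK_le_def x y : numK_le x y = (numK_norm (y - x) == y - x).
Proof.
apply/asboolP/eqP => [Tw|<-]; last exact: norm_T.
apply: sqT_inj => //; rewrite norm_sq /nm.
have := reK (FT Tw) (FT (po_0 h)); rewrite mulr0 addr0 => -[-> ->].
by rewrite expr0n addr0.
Qed.

HB.instance Definition _ := Num.IntegralDomain_isNumRing.Build (numK S)
  numK_normD numK_addr_gt0 numK_norm_eq0 numK_ger_total numK_normM numK_le_def
  (fun _ _ => erefl).

Lemma numK_normCK x : `|x| ^+ 2 = x * numK_conj x.
Proof. by rewrite -nm_conj -norm_sq. Qed.

HB.instance Definition _ := Num.NumField_isImaginary.Build (numK S)
  (rc_sqri S) numK_normCK.

Lemma numK_geP x y : reflect (T (y - x)) (x <= y).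
Proof. exact: asboolP. Qed.

End NumClosed.

(** * Places and generic points *)

Lemma lead_cancel (F : fieldType) (p q : {poly F}) :
  q != 0 -> (size q <= size p)%N -> p != 0 ->
  (size (p - (lead_coef p / lead_coef q) *: ('X^(size p - size q) * q))%R < size p)%N.
Proof.
move=> q0 qp p0; have sp : (0 < size p)%N by rewrite size_poly_gt0.
have sq : (0 < size q)%N by rewrite size_poly_gt0.
rewrite -[X in (_ < X)%N](prednK sp) ltnS; apply/leq_sizeP => j jp.
rewrite coefB coefZ coefXnM; have -> : (j < size p - size q)%N = false by lia.
have [je|jn] := eqVneq j (size p).-1.
  have -> : (j - (size p - size q) = (size q).-1)%N by lia.
  by rewrite je -!lead_coefE divfK ?lead_coef_eq0 // subrr.
have aux (a c : nat) : (0 < a)%N -> (a.-1 <= j)%N -> j != a.-1 -> (c <= a)%N ->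
  (a <= j)%N && (c <= j - (a - c))%N by lia.
by have /andP[h1 h2] := aux _ _ sp jp jn qp; rewrite !nth_default ?mulr0 ?subrr.
Qed.

Section Places.
Variables (K : closedFieldType) (k : K -> Prop).
Hypotheses (hk : subfield k) (kc : forall x, algover k x -> k x).
Implicit Types (G : K * K -> Prop) (p q : {poly K}) (x y z a b : K).

(* A homomorphism from a subring of K to k is encoded by its graph G. *)
Definition phom G := [/\ forall c, k c -> G (c, c),
  forall x a b, G (x, a) -> G (x, b) -> a = b, forall x a, G (x, a) -> k a &
  forall x y a b, G (x, a) -> G (y, b) -> G (x - y, a - b) /\ G (x * y, a * b)].

Definition gpoly G p q := forall i, G (p`_i, q`_i).

Section OnePhom.
Variable G : K * K -> Prop.
Hypothesis hG : phom G.

Let G0 : G (0, 0). Proof. by case: hG => Gk _ _ _; apply: Gk; case: hk. Qed.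
Let G1 : G (1, 1). Proof. by case: hG => Gk _ _ _; apply: Gk; case: hk. Qed.
Let GB x y a b : G (x, a) -> G (y, b) -> G (x - y, a - b).
Proof. by case: hG => _ _ _ s gx gy; case: (s _ _ _ _ gx gy). Qed.
Lemma phomM x y a b : G (x, a) -> G (y, b) -> G (x * y, a * b).
Proof. by case: hG => _ _ _ s gx gy; case: (s _ _ _ _ gx gy). Qed.
Let GN x a : G (x, a) -> G (- x, - a).
Proof. by move=> gx; rewrite -sub0r -[- a]sub0r; apply: GB. Qed.
Let GD x y a b : G (x, a) -> G (y, b) -> G (x + y, a + b).
Proof. by move=> gx gy; rewrite -[y]opprK -[b]opprK; apply: GB => //; apply: GN. Qed.

Lemma phom_sum (I : Type) (r : seq I) (P : pred I) (f g : I -> K) :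
  (forall i, P i -> G (f i, g i)) -> G (\sum_(i <- r | P i) f i, \sum_(i <- r | P i) g i).
Proof.
move=> fg; elim: r => [|i r IH]; first by rewrite !big_nil.
by rewrite !big_cons; case: ifP => // Pi; apply: GD => //; apply: fg.
Qed.

Lemma phomX x a n : G (x, a) -> G (x ^+ n, a ^+ n).
Proof. by move=> gx; elim: n => [|n IH]; rewrite ?expr0 // !exprS; apply: phomM. Qed.

Lemma gpolyB p q p' q' : gpoly G p q -> gpoly G p' q' -> gpoly G (p - p') (q - q').
Proof. by move=> h h' i; rewrite !coefB; apply: GB. Qed.

Lemma gpolyM p q p' q' : gpoly G p q -> gpoly G p' q' -> gpoly G (p * p') (q * q').
Proof. by move=> h h' i; rewrite !coefM; apply: phom_sum => j _; apply: phomM. Qed.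

Lemma gpolyC x a : G (x, a) -> gpoly G x%:P a%:P.
Proof. by move=> gx i; rewrite !coefC; case: eqP. Qed.

Lemma gpolyXn n : gpoly G 'X^n 'X^n.
Proof. by move=> i; rewrite coefXn; case: eqP. Qed.

Lemma gpoly_k p : pover k p -> gpoly G p p.
Proof. by case: hG => Gk _ _ _ kp i; apply: Gk. Qed.

Lemma gpoly_over p q : gpoly G p q -> pover k q.
Proof. by case: hG => _ _ Gc _ pq i; apply: Gc (pq i). Qed.

Let inI z q := exists p, gpoly G p q /\ p.[z] = 0.

(** The images in k[X] of the relations of [z] form an ideal. Unless it contains 1, a nonzero
    element of least degree divides the others, and its root lies in [k] because [k] is relatively
    algebraically closed. *)
Let common_root z : ~ inI z 1 -> exists2 b, k b & forall q, inI z q -> q.[b] = 0.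
Proof.
move=> n1; have [[q0 [Iq0 q00]]|none] := EM (exists q, inI z q /\ q != 0); last first.
  exists 0; first by case: hk.
  move=> q Iq; have [->|q0] := eqVneq q 0; first by rewrite horner0.
  by case: none; exists q.
pose P n := `[< exists q, [/\ inI z q, q != 0 & size q = n] >].
have exP : exists n, P n by exists (size q0); apply/asboolP; exists q0.
have [n /asboolP[q [Iq qn0 <-]] minq] := ex_minnP exP.
have IM c d q1 q2 : k c -> inI z q1 -> inI z q2 -> inI z (q1 - c *: ('X^d * q2)).
  move=> kc' [p1 [g1 z1]] [p2 [g2 z2]]; exists (p1 - c%:P * ('X^d * p2)); split.
    rewrite -mul_polyC; apply: gpolyB => //; apply: gpolyM; last exact/gpolyM/g2/gpolyXn.
    by apply: gpolyC; case: hG => Gk _ _ _; apply: Gk.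
  by rewrite hornerD hornerN !hornerM z1 z2 !mulr0 subrr.
have kI q1 : inI z q1 -> pover k q1 by move=> [p [/gpoly_over]].
have kq1 q1 q2 : inI z q1 -> inI z q2 -> k (lead_coef q1 / lead_coef q2).
  move=> /kI k1 /kI k2; apply/(sfpredP hk)/rpred_div; apply/sfpredP; [exact: k1|exact: k2].
have sq : size q != 1%N.
  apply/eqP => sq1; apply: n1.
  have /size_poly1P[c c0 qc] : size q == 1%N by rewrite sq1.
  have := kI q Iq 0%N; rewrite qc coefC => kc1; case: Iq => p [gp pz].
  exists (c^-1%:P * p); split; last by rewrite hornerM pz mulr0.
  have -> : 1 = c^-1%:P * q by rewrite qc -polyCM mulVf.
  apply: gpolyM => //; apply: gpolyC; case: hG => Gk _ _ _; apply: Gk.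
  exact: subfieldV.
have /closed_rootP[b /rootP qb] := sq.
exists b; first by apply: kc; exists q; split=> //; apply: kI.
move=> q1; have [m] := ubnP (size q1); elim: m => // m IH in q1 *; rewrite ltnS => sq1 Iq1.
have [->|q10] := eqVneq q1 0; first by rewrite horner0.
have le : (size q <= size q1)%N by apply: minq; apply/asboolP; exists q1.
have := lead_cancel qn0 le q10; set r := q1 - _ => sr.
have := IH r (leq_trans sr sq1) (IM _ _ _ _ (kq1 _ _ Iq1 Iq) Iq1 Iq).
by rewrite /r hornerD hornerN hornerZ hornerM qb !mulr0 subr0.
Qed.

Hypothesis mG : forall G', phom G' -> (forall u, G u -> G' u) -> forall u, G' u -> G u.

(** If no relation of [z] reduced to 1, the images of its relations would have a common root [b] in
    [k], and z -> b would extend the maximal homomorphism. *)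
Lemma phom_max_ext z : ~ (exists a, G (z, a)) -> exists p, gpoly G p 1 /\ p.[z] = 0.
Proof.
move=> nz; apply: contrapT => n1; have [b kb Ib] := common_root n1.
apply: nz; exists b.
apply: (mG (G' := fun u => exists p q, gpoly G p q /\ u = (p.[z], q.[b]))).
- split.
  + move=> c kc'; exists c%:P, c%:P; rewrite !hornerC; split=> //; apply: gpoly_k => i.
    by rewrite coefC; case: eqP => // _; case: hk.
  + move=> x a c [p [q [pq [-> ->]]]] [p' [q' [pq' [e ->]]]].
    apply/eqP; rewrite -subr_eq0 -hornerN -hornerD; apply/eqP/Ib.
    by exists (p - p'); rewrite hornerD hornerN e subrr; split=> //; apply: gpolyB.
  + move=> x a [p [q [/gpoly_over kq [_ ->]]]]; apply/(sfpredP hk)/rpred_horner; last exact/sfpredP.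
    exact/(poverP hk).
  + move=> x y a c [p [q [pq [-> ->]]]] [p' [q' [pq' [-> ->]]]]; split.
      by exists (p - p'), (q - q'); rewrite !hornerD !hornerN; split=> //; apply: gpolyB.
    by exists (p * p'), (q * q'); rewrite !hornerM; split=> //; apply: gpolyM.
- by move=> [x a] gx; exists x%:P, a%:P; rewrite !hornerC; split=> //; apply: gpolyC.
- by exists 'X, 'X; rewrite !hornerX; split=> //; apply: (gpolyXn 1).
Qed.

(** The classical argument that a maximal homomorphism is defined at z or at 1/z. Reversing the
    shorter relation [q] gives a polynomial [Q] vanishing at [z]. In q_0 p - p_e Q the leading terms
    cancel, and since p_e maps to 0 and q_0 to 1 the result still reduces to 1, so the total size
    drops. *)
Let no_relation_pair n z p q : z != 0 -> (size p + size q <= n)%N ->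
  gpoly G p 1 -> p.[z] = 0 -> gpoly G q 1 -> q.[z^-1] = 0 -> False.
Proof.
have [_ Gf _ _] := hG.
elim: n z p q => [|n IH] z p q z0 sz gp pz gq qz.
  have p0 : p = 0 by apply/eqP; rewrite -size_poly_leq0; lia.
  have := gp 0%N; rewrite p0 coef0 coef1 => /(Gf _ _ _ G0)/eqP.
  by rewrite eq_sym oner_eq0.
wlog le : z p q z0 sz gp pz gq qz / (size q <= size p)%N.
  move=> H; have [|/ltnW] := leqP (size q) (size p); first exact: (H z).
  by apply: (H z^-1); rewrite ?invr_eq0 ?invrK // addnC.
pose e := (size p).-1.
have p0 : p != 0.
  apply/eqP => p0; have := gp 0%N; rewrite p0 coef0 coef1 => /(Gf _ _ _ G0)/eqP.
  by rewrite eq_sym oner_eq0.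
have sp : size p = e.+1 by rewrite /e prednK // size_poly_gt0.
pose Q := \poly_(j < e.+1) q`_(e - j); pose Q' : {poly K} := \poly_(j < e.+1) (1 : {poly K})`_(e - j).
have gQ : gpoly G Q Q' by move=> i; rewrite !coef_poly; case: ifP.
have Qz : Q.[z] = 0.
  have -> : Q.[z] = z ^+ e * q.[z^-1]; last by rewrite qz mulr0.
  rewrite horner_poly (horner_coef_wide (n := e.+1)) -?sp // sp mulr_sumr.
  rewrite (reindex_inj rev_ord_inj); apply: eq_bigr => j _ /=.
  have je : (j <= e)%N by rewrite -ltnS.
  rewrite subSS subKn // exprVn mulrCA; congr (_ * _).
  by rewrite expfB_cond // (negbTE z0).
have [e0|e0] := posnP e.
  have pc : p = (p`_0)%:P by apply: size1_polyC; rewrite sp e0.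
  have := gp 0%N; move: pz; rewrite pc hornerC coefC /= => ->.
  by rewrite coef1 => /(Gf _ _ _ G0)/eqP; rewrite eq_sym oner_eq0.
have gq0 : G (q`_0, 1) by have := gq 0%N; rewrite coef1.
have gpe : G (p`_e, 0) by have := gp e; rewrite coef1 gtn_eqF.
have g1 : gpoly G ((q`_0)%:P * p - (p`_e)%:P * Q) 1.
  have -> : 1 = 1%:P * 1 - 0%:P * Q' :> {poly K} by rewrite mul0r subr0 mulr1.
  by apply: gpolyB; apply: gpolyM => //; apply: gpolyC.
apply: (IH z _ q z0 _ g1 _ gq qz); last by rewrite hornerD hornerN !hornerM pz Qz !mulr0 subrr.
rewrite -ltnS; apply: leq_trans sz; rewrite ltn_add2r sp ltnS.
apply/leq_sizeP => j; rewrite coefB !coefCM leq_eqVlt => /orP[/eqP<-|ej].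
  by rewrite coef_poly ltnSn subnn mulrC subrr.
by rewrite coef_poly ltnS leqNgt ej /= (nth_default 0 (s := p)) ?sp // !mulr0 subrr.
Qed.

Lemma phom_max_valuation z : z != 0 -> (exists a, G (z, a)) \/ (exists a, G (z^-1, a)).
Proof.
move=> z0; have [|/phom_max_ext[p [gp pz]]] := EM (exists a, G (z, a)); [by left|right].
apply: contrapT => /phom_max_ext[q [gq qz]].
exact: (no_relation_pair z0 (leqnn _) gp pz gq qz).
Qed.

Lemma phom_max_inv x a : G (x, a) -> a != 0 -> exists b, G (x^-1, b).
Proof.
move=> gx a0; have [_ Gf _ _] := hG; apply: contrapT => /phom_max_ext[p [gp px]].
have x0 : x != 0 by apply: contraNneq a0 => x0; rewrite x0 in gx; rewrite (Gf _ _ _ gx G0).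
have p0 : p != 0.
  apply/eqP => p0; have := gp 0%N; rewrite p0 coef0 coef1 => /(Gf _ _ _ G0)/eqP.
  by rewrite eq_sym oner_eq0.
pose e := (size p).-1; have sp : size p = e.+1 by rewrite /e prednK // size_poly_gt0.
have : G (\sum_(i < e.+1) p`_i * x ^+ (e - i), \sum_(i < e.+1) (1 : {poly K})`_i * a ^+ (e - i)).
  by apply: phom_sum => i _; apply: phomM; [apply: gp|apply: phomX].
have -> : \sum_(i < e.+1) p`_i * x ^+ (e - i) = x ^+ e * p.[x^-1].
  rewrite horner_coef sp mulr_sumr; apply: eq_bigr => i _.
  have ie : (i <= e)%N by rewrite -ltnS.
  by rewrite exprVn mulrCA expfB_cond // (negbTE x0).
rewrite px mulr0 => /(Gf _ _ _ G0)/esym/eqP.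
rewrite big_ord_recl coef1 mul1r subn0 big1 ?addr0 ?expf_eq0 ?(negbTE a0) ?andbF //.
by move=> i _; rewrite coef1 mul0r.
Qed.

(** If 1/z is in the domain, dividing c(z) = 0 by a power of [z] expresses the leading coefficient
    times [z] as a polynomial in 1/z. That coefficient is invertible in the domain because its image
    is nonzero. *)
Lemma phom_max_integral z c c' : gpoly G c c' -> c.[z] = 0 -> c'`_(size c).-1 != 0 ->
  exists a, G (z, a).
Proof.
move=> gc cz lc; have [_ Gf _ _] := hG.
have [->|z0] := eqVneq z 0; first by exists 0.
have [//|[w gw]] := phom_max_valuation z0.
have [d gd] := phom_max_inv (gc (size c).-1) lc.
have c0 : c != 0.
  apply/eqP => c0; move: lc (gc (size c).-1); rewrite c0 coef0 => lc g0.
  by rewrite (Gf _ _ _ g0 G0) eqxx in lc.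
have sc : (0 < size c)%N by rewrite size_poly_gt0.
pose e := (size c).-1; have sce : size c = e.+1 by rewrite /e prednK.
have lc0 : c`_e != 0 by rewrite -lead_coefE lead_coef_eq0.
have [e0|e0] := posnP e.
  have cc : c = (c`_0)%:P by apply: size1_polyC; rewrite sce e0.
  by move: cz lc0; rewrite cc hornerC e0 coefC /= => ->; rewrite eqxx.
have -> : z = (c`_e)^-1 * - (\sum_(i < e) c`_i * (z^-1) ^+ (e.-1 - i)).
  have : c.[z] * (z^-1) ^+ e.-1 = 0 by rewrite cz mul0r.
  rewrite horner_coef sce big_ord_recr /= mulrDl mulr_suml => /eqP; rewrite addrC addr_eq0.
  move/eqP=> h; have {h} : c`_e * z = - (\sum_(i < e) c`_i * (z^-1) ^+ (e.-1 - i)).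
    rewrite -[z in LHS](mulfK (expf_neq0 e.-1 z0)) -exprS prednK // mulrA -exprVn h.
    congr (- _); apply: eq_bigr => i _; have ie : (i <= e.-1)%N by rewrite -ltnS prednK.
    rewrite -mulrA; congr (_ * _).
    by rewrite expfB_cond ?invr_eq0 ?(negbTE z0) // !exprVn invrK mulrC.
  by move=> <-; rewrite mulKf.
eexists; apply: phomM; first exact: gd.
by apply: GN; apply: phom_sum => i _; apply: phomM; [apply: gc|apply: phomX gw].
Qed.

End OnePhom.

Lemma phom_extends G0 : phom G0 -> exists G, [/\ phom G, forall u, G0 u -> G u &
  forall G', phom G' -> (forall u, G u -> G' u) -> forall u, G' u -> G u].
Proof.
move=> h0; apply: (zorn_sets (Q := phom)) => // Ch [G1 Ch1] hCh tot.
have two u v : (exists A, Ch A /\ A u) -> (exists A, Ch A /\ A v) ->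
    exists A, [/\ Ch A, A u & A v].
  move=> [A [ChA Au]] [B [ChB Bv]].
  have [AB|BA] := tot A B ChA ChB; first by exists B; split=> //; apply: AB.
  by exists A; split=> //; apply: BA.
split.
- by move=> c kc'; exists G1; split=> //; case: (hCh _ Ch1) => g _ _ _; apply: g.
- move=> x a b Ux Uy; have [A [ChA Aa Ab]] := two _ _ Ux Uy.
  by case: (hCh _ ChA) => _ f _ _; apply: f Aa Ab.
- by move=> x a [A [ChA Aa]]; case: (hCh _ ChA) => _ _ c _; apply: c Aa.
- move=> x y a b Ux Uy; have [A [ChA Aa Ab]] := two _ _ Ux Uy.
  by case: (hCh _ ChA) => _ _ _ r; have [r1 r2] := r _ _ _ _ Aa Ab; split; exists A.
Qed.

(** Send [y] to a point of [k] avoiding the zeros of finitely many leading coefficients. A maximal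
    extension is then defined at all coordinates of [x] and at the inverse of h(x); the latter keeps
    [h] nonzero at the image point. *)
Lemma place_specialization N (y : K) (x : 'I_N -> K) (h : {mpoly K[N]}) :
  (forall i, algover (gen (adds k [:: y])) (x i)) -> mover k h -> h.@[x] != 0 ->
  exists u : 'I_N -> K, [/\ forall i, k (u i), h.@[u] != 0 &
    forall p : {mpoly K[N]}, mover k p -> p.@[x] = 0 -> p.@[u] = 0].
Proof.
move=> ax kh hx; have [ky|nky] := EM (k y).
  exists x; split=> // i; apply: kc; apply: algover_mono (ax i) => z.
  by apply=> // c [//|/[!inE]/eqP->].
have FP p : pover k p <-> p \is a polyOver (sfpred hk) by exact: poverP.
have ny p : pover k p -> p.[y] = 0 -> p = 0.
  move=> kp py; apply/eqP; apply: contrapT => /negP p0; apply: nky; apply: kc.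
  by exists p.
pose A z := exists p, pover k p /\ z = p.[y].
have hA : subring A.
  split; first by exists 1; rewrite hornerC; split=> //; apply/FP/rpred1.
  move=> _ _ [p [/FP kp ->]] [q [/FP kq ->]]; split.
    by exists (p - q); rewrite hornerD hornerN; split=> //; apply/FP/rpredB.
  by exists (p * q); rewrite hornerM; split=> //; apply/FP/rpredM.
have kA z : adds k [:: y] z -> A z.
  case=> [kz|/[!inE]/eqP->].
    by exists z%:P; rewrite hornerC; split=> //; apply/FP; rewrite polyOverC; apply/sfpredP.
  by exists 'X; rewrite hornerX; split=> //; apply/FP/polyOverX.
(* v is integral over k[y, 1/f] for the leading coefficient f of a relation, so a maximal
   homomorphism that does not kill f is defined at v. *)
have lead v : acl (adds k [:: y]) v -> exists f : {poly K}, [/\ pover k f, f != 0 &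
    forall G a, phom G -> (forall p, pover k p -> G (p.[y], p.[a])) ->
      (forall G', phom G' -> (forall u, G u -> G' u) -> forall u, G' u -> G u) ->
      f.[a] != 0 -> exists b, G (v, b)].
  move=> /(acl_ring hA kA)[c [c0 Ac cv]]; have [f fP] := choice Ac.
  exists (f (size c).-1); split; first by case: (fP (size c).-1).
    apply: contraNneq c0 => f0; rewrite -lead_coef_eq0 lead_coefE.
    by have [_ ->] := fP (size c).-1; rewrite f0 horner0.
  move=> G a hG Gy mG fa; pose c' := \poly_(i < size c) (f i).[a].
  apply: (phom_max_integral hG mG (c := c) (c' := c')) => //.
    move=> i; rewrite coef_poly; case: ltnP => [_|le].
      by have [kf ->] := fP i; apply: Gy.
    by rewrite nth_default //; case: hG => g _ _ _; apply: g; case: hk.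
  by rewrite coef_poly prednK ?leqnn // size_poly_gt0.
have hgen := subfield_acl (adds k [:: y]).
have ahx : acl (adds k [:: y]) (h.@[x])^-1.
  apply: subfieldV => //; apply: mover_meval => // m.
  by apply: acl_incl; left.
have /choice[f fP] := fun i : 'I_N => lead (x i) (ax i).
have [g [kg g0 gP]] := lead _ ahx.
pose F := g * \prod_i f i.
have kF : pover k F.
  by apply/FP/rpredM; [exact/FP|apply: rpred_prod => i _; apply/FP; case: (fP i)].
have F0 : F != 0.
  by rewrite mulf_neq0 //; apply/prodf_neq0 => i _; case: (fP i).
have [a ka Fa] : exists2 a, k a & F.[a] != 0.
  (* A root of F X + 1 is automatically not a root of [F], and it lies in [k] because it is
     algebraic over it. *)
  have /closed_rootP[a /rootP] : size (F * 'X + 1) != 1%N.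
    have := size_MXaddC F 1; rewrite (negbTE F0) /= => ->.
    by rewrite eqSS size_poly_eq0.
  rewrite hornerD hornerMX hornerC => e; exists a; last first.
    by apply/eqP => Fa; move/eqP: e; rewrite Fa mul0r add0r oner_eq0.
  apply: kc; exists (F * 'X + 1); split.
  - apply/eqP => e1; have := congr1 (fun p : {poly K} => p.[0]) e1.
    by rewrite hornerD hornerMX hornerC mulr0 add0r horner0 => /eqP; rewrite oner_eq0.
  - by apply/FP/rpredD; [apply/rpredM; [exact/FP|apply: polyOverX]|apply: rpred1].
  - by rewrite hornerD hornerMX hornerC.
have [|G [hG GG0 mG]] := @phom_extends (fun u => exists p, pover k p /\ u = (p.[y], p.[a])).
  split.
  - move=> c kc'; exists c%:P; rewrite !hornerC; split=> //.
    by apply/FP; rewrite polyOverC; apply/sfpredP.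
  - move=> z b c [p [kp [-> ->]]] [q [kq [e ->]]]; congr (_.[a]).
    apply/eqP; rewrite -subr_eq0; apply/eqP/ny; last by rewrite hornerD hornerN e subrr.
    by apply/FP/rpredB; apply/FP.
  - move=> z b [p [/FP kp [_ ->]]]; apply/(sfpredP hk)/rpred_horner => //.
    exact/sfpredP.
  - move=> z w b c [p [/FP kp [-> ->]]] [q [/FP kq [-> ->]]]; split.
      by exists (p - q); rewrite !hornerD !hornerN; split=> //; apply/FP/rpredB.
    by exists (p * q); rewrite !hornerM; split=> //; apply/FP/rpredM.
have Gy p : pover k p -> G (p.[y], p.[a]) by move=> kp; apply: GG0; exists p.
have [Gk Gf Gc Gr] := hG.
have /andP[ga fa] : (g.[a] != 0) && [forall i, (f i).[a] != 0].
  move: Fa; rewrite hornerM horner_prod mulf_eq0 negb_or => /andP[-> /prodf_neq0 fa].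
  by apply/forallP => i; apply: fa.
have /choice[u uP] : forall i, exists b, G (x i, b).
  by move=> i; case: (fP i) => _ _ H; apply: (H G a) => //; apply: (forallP fa i).
have Gm (p : {mpoly K[N]}) : mover k p -> G (p.@[x], p.@[u]).
  move=> kp; rewrite !mevalE; apply: phom_sum => // m _; apply: phomM => //.
    exact: Gk.
  apply: (big_ind2 (fun v w => G (v, w))) => [|v w v' w'|i _]; last exact: phomX.
    by apply: Gk; case: hk.
  exact: phomM.
exists u; split.
- by move=> i; apply: Gc (uP i).
- have [b gb] := gP G a hG Gy mG ga; apply/eqP => hu.
  have k1 : k 1 by case: hk.
  have := phomM hG (Gm h kh) gb; rewrite divff // hu mul0r => /(Gf _ _ _ (Gk 1 k1))/eqP.
  by rewrite oner_eq0.
- have k0 : k 0 by case: hk.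
  by move=> p kp px; have := Gm p kp; rewrite px => /(Gf _ _ _ (Gk 0 k0)).
Qed.

End Places.

(** * Residue fields of prime ideals *)

Section PrimeQuotient.
Variables (R : comNzRingType) (I : R -> Prop).

Record prime_ideal : Prop := PrimeIdeal {
  pi_0 : I 0;
  pi_B : forall x y, I x -> I y -> I (x - y);
  pi_M : forall x y, I y -> I (x * y);
  pi_1 : ~ I 1;
  pi_prime : forall x y, I (x * y) -> I x \/ I y }.

Definition pidl (h : prime_ideal) : {pred R} := fun x => `[< I x >].

Section Instances.
Variable h : prime_ideal.

Lemma pidlP x : reflect (I x) (x \in pidl h). Proof. exact: asboolP. Qed.

Lemma pidl_zmod : zmod_closed (pidl h).
Proof.
split=> [|x y /pidlP Ix /pidlP Iy]; first by apply/pidlP/pi_0.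
by apply/pidlP/pi_B.
Qed.

Lemma pidl_proper :
  1 \notin pidl h /\ forall a, {in pidl h, forall u, a * u \in pidl h}.
Proof.
split=> [|x y /pidlP Iy]; first by apply/pidlP; apply: pi_1.
by apply/pidlP/pi_M.
Qed.

Lemma pidl_prime : prime_idealr_closed (pidl h).
Proof. by move=> x y /pidlP/(pi_prime h)[|] Ix; apply/orP; [left|right]; apply/pidlP. Qed.

End Instances.

HB.instance Definition _ h := GRing.isZmodClosed.Build R (pidl h) (pidl_zmod h).
HB.instance Definition _ h := isProperIdeal.Build R (pidl h) (pidl_proper h).
HB.instance Definition _ h := isPrimeIdealrClosed.Build R (pidl h) (@pidl_prime h).

Definition pquot (h : prime_ideal) := {ideal_quot (pidl h)}.
HB.instance Definition _ h := GRing.ComNzRing.on (pquot h).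

Definition pquot_unit h (x : pquot h) : bool := `[< exists y, y * x = 1 >].
Definition pquot_inv h (x : pquot h) : pquot h :=
  if pselect (exists y, y * x = 1) is left e then sval (cid e) else x.

Lemma pquot_mulVx h : {in @pquot_unit h, left_inverse 1 (@pquot_inv h) *%R}.
Proof.
move=> x /asboolP ux; rewrite /pquot_inv; case: pselect => // e.
exact: svalP (cid e).
Qed.

Lemma pquot_unitP h (x y : pquot h) : y * x = 1 -> pquot_unit x.
Proof. by move=> e; apply/asboolP; exists y. Qed.

Lemma pquot_inv_out h : {in [predC @pquot_unit h], @pquot_inv h =1 id}.
Proof. by move=> x /asboolPn nu; rewrite /pquot_inv; case: pselect. Qed.

HB.instance Definition _ h := GRing.ComNzRing_hasMulInverse.Build (pquot h)
  (@pquot_mulVx h) (@pquot_unitP h) (@pquot_inv_out h).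

Lemma pquot_integral h (x y : pquot h) : x * y = 0 -> (x == 0) || (y == 0).
Proof. exact: Quotient.rquot_IdomainAxiom. Qed.

HB.instance Definition _ h := GRing.ComUnitRing_isIntegral.Build (pquot h)
  (@pquot_integral h).

Lemma prime_residue_field : prime_ideal ->
  exists (L : fieldType) (psi : {rmorphism R -> L}), forall x, psi x = 0 <-> I x.
Proof.
move=> h; pose Q := pquot h; pose pi : {rmorphism R -> Q} := \pi_Q%qT.
pose fr : {rmorphism Q -> {fraction Q}} := @FracField.tofrac Q.
exists {fraction Q}, (fr \o pi : {rmorphism R -> {fraction Q}}) => x /=.
have e : (pi x == 0) = (x \in pidl h).
  have := Quotient.idealrBE (pidl h) x 0; rewrite subr0 => ->.
  by rewrite -[0 in LHS](rmorph0 pi).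
split=> [/eqP|Ix].
  change (fr (pi x) == 0 -> I x); rewrite -[0](rmorph0 fr) tofrac_eq e.
  by move/pidlP.
have /eqP px : pi x == 0 by rewrite e; apply/pidlP.
by change (fr (pi x) = 0); rewrite px rmorph0.
Qed.

End PrimeQuotient.

(** * Loci of points over relatively algebraically closed fields *)

Section Locus.
Variables (K : closedFieldType) (N : nat).
Implicit Types (k : K -> Prop) (p q f : {mpoly K[N]}) (x y u v : 'I_N -> K).

(** A form of the Nullstellensatz: the coordinates of [x], taken as generators, are eliminated one
    at a time, each by a place over the relative algebraic closure of the remaining ones. *)
Lemma point_specialization k x q : subfield k -> (forall z, acl k z -> k z) ->
  mover k q -> q.@[x] != 0 -> exists u, [/\ forall i, k (u i), q.@[u] != 0 &
    forall p, mover k p -> p.@[x] = 0 -> p.@[u] = 0].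
Proof.
move=> hk kc kq.
suff H ys : forall x, (forall i, acl (adds k ys) (x i)) -> q.@[x] != 0 ->
    exists u, [/\ forall i, k (u i), q.@[u] != 0 &
      forall p, mover k p -> p.@[x] = 0 -> p.@[u] = 0].
  by apply: (H (codom x)) => i; apply: acl_incl; right; apply: codom_f.
elim: ys => [|y ys IH] {}x ax qx.
  exists x; split=> // i; apply: kc; apply: acl_mono (ax i) => z; by case.
pose k1 := acl (adds k ys); have hk1 : subfield k1 := subfield_acl _.
have kk1 z : k z -> k1 z by move=> kz; apply: acl_incl; left.
have [||||u [k1u qu ru]] := @place_specialization K k1 hk1 _ N y x q.
- by move=> z; apply: algover_trans; apply: subfield_gen.
- move=> i; have : acl (adds k1 [:: y]) (x i).
    apply: acl_mono (ax i) => z [kz|]; first by left; apply: kk1.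
    by rewrite inE => /orP[zy|zs]; [right; rewrite inE|left; apply: acl_incl; right].
  by [].
- by move=> m; apply: kk1.
- by [].
have [|w [kw qw rw]] := IH u _ qu; first by move=> i; apply: k1u.
exists w; split=> // p kp px; apply: rw => //; apply: ru => // m; exact: kk1.
Qed.

(** Writes [f] through polynomials over [k] with coefficients linearly independent over [k]. At a
    point with coordinates in [k] it vanishes exactly when all the components do, so arbitrary
    closed sets can be tested by such points. *)
Lemma mpoly_expansion k f : subfield k -> exists (es : seq K) (g : K -> {mpoly K[N]}),
  [/\ uniq es, forall e, mover k (g e), f = \sum_(e <- es) e *: g e &
   forall a : K -> K, (forall e, k (a e)) -> \sum_(e <- es) e * a e = 0 ->
     forall e, e \in es -> a e = 0].
Proof.
move=> hk; rewrite (mpolyE f); elim: (msupp f) => [|m r [es [g [ue kg fE ind]]]].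
  exists [::], (fun _ => 0); rewrite !big_nil; split=> //.
  by move=> _; apply/(moverP hk)/rpred0.
rewrite big_cons {}fE; set c := f@_m.
have [[a [ka ca]]|nc] := EM (exists a : K -> K, (forall e, k (a e)) /\ c = \sum_(e <- es) e * a e).
  exists es, (fun e => g e + a e *: 'X_[m]); split=> // [e|].
    apply/(moverP hk); apply: rpredD; first exact/(moverP hk).
    by apply: mpolyOverZ; [apply/sfpredP|apply: mpolyOverX].
  rewrite ca scaler_suml -big_split; apply: eq_bigr => e _ /=.
  by rewrite scalerDr scalerA addrC.
have nce : c \notin es.
  apply/negP => ce; apply: nc; exists (fun e => (e == c)%:R); split.
    by move=> e; case: eqP => _; case: hk.
  by rewrite (bigD1_seq c) //= eqxx mulr1 big1 ?addr0 // => e /negbTE->; rewrite mulr0.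
exists (c :: es), (fun e => if e == c then 'X_[m] else g e); split.
- by rewrite /= nce.
- by move=> e; case: eqP => // _; apply/(moverP hk)/mpolyOverX.
- rewrite big_cons eqxx; congr (_ + _); rewrite !big_seq; apply: eq_bigr => e es_.
  by case: eqP es_ => [->|//]; rewrite (negbTE nce).
move=> a ka; rewrite big_cons => /eqP; rewrite addr_eq0 => /eqP e0.
have ac : a c = 0.
  apply/eqP; apply: contrapT => /negP ac; apply: nc; exists (fun e => - (a e / a c)); split.
    move=> e; apply/(sfpredP hk); rewrite rpredN; apply: rpred_div; exact/sfpredP.
  rewrite -[LHS](mulfK ac) e0 mulNr mulr_suml -sumrN; apply: eq_bigr => e _.
  by rewrite mulrN mulrA.
have es0 : \sum_(e <- es) e * a e = 0 by apply/eqP; rewrite -oppr_eq0 -e0 ac mulr0.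
by move=> e /[!inE]/orP[/eqP->//|]; apply: ind.
Qed.

Variable (D : ('I_N -> K) -> Prop) (d : {mpoly K[N]}).
Hypotheses (dD : forall v, D v <-> d.@[v] != 0) (dk : forall k, subfield k -> mover k d).

Definition locus k x v := D v /\ forall p, mover k p -> p.@[x] = 0 -> p.@[v] = 0.

(** Suppose the closed sets [Y] and [Z] cover the locus and neither contains it. Some equation of
    each has a component over [k] that is nonzero at [x]. Specialising [x] to a point over [k] where
    both components stay nonzero gives a point of the locus outside [Y] and [Z]. *)
Lemma locus_irreducible k x : subfield k -> (forall z, acl k z -> k z) -> D x ->
  zirreducible D (locus k x).
Proof.
move=> hk kc Dx; split.
- exists (fun p => mover k p /\ p.@[x] = 0) => v.
  by split=> [[Dv h]|[Dv h]]; split=> // p; [case; apply: h|move=> kp px; apply: h].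
- by exists x.
move=> Y Z [SY YE] [SZ ZE] cov.
have [?|nY] := EM (forall v, locus k x v -> Y v); first by left.
right=> v lv; apply: contrapT => nZv; apply: nY => w lw; apply: contrapT => nYw.
have nonvan S u : D u -> ~ zeros D S u -> exists2 f, S f & f.@[u] != 0.
  move=> Du nz; apply: contrapT => no; apply: nz; split=> // p Sp.
  by apply/eqP; apply: contrapT => /negP pu; apply: no; exists p.
have [f Sf fw] : exists2 f, SY f & f.@[w] != 0.
  by apply: nonvan; [case: lw|move/YE].
have [g Sg gv] : exists2 f, SZ f & f.@[v] != 0.
  by apply: nonvan; [case: lv|move/ZE].
have comp q u : locus k x u -> q.@[u] != 0 -> exists es g0 e0,
    [/\ uniq es, forall e, mover k (g0 e), q = \sum_(e <- es) e *: g0 e,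
     forall a : K -> K, (forall e, k (a e)) -> \sum_(e <- es) e * a e = 0 ->
       forall e, e \in es -> a e = 0 & (e0 \in es) && ((g0 e0).@[x] != 0)].
  move=> lu qu; have [es [g0 [ue kg qE ind]]] := mpoly_expansion q hk.
  suff [e0 h0] : exists e0, (e0 \in es) && ((g0 e0).@[x] != 0) by exists es, g0, e0.
  apply: contrapT => no; case/negP: qu; rewrite qE raddf_sum /= big_seq big1 // => e ee.
  rewrite mevalZ; case: lu => _ ->; rewrite ?mulr0 //.
  by apply/eqP; apply: contrapT => /negP ge; apply: no; exists e; rewrite ee.
have [ef [gf [e1 [_ kf fE indf /andP[e1f x1]]]]] := comp f w lw fw.
have [eg [gg [e2 [_ kg gE indg /andP[e2g x2]]]]] := comp g v lv gv.
have [||u [ku hu ru]] := @point_specialization k x (gf e1 * gg e2 * d) hk kc.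
- by apply/(moverP hk); do !apply: rpredM; apply/(moverP hk) => //; apply: dk.
- by rewrite !mevalM !mulf_neq0 //; apply/dD.
move: hu; rewrite !mevalM !mulf_eq0 !negb_or => /andP[/andP[u1 u2] ud].
have val0 q es g0 e0 : q = \sum_(e <- es) e *: g0 e -> (forall e, mover k (g0 e)) ->
    (forall a : K -> K, (forall e, k (a e)) -> \sum_(e <- es) e * a e = 0 ->
       forall e, e \in es -> a e = 0) -> e0 \in es -> q.@[u] = 0 -> (g0 e0).@[u] = 0.
  move=> qE kg0 ind e0s qu; apply: (ind (fun e => (g0 e).@[u])) => //.
    by move=> e; apply: mover_meval.
  by rewrite -[RHS]qu qE raddf_sum; apply: eq_bigr => e _; rewrite /= mevalZ.
have lu : locus k x u by split=> //; apply/dD.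
case: (cov u lu) => [/YE[_ /(_ f Sf)]|/ZE[_ /(_ g Sg)]] h.
  by case/eqP: u1; apply: (val0 f ef gf e1).
by case/eqP: u2; apply: (val0 g eg gg e2).
Qed.

(** Dropping the elements of [s] from the base field one at a time gives n + 1 strictly increasing
    irreducible loci of [x] inside [V]. If [p] failed somewhere on [V], the set [V] itself would
    lengthen the chain beyond its dimension. *)
Lemma generic_point_vanishing k V x s n p : subfield k -> zirreducible D V ->
  zclosed_over k D V -> V x -> indep k s -> size s = n ->
  (forall z, z \in s -> z \in codom x) -> ~ zdim_ge D V n.+1 ->
  mover k p -> p.@[x] = 0 -> forall v, V v -> p.@[v] = 0.
Proof.
move=> hk irV [S [kS VE]] Vx is_ sn sx ndim kp px v Vv.
apply/eqP; apply: contrapT => /negP pv; apply: ndim.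
pose kk l := acl (adds k (drop l s)).
have hkk l : subfield (kk l) by apply: subfield_acl.
have kkc l z : acl (kk l) z -> kk l z by apply: acl_sub.
have kkk l z : k z -> kk l z by move=> kz; apply: acl_incl; left.
have Dx : D x by case/VE: Vx.
pose C l := if (l <= n)%N then locus (kk l) x else V.
have CV l w : C l w -> V w.
  rewrite /C; case: ifP => // _ [Dw lw]; apply/VE; split=> // q Sq; apply: lw.
    by move=> m; apply/kkk/kS.
  by case/VE: Vx => _; apply.
exists C; split=> [l ln|l ln].
  split; last exact: CV.
  by rewrite /C; case: ifP => // _; apply: locus_irreducible => // z; apply: kkc.
rewrite ltnS in ln; split.
  move=> w; rewrite {1}/C ln => lw; have Cw : C l w by rewrite /C ln.
  rewrite /C; case: ifP => _; last exact: CV Cw.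
  case: lw => Dw lw; split=> // q kq; apply: lw => m; apply: acl_mono (kq m) => z.
  case=> [|zd]; [by left|right]; apply: mem_subseq zd.
  by rewrite -addn1 addnC -drop_drop; apply: drop_subseq.
rewrite /C ln; have [eln|lt_ln] := eqVneq l n.
  rewrite eln ltnn; exists v; split=> // -[_ lv]; case/negP: pv; apply/eqP; apply: lv => // m.
  exact: kkk.
have {lt_ln}ln' : (l < n)%N by rewrite ltn_neqAle lt_ln.
rewrite ln'; have ls : (l < size s)%N by rewrite sn.
pose z := nth 0 s l; have ds : drop l s = z :: drop l.+1 s by apply: drop_nth.
have nz : ~ kk l.+1 z.
  by have := is_; rewrite -(cat_take_drop l s) ds => /indep_cat[[]].
have /codomP[j zj] : z \in codom x by apply/sx/mem_nth.
(* Strictness: the point [u] has its coordinates in the smaller field, so its coordinate [j] differs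
   from the transcendental [z], whereas the smaller locus satisfies the equation X_j = z. *)
have [|u [ku du ru]] := @point_specialization (kk l.+1) x d (hkk _) (kkc _) (dk (hkk _)).
  exact/dD.
exists u; split; first by split=> //; apply/dD.
move=> [_ /(_ ('X_j - z%:MP))]; rewrite !mevalB !mevalXU !mevalC -zj subrr => h.
apply: nz; suff -> : z = u j by [].
apply/eqP; rewrite eq_sym -subr_eq0; apply/eqP/h => // m.
apply/(sfpredP (hkk l)); rewrite mcoeffB mcoeffX mcoeffC; apply: rpredB.
  by case: eqP => _; rewrite ?rpred0 ?rpred1.
apply: rpredM; last by case: eqP => _; rewrite ?rpred0 ?rpred1.
by apply/sfpredP/acl_incl; right; rewrite ds mem_head.
Qed.

End Locus.

(** * From chains of irreducible sets to transcendence degree *)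

Section ChainTranscendence.
Variables (K : closedFieldType) (N : nat) (D : ('I_N -> K) -> Prop).
Implicit Types (p q : {mpoly K[N]}) (P : {poly {mpoly K[N]}}).

Lemma irreducible_ideal_prime (C : ('I_N -> K) -> Prop) :
  zirreducible D C -> prime_ideal (fun p : {mpoly K[N]} => forall v, C v -> p.@[v] = 0).
Proof.
move=> [[S CS] [v0 Cv0] irr]; split.
- by move=> v _; rewrite meval0.
- by move=> p q Ip Iq v Cv; rewrite mevalB Ip // Iq // subrr.
- by move=> p q Iq v Cv; rewrite mevalM Iq // mulr0.
- by move=> /(_ v0 Cv0)/eqP; rewrite meval1 oner_eq0.
move=> p q Ipq; pose Z r v := D v /\ r.@[v] = 0.
have zZ r : zclosed D (Z r).
  exists (fun r' => r' = r) => v; split=> [[Dv rv]|[Dv h]]; split=> //; last exact: h.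
  by move=> _ ->.
have [v Cv|pZ|qZ] := irr _ _ (zZ p) (zZ q); last 2 first.
- by left=> v /pZ[].
- by right=> v /qZ[].
have Dv : D v by case/CS: Cv.
have /eqP := Ipq v Cv; rewrite mevalM mulf_eq0 => /orP[]/eqP h; [by left|by right].
Qed.

Section Tower.
Variables (C : nat -> ('I_N -> K) -> Prop) (r : nat) (f : nat -> {mpoly K[N]}).
Let I j p := forall v, C j v -> p.@[v] = 0.
Hypotheses (prC : forall j, (j <= r)%N -> prime_ideal (I j))
  (CS : forall j, (j < r)%N -> forall v, C j v -> C j.+1 v)
  (fI : forall j, (j < r)%N -> I j (f j)) (fnI : forall j, (j < r)%N -> ~ I j.+1 (f j)).

(** The ring K[f_0, ..., f_(j-1)], where f_i vanishes on C_i but not on C_(i+1). *)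
Fixpoint tower_ring (j : nat) (p : {mpoly K[N]}) : Prop :=
  if j is j'.+1 then exists P, (forall i, tower_ring j' P`_i) /\ p = P.[f j']
  else exists c : K, p = c%:MP.

Lemma tower_ring_ops j : [/\ tower_ring j 0, tower_ring j 1 &
  forall p q, tower_ring j p -> tower_ring j q ->
    tower_ring j (p - q) /\ tower_ring j (p * q)].
Proof.
elim: j => [|j [R0 R1 Rs]] /=.
  split; [by exists 0; rewrite mpolyC0|by exists 1|move=> _ _ [a ->] [b ->]].
  by split; [exists (a - b); rewrite mpolyCB|exists (a * b); rewrite mpolyCM].
have RD p q : tower_ring j p -> tower_ring j q -> tower_ring j (p + q).
  move=> Rp Rq; rewrite -[q]opprK; apply Rs => //; rewrite -sub0r; by apply Rs.
split.
- by exists 0; rewrite horner0; split=> // i; rewrite coef0.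
- exists 1; rewrite hornerC; split=> // i; rewrite coef1; by case: eqP.
- move=> _ _ [P [RP ->]] [Q [RQ ->]]; split.
    by exists (P - Q); rewrite hornerD hornerN; split=> // i; rewrite coefB; apply Rs.
  exists (P * Q); rewrite hornerM; split=> // i; rewrite coefM.
  by elim/big_ind: _ => // k _; apply Rs.
Qed.

Lemma tower_ideal_le j j' : (j <= j')%N -> (j' <= r)%N -> forall p, I j' p -> I j p.
Proof.
move=> jj' j'r p Ip v Cv; apply: Ip; elim: j' jj' j'r => [|j' IH].
  by rewrite leqn0 => /eqP <-.
rewrite leq_eqVlt => /orP[/eqP<-//|]; rewrite ltnS => jj' j'r.
by apply: CS => //; apply: IH => //; apply: ltnW.
Qed.

(** The constant coefficient of [P] vanishes on C_j, because f_j does, and so is zero by hypothesis.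
    What remains is divisible by f_j, which is outside the prime ideal of C_(j+1); cancel it and
    repeat. *)
Lemma tower_poly_eq0 j : (j < r)%N -> (forall p, tower_ring j p -> I j p -> p = 0) ->
  forall P, (forall i, tower_ring j P`_i) -> I j.+1 P.[f j] -> P = 0.
Proof.
move=> jr R0; elim/poly_ind => // P c IH RP.
have c0 : (P * 'X + c%:P)`_0 = c by rewrite coefD coefMX coefC add0r.
have Rc : tower_ring j c by have := RP 0%N; rewrite c0.
rewrite hornerD hornerMX hornerC => Ie.
have cz : c = 0.
  apply: R0 => // v Cv; have := Ie v (CS jr Cv); rewrite mevalD mevalM (fI jr Cv) mulr0 add0r.
  exact.
rewrite cz addr0 in Ie *; rewrite IH ?mul0r ?addr0 //.
  by move=> i; have := RP i.+1; rewrite coefD coefMX coefC /= addr0.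
have [] // := pi_prime (prC jr) Ie.
by move=> fj; case: (fnI jr).
Qed.

Lemma tower_ring_eq0 j : (j <= r)%N -> forall p, tower_ring j p -> I j p -> p = 0.
Proof.
elim: j => [_ _ [c ->] Ic|j IH jr _ [P [RP ->]] IP].
  have [->|c0] := eqVneq c 0; first by rewrite mpolyC0.
  case: (pi_1 (prC (leq0n r))) => v Cv; have := Ic v Cv.
  by rewrite mevalC => /eqP; rewrite (negbTE c0).
by rewrite (tower_poly_eq0 jr (IH (ltnW jr)) RP IP) horner0.
Qed.

Variables (L : fieldType) (psi : {rmorphism {mpoly K[N]} -> L}).
Hypothesis psiE : forall p, psi p = 0 <-> I r p.
Let A (x : L) := exists c : K, x = psi c%:MP.

Let psi_ring j : subring (fun x => exists p, tower_ring j p /\ x = psi p).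
Proof.
have [_ R1 Rs] := tower_ring_ops j; split; first by exists 1; rewrite rmorph1.
move=> _ _ [p [Rp ->]] [q [Rq ->]]; have [Rb RM] := Rs p q Rp Rq.
by split; [exists (p - q); rewrite rmorphB|exists (p * q); rewrite rmorphM].
Qed.

Let tower_ring_C j c : tower_ring j c%:MP.
Proof.
elim: j => [|j IH] /=; first by exists c.
exists (c%:MP)%:P; rewrite hornerC; split=> // i; rewrite coefC; case: eqP => // _.
by case: (tower_ring_ops j).
Qed.

Let tower_ring_f j i : (i < j)%N -> tower_ring j (f i).
Proof.
elim: j => // j IH; rewrite ltnS leq_eqVlt => /orP[/eqP->|/IH Rf] /=.
  exists 'X; rewrite hornerX; split=> // l; rewrite coefX.
  by case: eqP; case: (tower_ring_ops j).
exists (f i)%:P; rewrite hornerC; split=> // l; rewrite coefC; case: eqP => // _.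
by case: (tower_ring_ops j).
Qed.

Lemma tower_indep j : (j <= r)%N -> indep A [seq psi (f i) | i <- rev (iota 0 j)].
Proof.
elim: j => // j IH jr; rewrite -addn1 iotaD /= rev_cat /= add0n; split; last exact: IH (ltnW jr).
move=> /(acl_ring (psi_ring j))[|c [c0 Rc cf]].
  move=> x [[a ->]|xs]; first by exists a%:MP.
  have /mapP[i im ->] := xs; exists (f i); split=> //; apply: tower_ring_f.
  by move: im; rewrite mem_rev mem_iota add0n.
have /choice[g gP] := Rc.
pose P := \poly_(i < size c) g i.
have P0 : P = 0.
  apply: (tower_poly_eq0 jr (tower_ring_eq0 (ltnW jr))).
    move=> i; rewrite coef_poly; case: ifP => _; first by case: (gP i).
    by case: (tower_ring_ops j).
  apply: (tower_ideal_le jr (leqnn _)); apply/psiE.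
  rewrite horner_poly rmorph_sum -[RHS]cf [RHS]horner_coef; apply: eq_bigr => i _.
  by rewrite rmorphM rmorphXn; case: (gP i) => _ ->.
case/negP: c0; apply/eqP/polyP => i; rewrite coef0.
have [ic|/(nth_default 0)//] := ltnP i (size c).
have [_ ->] := gP i; have := congr1 (fun P => P`_i) P0.
by rewrite coef_poly ic coef0 => ->; rewrite rmorph0.
Qed.

(** The f_i are independent in the residue field of C_r and algebraic over the images of the
    variables; exchange selects r independent variables. *)
Lemma tower_vars : exists v : seq 'I_N, [/\ uniq v, size v = r &
  indep A [seq psi 'X_i | i <- v]].
Proof.
have genX p : acl (adds A [seq psi 'X_i | i <- enum 'I_N]) (psi p).
  apply: acl_gen; have h := subfield_gen (adds A [seq psi 'X_i | i <- enum 'I_N]).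
  rewrite (mpolyE p) rmorph_sum; apply/(sfpredP h); apply: rpred_sum => m _.
  rewrite -mul_mpolyC rmorphM; apply: rpredM.
    by apply/sfpredP; apply: gen_incl; left; exists p@_m.
  rewrite mpolyXE_id rmorph_prod; apply: rpred_prod => i _; rewrite rmorphXn.
  by apply/rpredX/sfpredP; apply: gen_incl; right; apply/map_f; rewrite mem_enum.
have [|s [/subseqP[m sm ->] is_ sz]] := indep_sub (t := [seq psi 'X_i | i <- enum 'I_N])
    (tower_indep (leqnn r)).
  by move=> _ /mapP[i _ ->].
exists (mask m (enum 'I_N)); split.
- by apply: mask_uniq; apply: enum_uniq.
- by rewrite -(size_map (fun i => psi 'X_i)) map_mask sz size_map size_rev size_iota.
- by rewrite map_mask.
Qed.

End Tower.

(** A relation over [k] between the chosen coordinates of [y] holds on [X], hence on the top C_r of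
    the chain, hence between the corresponding variables in its residue field. These are independent
    there even over [K]. *)
Lemma chain_trdeg (X : ('I_N -> K) -> Prop) (k : K -> Prop) (y : 'I_N -> K) r :
  subfield k -> zdim_ge D X r ->
  (forall p, mover k p -> p.@[y] = 0 -> forall v, X v -> p.@[v] = 0) ->
  exists s, [/\ indep k s, size s = r & forall z, z \in s -> z \in codom y].
Proof.
move=> hk [C [irC CC]] Xk.
pose I j p := forall v, C j v -> p.@[v] = 0.
have prC j : (j <= r)%N -> prime_ideal (I j).
  by move=> /irC[ir _]; apply: irreducible_ideal_prime.
have /choice[f fP] j : exists g, (j < r)%N -> I j g /\ ~ I j.+1 g.
  have [jr|] := boolP (j < r)%N; last by exists 0.
  have [[S CS] _ _] := (irC j (ltnW jr)).1; have [_ [v [C1v nCv]]] := CC j jr.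
  have Dv : D v by have [[S' CS'] _ _] := (irC j.+1 jr).1; case/CS': C1v.
  have [g [Sg gv]] : exists g, S g /\ g.@[v] != 0.
    apply: contrapT => no; apply: nCv; apply/CS; split=> // g Sg.
    by apply/eqP; apply: contrapT => /negP gv; apply: no; exists g.
  exists g => _; split; first by move=> w /CS[_]; apply.
  by move=> /(_ v C1v)/eqP; rewrite (negbTE gv).
have [L [psi psiE]] := prime_residue_field (prC r (leqnn r)).
have [v [uv sv iv]] := tower_vars prC (fun j jr => (CC j jr).1)
  (fun j jr => (fP j jr).1) (fun j jr => (fP j jr).2) psiE.
exists [seq y i | i <- v]; split; last 2 first.
- by rewrite size_map.
- by move=> _ /mapP[i _ ->]; apply: codom_f.
apply: avars_indep => // p kp vp py.
pose A (x : L) := exists c : K, x = psi c%:MP.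
have psiC_zmod : zmod_morphism (fun c : K => psi c%:MP).
  by move=> a b; rewrite mpolyCB rmorphB.
have psiC_mon : monoid_morphism (fun c : K => psi c%:MP).
  by split=> [|a b]; rewrite ?mpolyC1 ?rmorph1 // mpolyCM rmorphM.
have [psiC psiCE] : exists g : {rmorphism K -> L}, forall c, g c = psi c%:MP.
  exists (HB.pack (fun c : K => psi c%:MP) (GRing.isZmodMorphism.Build _ _ _ psiC_zmod)
    (GRing.isMonoidMorphism.Build _ _ _ psiC_mon) : {rmorphism K -> L}).
  by [].
have A0 : A 0 by exists 0; rewrite mpolyC0 rmorph0.
have q0 : map_mpoly psiC p = 0.
  apply: (indep_avars A0 iv).
  - by move=> m; rewrite mcoeff_map_mpoly; exists p@_m; apply: psiCE.
  - move=> m; rewrite mcoeff_msupp mcoeff_map_mpoly fmorph_eq0 -mcoeff_msupp; exact: vp.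
  - have : psi p = 0.
      apply/psiE => w Cw; apply: Xk => //; exact: (irC r (leqnn r)).2.
    move=> <-; elim/mpolyind: {kp vp py} p => [|c m q _ _ IH].
      by rewrite rmorph0 meval0 rmorph0.
    rewrite rmorphD /= mevalD IH rmorphD; congr (_ + _).
    rewrite map_mpolyZ map_mpolyX mevalZ mevalX -mul_mpolyC rmorphM mpolyXE_id rmorph_prod.
    by rewrite psiCE; congr (_ * _); apply: eq_bigr => i _; rewrite rmorphXn.
apply/mpolyP => m; rewrite mcoeff0; apply: (fmorph_inj psiC).
by rewrite rmorph0 -mcoeff_map_mpoly q0 mcoeff0.
Qed.

End ChainTranscendence.

(** * Free exponentials *)

Section RationalEmbedding.
Variables (K : fieldType) (ch : [pchar K] =i pred0).

Lemma char0_intr_eq0 (n : int) : (n%:~R == 0 :> K) = (n == 0).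
Proof.
have /pcharf0P ch' := ch.
by case: n => n; rewrite ?NegzE ?mulrNz ?oppr_eq0 -pmulrn ch'.
Qed.

Lemma ratr_frac (a b : int) (q : rat) : b != 0 -> q * b%:~R = a%:~R ->
  ratr q = a%:~R / b%:~R :> K.
Proof.
move=> b0 e; rewrite /ratr; have d0 : (denq q)%:~R != 0 :> K by rewrite char0_intr_eq0 denq_neq0.
have b0' : b%:~R != 0 :> K by rewrite char0_intr_eq0.
suff h : numq q * b = a * denq q.
  by apply/eqP; rewrite eqr_div // -!intrM h.
apply: (@intr_inj rat); rewrite !intrM -e numqE; ring.
Qed.

Lemma ratr_zmod : zmod_morphism (@ratr K).
Proof.
move=> x y; have dx : (denq x)%:~R != 0 :> K by rewrite char0_intr_eq0 denq_neq0.
have dy : (denq y)%:~R != 0 :> K by rewrite char0_intr_eq0 denq_neq0.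
rewrite (@ratr_frac (numq x * denq y - numq y * denq x) (denq x * denq y)).
- by rewrite /ratr !(mulrzBr, intrM); field; rewrite ?dx ?dy.
- by rewrite mulf_neq0 ?denq_neq0.
- by rewrite !(mulrzBr, intrM) !numqE; ring.
Qed.

Lemma ratr_monoid : monoid_morphism (@ratr K).
Proof.
split; first by rewrite (@ratr_frac 1 1) ?mulr1 ?divr1.
move=> x y; have dx : (denq x)%:~R != 0 :> K by rewrite char0_intr_eq0 denq_neq0.
have dy : (denq y)%:~R != 0 :> K by rewrite char0_intr_eq0 denq_neq0.
rewrite (@ratr_frac (numq x * numq y) (denq x * denq y)).
- by rewrite /ratr !intrM; field; rewrite ?dx ?dy.
- by rewrite mulf_neq0 ?denq_neq0.
- by rewrite !intrM !numqE; ring.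
Qed.

Lemma Q2K_ex : exists f : {rmorphism rat -> K}, forall q, ratr q = f q.
Proof.
by exists (HB.pack (@ratr K) (GRing.isZmodMorphism.Build _ _ _ ratr_zmod)
  (GRing.isMonoidMorphism.Build _ _ _ ratr_monoid) : {rmorphism rat -> K}).
Qed.

Definition Q2K : {rmorphism rat -> K} := sval (cid Q2K_ex).

Lemma Q2KE q : ratr q = Q2K q. Proof. exact: svalP (cid Q2K_ex) q. Qed.

Lemma Q2K_gen (S : K -> Prop) q : gen S (Q2K q).
Proof.
have h := subfield_gen S; rewrite -Q2KE /ratr; apply/(sfpredP h)/rpred_div; exact: rpred_int.
Qed.

End RationalEmbedding.

Section FreeExponential.
Variables (K : closedFieldType) (ch : [pchar K] =i pred0).
Local Notation iQ := (Q2K ch).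

(* B is a transcendence basis and X, with w, is a Q-basis of K with coordinates c;
   exactly one of x, E x is transcendental over the elements of B other than fr x,
   the other one and all earlier basis elements are algebraic over them. *)
Record free_exp (E : K -> K) (w : K) : Type := FreeExp {
  fe_B : K -> Prop; fe_X : K -> Prop; fe_lev : K -> nat; fe_fr : K -> K;
  fe_c : K -> K -> rat;
  fe_E : axiom_E E;
  fe_neq0 : forall x, E x != 0;
  fe_tor : forall q, acl (fun _ => False) (E (iQ q * w));
  fe_w : ~ acl (fun _ => False) w;
  fe_ker : forall x, E x = 1 -> exists n : int, x = w *~ n;
  fe_log : axiom_LOG E;
  fe_basis : forall z, acl fe_B z;
  fe_frB : forall x, fe_X x -> fe_B (fe_fr x);
  fe_supp : forall z, exists s, [/\ uniq s, forall x, x \in s -> fe_X x \/ x = w,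
    z = \sum_(x <- s) iQ (fe_c z x) * x & forall x, fe_c z x != 0 -> x \in s];
  fe_cD : forall z z' x, fe_c (z + z') x = fe_c z x + fe_c z' x;
  fe_cZ : forall q z x, fe_c (iQ q * z) x = q * fe_c z x;
  fe_cX : forall x y, fe_X x -> fe_c x y = (y == x)%:R;
  fe_prev : forall x y, fe_X x -> fe_X y -> y <> x -> (fe_lev y <= fe_lev x)%N ->
    acl (fun b => fe_B b /\ b <> fe_fr x) y /\ acl (fun b => fe_B b /\ b <> fe_fr x) (E y);
  fe_free : forall x, fe_X x ->
    (acl (fun b => fe_B b /\ b <> fe_fr x) x /\ ~ acl (fun b => fe_B b /\ b <> fe_fr x) (E x)) \/
    (~ acl (fun b => fe_B b /\ b <> fe_fr x) x /\ acl (fun b => fe_B b /\ b <> fe_fr x) (E x));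
  fe_wfr : forall x, fe_X x -> acl (fun b => fe_B b /\ b <> fe_fr x) w }.

Variables (E : K -> K) (w : K) (fe : free_exp E w).
Local Notation B := (fe_B fe).
Local Notation X := (fe_X fe).
Local Notation lev := (fe_lev fe).
Local Notation fr := (fe_fr fe).
Local Notation c := (fe_c fe).
Let Om x := acl (fun b => B b /\ b <> fr x).
Let hOm x : subfield (Om x) := subfield_acl _.

Lemma fe_E0 : E 0 = 1.
Proof.
have := fe_E fe 0 0; rewrite addr0 => /eqP; rewrite -subr_eq0 -{1}[E 0]mulr1 -mulrBr.
by rewrite mulf_eq0 (negbTE (fe_neq0 fe 0)) subr_eq0 => /eqP.
Qed.

Lemma fe_EN x : E (- x) = (E x)^-1.
Proof.
by apply: (mulIf (fe_neq0 fe x)); rewrite -(fe_E fe) addNr fe_E0 mulVf ?(fe_neq0 fe).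
Qed.

Lemma fe_En x n : E (x *+ n) = E x ^+ n.
Proof. by elim: n => [|n IH]; rewrite ?mulr0n ?fe_E0 // mulrS (fe_E fe) IH exprS. Qed.

Lemma fe_Ez x (n : int) : E (x *~ n) = E x ^ n.
Proof.
by case: n => n; rewrite ?NegzE ?mulrNz ?fe_EN -pmulrn fe_En.
Qed.

Lemma fe_Esum (I : Type) (r : seq I) (f : I -> K) :
  E (\sum_(i <- r) f i) = \prod_(i <- r) E (f i).
Proof. by elim/big_rec2: _ => [|i y z _ <-]; rewrite ?fe_E0 ?(fe_E fe). Qed.

Lemma acl_scale (S : K -> Prop) q x : acl S x -> acl S (iQ q * x).
Proof.
by have [_ _ s _] := subfield_acl S; move=> ax; case: (s (iQ q) x) => //; apply: acl_gen; apply: Q2K_gen.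
Qed.

Lemma acl_Escale (S : K -> Prop) q x : acl S (E x) -> acl S (E (iQ q * x)).
Proof.
move=> ax; have hS := subfield_acl S; have d0 := denq_gt0 q.
pose d := `|denq q|%N; have dE : denq q = d%:Z by rewrite /d gtz0_abs.
have e : E (iQ q * x) ^+ d = E x ^ numq q.
  rewrite -fe_En -fe_Ez; congr E; rewrite -mulrnAl -mulr_natr -[d%:R]/(d%:~R) -dE.
  have -> : (denq q)%:~R = iQ (denq q)%:~R by rewrite rmorph_int.
  by rewrite -rmorphM -numqE rmorph_int mulrzl.
have dpos : (0 < d)%N by rewrite -ltz_nat -dE.
apply: (acl_root (p := 'X^d - (E x ^ numq q)%:P)).
- by rewrite -size_poly_gt0 size_XnsubC.
- apply/(poverP hS); apply: rpredB; first exact/rpredX/polyOverX.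
  rewrite polyOverC; move: (numq q) => [] n; rewrite ?NegzE -?exprnN -?exprnP;
    rewrite ?rpredV; apply/rpredX/sfpredP; exact: ax.
- by rewrite hornerD hornerN hornerXn hornerC e subrr.
Qed.

Lemma acl_Esum_scale (S : K -> Prop) (I : eqType) (r : seq I) (q : I -> rat) (z : I -> K) :
  (forall i, i \in r -> acl S (z i) /\ acl S (E (z i))) ->
  acl S (\sum_(i <- r) iQ (q i) * z i) /\ acl S (E (\sum_(i <- r) iQ (q i) * z i)).
Proof.
move=> zS; have hS := subfield_acl S; rewrite fe_Esum; split; apply/(sfpredP hS).
  by rewrite big_seq; apply: rpred_sum => i /zS[h _]; apply/sfpredP; apply: acl_scale.
rewrite big_seq; apply: rpred_prod => i /zS[_ h]; apply/sfpredP; exact: acl_Escale.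
Qed.

Lemma fe_cB z z' x : c (z - z') x = c z x - c z' x.
Proof.
by rewrite (fe_cD fe) -mulN1r -(rmorphN1 iQ) (fe_cZ fe) mulN1r.
Qed.

Section Rank.
Variables (C J : K -> Prop).
Hypotheses (CC : forall z, acl C z -> C z) (Cw : C w)
  (CJ : forall x, X x -> J x -> C x /\ C (E x))
  (CO : forall x, X x -> ~ J x -> forall z, C z -> Om x z).

Definition spanned (z : K) := forall x, X x -> ~ J x -> c z x = 0.

Lemma spanned_C z : spanned z -> C z.
Proof.
move=> sz; have [s [_ sX -> _]] := fe_supp fe z.
have hC := subfield_acl C; apply: CC; apply/(sfpredP hC); rewrite big_seq.
apply: rpred_sum => x xs; apply/sfpredP.
have [->|cx] := eqVneq (c z x) 0.
  by rewrite rmorph0 mul0r; case: hC.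
apply: acl_scale; apply: acl_incl; have [Xx|->//] := sX x xs.
have [Jx|nJ] := EM (J x); first by case: (CJ Xx Jx).
by rewrite (sz x Xx nJ) eqxx in cx.
Qed.

(** The elements whose expansion avoids [x] and involves, outside [J], only basis elements of level
    at most that of [x]. For them both u and E u avoid the fresh variable of [x]. *)
Let below x u := X x /\ ~ J x /\ c u x = 0 /\
  forall y, X y -> ~ J y -> c u y != 0 -> (lev y <= lev x)%N.

Let below_Om x u : below x u -> Om x u /\ Om x (E u).
Proof.
move=> [Xx [nJ [cux lu]]]; have [s [_ sX uE _]] := fe_supp fe u.
rewrite uE; pose s' := [seq y <- s | c u y != 0].
have -> : \sum_(y <- s) iQ (c u y) * y = \sum_(y <- s') iQ (c u y) * y.
  rewrite big_filter [RHS]big_mkcond; apply: eq_bigr => y _.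
  by case: eqP => // ->; rewrite rmorph0 mul0r.
have aE : acl (fun _ => False) (E w).
  by have := fe_tor fe 1; rewrite rmorph1 mul1r.
apply: acl_Esum_scale => y; rewrite mem_filter => /andP[cy ys].
have [Xy|->] := sX y ys; last first.
  by split; [apply: CO Xx nJ _ Cw|apply: acl_mono aE].
have [Jy|nJy] := EM (J y).
  by have [Cy CEy] := CJ Xy Jy; split; apply: CO.
have yx : y <> x by move=> yx; rewrite yx cux eqxx in cy.
exact: fe_prev Xx Xy yx (lu y Xy nJy cy).
Qed.

(** Subtracting the [x]-component leaves an element [below] x, so [z] and E z inherit the
    alternative of [fe_free] from [x] and E x. *)
Let pivot_free x z : X x -> ~ J x -> c z x != 0 ->
  (forall y, X y -> ~ J y -> c z y != 0 -> (lev y <= lev x)%N) ->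
  (Om x z /\ ~ Om x (E z)) \/ (~ Om x z /\ Om x (E z)).
Proof.
move=> Xx nJ czx lz; pose u := z - iQ (c z x) * x.
have zE : z = iQ (c z x) * x + u by rewrite /u; ring.
have cu y : c u y = c z y - c z x * (y == x)%:R.
  by rewrite /u fe_cB (fe_cZ fe) (fe_cX _ Xx).
have [ou oEu] : Om x u /\ Om x (E u).
  apply: below_Om; split=> //; split=> //; split; first by rewrite cu eqxx mulr1 subrr.
  move=> y Xy nJy; rewrite cu; have [->//|_] := eqVneq y x.
  by rewrite mulr0 subr0; apply: lz.
have hx : x = iQ (c z x)^-1 * (iQ (c z x) * x).
  by rewrite mulrA -rmorphM mulVf // rmorph1 mul1r.
have sc : Om x (iQ (c z x) * x) -> Om x x.
  by move=> h; have := acl_scale (c z x)^-1 h; rewrite -hx.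
have sE : Om x (E (iQ (c z x) * x)) -> Om x (E x).
  by move=> h; have := acl_Escale (c z x)^-1 h; rewrite -hx.
have xz : Om x z <-> Om x x.
  have [_ _ s _] := hOm x; split=> h.
    apply: sc; have -> : iQ (c z x) * x = z - u by rewrite {2}zE; ring.
    by case: (s z u).
  rewrite zE -[u]opprK; case: (s (iQ (c z x) * x) (- u)) => //; first exact: acl_scale.
  by rewrite -sub0r; case: (s 0 u) => //; case: (hOm x).
have Exz : Om x (E z) <-> Om x (E x).
  have [_ _ s _] := hOm x; rewrite zE (fe_E fe); split=> h.
    apply: sE; rewrite -[E _](mulfK (fe_neq0 fe u)).
    by case: (s _ _ h (subfieldV (hOm x) oEu)).
  by case: (s (E (iQ (c z x) * x)) (E u)) => //; apply: acl_Escale.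
by have [[h1 h2]|[h1 h2]] := fe_free Xx; [left|right]; rewrite xz Exz.
Qed.

Definition zEz m (z : 'I_m -> K) :=
  [seq z i | i <- enum 'I_m] ++ [seq E (z i) | i <- enum 'I_m].

Lemma sum_delta m (z : 'I_m -> K) i0 : \sum_i iQ (i == i0)%:R * z i = z i0.
Proof.
rewrite (bigD1 i0) //= eqxx rmorph1 mul1r big1 ?addr0 // => i /negbTE->.
by rewrite rmorph0 mul0r.
Qed.

Lemma zEz_l m (z : 'I_m -> K) i : z i \in zEz z.
Proof. by rewrite mem_cat map_f ?mem_enum. Qed.

Lemma zEz_r m (z : 'I_m -> K) i : E (z i) \in zEz z.
Proof. by rewrite mem_cat orbC (map_f (fun i => E (z i))) ?mem_enum. Qed.

Lemma zEz_P m (z : 'I_m -> K) y : y \in zEz z -> exists i, y = z i \/ y = E (z i).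
Proof. by rewrite mem_cat => /orP[]/mapP[i _ ->]; exists i; auto. Qed.

(** Gaussian elimination in the basis. Take [x] of maximal level occurring in the coordinates
    outside [J], and clear it from all vectors but one pivot. The other vectors, their exponentials
    and [C] avoid the fresh variable of [x], whereas one of the pivot and its exponential does not,
    so each pivot adds one dimension. *)
Lemma free_rank (plus : bool) m (z : 'I_m -> K) :
  (plus -> (forall u, C (E u) -> C u) /\
     forall q : 'I_m -> rat, C (\sum_i iQ (q i) * z i) -> forall i, q i = 0) ->
  (forall q : 'I_m -> rat, spanned (\sum_i iQ (q i) * z i) -> forall i, q i = 0) ->
  exists s, [/\ indep C s, size s = (m + (plus && (0 < m)))%N & forall y, y \in s -> acl (adds C (zEz z)) y].
Proof.
elim: m z => [|m IH] z hplus hz; first by exists [::]; rewrite andbF.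
pose Lev n := `[< exists x i, [/\ X x, ~ J x, c (z i) x != 0 & lev x = n] >].
have [n0 Ln0] : exists n, Lev n.
  apply: contrapT => no; have := hz (fun i => (i == ord0)%:R).
  rewrite sum_delta => h; have /h/(_ ord0)/eqP : spanned (z ord0); last by rewrite oner_eq0.
  move=> x Xx nJ; apply/eqP; apply: contrapT => /negP cx; apply: no.
  by exists (lev x); apply/asboolP; exists x, ord0.
have [bd bdP] : exists bd, forall n, Lev n -> (n <= bd)%N.
  have /choice[sp spP] := fun i => fe_supp fe (z i).
  exists (\sum_i \sum_(x <- sp i) lev x)%N => n /asboolP[x [i [_ _ cx <-]]].
  have [_ _ _ /(_ x cx) xs] := spP i.
  by rewrite (bigD1 i) //= (big_rem x) //= -addnA leq_addr.
have [n /asboolP[x [i0 [Xx nJ cx lx]]] maxn] := ex_maxnP (ex_intro _ n0 Ln0) bdP.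
have levz i y : X y -> ~ J y -> c (z i) y != 0 -> (lev y <= lev x)%N.
  by move=> Xy nJy cy; rewrite lx; apply: maxn; apply/asboolP; exists y, i.
(* The multiples of the pivot vector that remove [x] from the other vectors. *)
pose r j := c (z (lift i0 j)) x / c (z i0) x.
pose z' (j : 'I_m) := z (lift i0 j) - iQ (r j) * z i0.
have sumz' (q : 'I_m -> rat) : \sum_j iQ (q j) * z' j =
    \sum_i iQ (if unlift i0 i is Some j then q j else - \sum_j q j * r j) * z i.
  rewrite (bigD1_ord i0) //= unlift_none; apply/esym; rewrite addrC rmorphN rmorph_sum mulNr mulr_suml.
  rewrite -sumrB; apply: eq_bigr => j _; rewrite liftK /z' rmorphM; ring.
have hz' (P : K -> Prop) : (forall q : 'I_m.+1 -> rat, P (\sum_i iQ (q i) * z i) -> forall i, q i = 0) ->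
    forall q : 'I_m -> rat, P (\sum_j iQ (q j) * z' j) -> forall j, q j = 0.
  move=> hP q; rewrite sumz' => /hP qj j; have := qj (lift i0 j); by rewrite liftK.
have [|s [is_ sz sE]] := IH z' _ (hz' _ hz).
  by move=> /hplus[h1 h2]; split=> //; apply: hz'.
have bz' j : below x (z' j).
  split=> //; split=> //; split; first by rewrite /z' fe_cB (fe_cZ fe) divfK // subrr.
  move=> y Xy nJy; rewrite /z' fe_cB (fe_cZ fe); have [e|nz _] := eqVneq (c (z i0) y) 0; last exact: levz nz.
  by rewrite e mulr0 subr0; apply: levz.
have sOm y : y \in s -> Om x y.
  move/sE; apply: acl_sub => v [Cv|/zEz_P[j]]; first exact: CO.
  by have [h1 h2] := below_Om (bz' j); case=> ->.
have COm v : acl (adds C s) v -> Om x v.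
  by apply: acl_sub => u [Cu|/sOm//]; apply: CO.
have sz' y : y \in s -> acl (adds C (zEz z)) y.
  move/sE; apply: acl_sub => v [Cv|/zEz_P[j h]]; first by apply: acl_incl; left.
  have hS := subfield_acl (adds C (zEz z)).
  have inl i : acl (adds C (zEz z)) (z i) by apply: acl_incl; right; apply: zEz_l.
  have inr i : acl (adds C (zEz z)) (E (z i)) by apply: acl_incl; right; apply: zEz_r.
  have [_ _ sb _] := hS; have z'E : z' j = z (lift i0 j) + iQ (- r j) * z i0.
    by rewrite rmorphN mulNr.
  case: h => ->; last first.
    rewrite z'E (fe_E fe); case: (sb (E (z (lift i0 j))) (E (iQ (- r j) * z i0))) => //.
    exact: acl_Escale.
  by case: (sb (z (lift i0 j)) (iQ (r j) * z i0)) => //; apply: acl_scale.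
have memz : (forall v, v = z i0 \/ v = E (z i0) -> acl (adds C (zEz z)) v).
  by move=> v [|] ->; apply: acl_incl; right; [apply: zEz_l|apply: zEz_r].
have piv := pivot_free Xx nJ cx (levz i0).
(* The additional dimension is gained once, at the last pivot: of z and E z one involves the fresh
   variable, and the other is still outside [C], as [C] is closed under logarithms and contains no
   nontrivial combination. *)
have [pm|npm] := boolP (plus && (m == 0)%N); last first.
  have szE : (m.+1 + (plus && (0 < m.+1)) = (size s).+1)%N.
    by rewrite sz andbT; case: plus npm {hplus IH sz} => //= m0; rewrite lt0n m0 addSn.
  have [v [hv nv]] : exists v, (v = z i0 \/ v = E (z i0)) /\ ~ Om x v.
    by case: piv => -[h1 h2]; [exists (E (z i0))|exists (z i0)]; auto.
  exists (v :: s); rewrite szE; split=> //=; first by split=> // /COm.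
  by move=> y /[!inE]/orP[/eqP->|/sz'//]; apply: memz.
have [pl m0] := andP pm; have [hC hq] := hplus pl.
have nC : ~ C (z i0).
  move=> Cz; have := hq (fun i => (i == i0)%:R).
  by rewrite sum_delta => /(_ Cz i0)/eqP; rewrite eqxx oner_eq0.
have szE : (m.+1 + (plus && (0 < m.+1)) = 2)%N by rewrite pl (eqP m0).
have ad0 v : acl (adds C [::]) v -> C v by move=> h; apply: CC; apply: acl_mono h => y [].
have ad1 u v : Om x u -> acl (adds C [:: u]) v -> Om x v.
  by move=> ou; apply: acl_sub => y [/CO|/[!inE]/eqP->//]; apply.
rewrite szE; case: piv => -[h1 h2].
  exists [:: E (z i0); z i0]; split=> //=.
    by split; [move/(ad1 _ _ h1)|split=> // /ad0].
  by move=> y /[!inE]/orP[]/eqP->; apply: memz; auto.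
exists [:: z i0; E (z i0)]; split=> //=.
  by split; [move/(ad1 _ _ h2)|split=> // /ad0/hC].
by move=> y /[!inE]/orP[]/eqP->; apply: memz; auto.
Qed.

End Rank.
End FreeExponential.

(** * Countable closure under field operations, roots, exponentials, logarithms and supports *)

Section CountableHull.
Variables (K : closedFieldType) (n0 : seq K) (E lg th : K -> K) (sp : K -> seq K).

Let root_list_ex (p : {poly K}) : exists rs : seq K,
  p != 0 -> forall z, p.[z] = 0 -> z \in rs.
Proof.
have [rs pE] := closed_field_poly_normal p; exists rs => p0 z pz.
move/eqP: pz; rewrite pE hornerZ mulf_eq0 lead_coef_eq0 (negbTE p0) /= horner_prod.
rewrite prodf_seq_eq0 => /hasP[y yr /=]; rewrite hornerXsubC subr_eq0 => /eqP->; exact: yr.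
Qed.
Let roots p := sval (cid (root_list_ex p)).

(** A label encodes the kind of operation and an index into a finite list. Elements of the hull are
    values of finite trees with natural labels, and these trees are countable. *)
Let op (l : nat) (a : seq K) : K :=
  match (unpickle l : option (nat * nat)) with
  | Some (0%N, _) => a`_0 - a`_1
  | Some (1%N, _) => a`_0 * a`_1
  | Some (2%N, _) => (a`_0)^-1
  | Some (3%N, _) => E a`_0
  | Some (4%N, _) => lg a`_0
  | Some (5%N, _) => th a`_0
  | Some (6%N, k) => (sp a`_0)`_k
  | Some (7%N, k) => (roots (Poly a))`_k
  | _ => 1
  end.

Fixpoint hull_eval (t : GenTree.tree nat) : K :=
  match t with
  | GenTree.Leaf k => n0`_k
  | GenTree.Node l ts => op l (map hull_eval ts)
  end.

Definition hull (x : K) := exists t, hull_eval t = x.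

Lemma hull_countable : exists f : nat -> K, forall x, hull x -> exists k, f k = x.
Proof.
exists (fun k => if unpickle k is Some t then hull_eval t else 0) => x [t <-].
by exists (pickle t); rewrite pickleK.
Qed.

Let hull_args (a : seq K) : (forall x, x \in a -> hull x) -> exists ts, map hull_eval ts = a.
Proof.
elim: a => [|x a IH] ha; first by exists [::].
have [ts <-] := IH (fun y ya => ha y (mem_behead (s := x :: a) ya)).
by have [t <-] := ha x (mem_head _ _); exists (t :: ts).
Qed.

Let hull_op (tag k : nat) a : (forall x, x \in a -> hull x) -> hull (op (pickle (tag, k)) a).
Proof. by move=> /hull_args[ts <-]; exists (GenTree.Node (pickle (tag, k)) ts). Qed.

Let opE tag k a : op (pickle ((tag, k) : nat * nat)) a = match tag with
  | 0%N => a`_0 - a`_1 | 1%N => a`_0 * a`_1 | 2%N => (a`_0)^-1 | 3%N => E a`_0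
  | 4%N => lg a`_0 | 5%N => th a`_0 | 6%N => (sp a`_0)`_k | 7%N => (roots (Poly a))`_k
  | _ => 1 end.
Proof. by rewrite /op pickleK. Qed.

Lemma hull_gen x : x \in n0 -> hull x.
Proof. by move=> xn; exists (GenTree.Leaf (index x n0)); rewrite /= nth_index. Qed.

Let hull1 (tag k : nat) x : hull x -> hull (op (pickle (tag, k)) [:: x]).
Proof. by move=> hx; apply: hull_op => y /[!inE]/eqP->. Qed.

Lemma hull_E x : hull x -> hull (E x).
Proof. by move/(hull1 3%N 0%N); rewrite opE. Qed.
Lemma hull_lg x : hull x -> hull (lg x).
Proof. by move/(hull1 4%N 0%N); rewrite opE. Qed.
Lemma hull_th x : hull x -> hull (th x).
Proof. by move/(hull1 5%N 0%N); rewrite opE. Qed.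
Lemma hull_sp x y : hull x -> y \in sp x -> hull y.
Proof. by move=> /(hull1 6%N (index y (sp x))%N); rewrite opE /= => h ys; rewrite nth_index in h. Qed.

Lemma hull_subfield : subfield hull.
Proof.
(* Tag 8 falls into the default branch, whose value is 1. *)
have h1 : hull 1 by have := @hull_op 8%N 0%N [::] (fun x (h : x \in [::]) => match notF h with end); rewrite opE.
have hB x y : hull x -> hull y -> hull (x - y).
  move=> hx hy; have := @hull_op 0%N 0%N [:: x; y]; rewrite opE; apply=> z.
  by rewrite !inE => /orP[]/eqP->.
split=> //; first by rewrite -(subrr 1); apply: hB.
  move=> x y hx hy; split; first exact: hB.
  have := @hull_op 1%N 0%N [:: x; y]; rewrite opE; apply=> z.
  by rewrite !inE => /orP[]/eqP->.
by move=> x /(hull1 2%N 0%N); rewrite opE.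
Qed.

Lemma hull_acl x : acl hull x -> hull x.
Proof.
move=> [p [p0 hp px]]; have hp' i : hull p`_i by apply: hp => //; apply: hull_subfield.
have := @hull_op 7%N (index x (roots p)) p; rewrite opE polyseqK nth_index.
  by apply=> y /(nthP 0)[i _ <-].
exact: (svalP (cid (root_list_ex p))).
Qed.

End CountableHull.

(** * The Schanuel property *)

Section FreeAxioms.
Variables (K : closedFieldType) (ch : [pchar K] =i pred0).
Variables (E : K -> K) (w : K) (fe : free_exp ch E w).
Local Notation iQ := (Q2K ch).
Local Notation B := (fe_B fe).
Local Notation X := (fe_X fe).
Local Notation fr := (fe_fr fe).
Local Notation c := (fe_c fe).

Lemma subfield_in_gen_field (s : seq K) : subfield (in_gen_field s).
Proof.
have e x : in_gen_field s x <-> gen (fun y => y \in s) x.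
  by split=> h F hF; [move=> sF; apply: h|move=> _ sF; apply: h].
have [g0 g1 gs gi] := subfield_gen (fun y => y \in s).
split; [by apply/e|by apply/e| |by move=> x /e gx x0; apply/e; apply: gi].
by move=> x y /e gx /e gy; have [h1 h2] := gs x y gx gy; split; apply/e.
Qed.

(** If no nontrivial combination of [z] is a rational multiple of [w], the rank over acl(w) is
    already n. Otherwise one coordinate of such a combination is dropped: the others have rank n - 1
    over acl(w), and [w], which is transcendental and algebraic over [z], supplies the missing
    element. *)
Lemma free_SP : axiom_SP E.
Proof.
move=> n z Qz; pose C := acl (fun y => y = w).
have CC x : acl C x -> C x by apply: acl_sub.
have Cw : C w by apply: acl_incl.
pose J (_ : K) := False.
have CJ x : X x -> J x -> C x /\ C (E x) by [].
have CO x : X x -> ~ J x -> forall y, C y -> acl (fun b => B b /\ b <> fr x) y.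
  by move=> Xx _ y; apply: acl_sub => _ ->; apply: fe_wfr Xx.
have fin0 d t : indep (fun _ => False) t -> size t = d ->
    (forall y, y \in t -> acl (adds (fun _ => False) (zEz E z)) y) ->
    trdeg_ge (in_gen_field [::]) (zEz E z) d.
  move=> it st tz; have hg := subfield_in_gen_field [::].
  have it' : indep (in_gen_field [::]) t.
    apply: indep_mono it => x gx; apply: acl_gen; apply: gx => //; exact: subfield_gen.
  have [|t' [tt it'' st']] := indep_sub (t := zEz E z) it'.
    by move=> y /tz; apply: acl_mono => v [//|]; right.
  apply: (@indep_trdeg_ge _ _ _ t') => //; first by case: hg.
    by rewrite st'.
  by move=> x; apply: mem_subseq.
have Qz' (q : 'I_n -> rat) : \sum_i iQ (q i) * z i = 0 -> forall i, q i = 0.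
  by move=> h; apply: Qz; rewrite -[RHS]h; apply: eq_bigr => i _; rewrite Q2KE.
have [all0|] := EM (forall q : 'I_n -> rat, spanned fe J (\sum_i iQ (q i) * z i) -> forall i, q i = 0).
  have [//|s [is_ sz sC]] := free_rank CC Cw CJ CO (plus := false) _ all0.
  have [s' [ss is' sz']] := indep_sub is_ sC.
  apply: (fin0 n s').
  - by apply: indep_mono is' => x.
  - by rewrite sz' sz addn0.
  - by move=> y ys; apply: acl_incl; right; apply: (mem_subseq ss).
move=> nall; have [q [sq [i0 qi0]]] : exists q : 'I_n -> rat,
    spanned fe J (\sum_i iQ (q i) * z i) /\ exists i, q i != 0.
  apply: contrapT => no; apply: nall => q sq i; apply/eqP; apply: contrapT => /negP qi.
  by apply: no; exists q; split=> //; exists i.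
case: n z Qz fin0 Qz' nall q sq i0 qi0 => [|n] z Qz fin0 Qz' nall q sq i0 qi0; first by move: (ltn_ord i0).
pose u := \sum_i iQ (q i) * z i.
have cJ x : X x -> c u x = 0 by move=> Xx; apply: sq.
have ux v : (forall x, X x -> c v x = 0) -> v = iQ (c v w) * w.
  move=> cv; have [s [us sX ve cs]] := fe_supp fe v; rewrite [LHS]ve.
  have [ws|ws] := boolP (w \in s).
    rewrite (bigD1_seq w) //= big_seq_cond big1 ?addr0 // => y /andP[ys yw].
    by have [/cv->|e] := sX y ys; [rewrite rmorph0 mul0r|rewrite e eqxx in yw].
  rewrite [in RHS](_ : c v w = 0) ?rmorph0 ?mul0r; last first.
    by apply/eqP; apply: contraNT ws => /cs.
  rewrite big_seq big1 // => y ys.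
  by have [/cv->|e] := sX y ys; [rewrite rmorph0 mul0r|rewrite -e ys in ws].
have un0 : u != 0 by apply/eqP => /Qz'/(_ i0)/eqP; rewrite (negbTE qi0).
have cuw : c u w != 0.
  by apply: contraNneq un0 => e; rewrite (ux u cJ) e rmorph0 mul0r.
pose z' j := z (lift i0 j).
have [//|q' sq'|s [is_ sz sC]] := @free_rank _ _ _ _ fe C J CC Cw CJ CO false _ z'.
  (* Another combination that is a multiple of [w] is a multiple of [u]. Its coefficient at the
     dropped coordinate is zero, so by independence of [z] it is trivial. *)
  have e : \sum_j iQ (q' j) * z' j = iQ (c (\sum_j iQ (q' j) * z' j) w / c u w) * u.
    transitivity (iQ (c (\sum_j iQ (q' j) * z' j) w) * w).
      by apply: ux => x Xx; apply: sq'.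
    by rewrite [X in _ = _ * X](ux u cJ) mulrA -rmorphM divfK.
  set a := _ / _ in e.
  have h : \sum_i iQ ((if unlift i0 i is Some j then q' j else 0) - a * q i) * z i = 0.
    transitivity (\sum_j iQ (q' j) * z' j - iQ a * u); last by rewrite e subrr.
    rewrite /u mulr_sumr (bigD1_ord i0) //= unlift_none sub0r [in RHS](bigD1_ord i0) //=.
    rewrite opprD addrCA -sumrB rmorphN rmorphM; congr (_ + _); first by ring.
    by apply: eq_bigr => j _; rewrite liftK rmorphB rmorphM /z' mulrBl mulrA.
  have ha : a = 0.
    have := Qz' _ h i0; rewrite unlift_none sub0r => /eqP; rewrite oppr_eq0 mulf_eq0.
    by rewrite (negbTE qi0) orbF => /eqP.
  by move=> j; have := Qz' _ h (lift i0 j); rewrite liftK ha mul0r subr0.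
have [s' [ss is' sz']] := indep_sub is_ sC.
apply: (fin0 n.+1 (s' ++ [:: w])).
- apply/indep_cat; split=> /=.
    by split=> // h; apply: (fe_w fe); apply: acl_mono h => y [].
  by apply: indep_mono is' => x [//|/[!inE]/eqP->]; apply/acl_incl.
- by rewrite size_cat sz' sz addn0 addn1.
move=> y; rewrite mem_cat inE => /orP[/(mem_subseq ss)/zEz_P[j h]|/eqP->].
  by apply: acl_incl; right; case: h => ->; [apply: zEz_l|apply: zEz_r].
have -> : w = iQ (c u w)^-1 * u by rewrite {2}(ux u cJ) mulrA -rmorphM mulVf // rmorph1 mul1r.
apply: acl_scale.
have [|] // := @acl_Esum_scale _ ch _ _ fe (adds (fun _ => False) (zEz E z)) _ (index_enum _) q z.
move=> i _.
by split; apply: acl_incl; right; [apply: zEz_l|apply: zEz_r].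
Qed.

End FreeAxioms.

(** * Countable closure *)

Lemma Gpt_l (K : fieldType) n (a b : 'I_n -> K) j : Gpt a b (lshift n j) = a j.
Proof. by rewrite /Gpt (unsplitK (inl _ j)). Qed.
Lemma Gpt_r (K : fieldType) n (a b : 'I_n -> K) j : Gpt a b (rshift n j) = b j.
Proof. by rewrite /Gpt (unsplitK (inr _ j)). Qed.

Section LaurentSubstitution.
Variables (K : closedFieldType) (m n : nat) (M : 'M[int]_(m, n)) (k : K -> Prop).
Hypothesis hk : subfield k.

Definition monomial_map (z w : 'I_n -> K) : 'I_(m + m) -> K :=
  Gpt (fun i => \sum_j (M i j)%:~R * z j) (fun i => \prod_j (w j) ^ (M i j)).

(* Negative exponents are cleared by a power of the product of the multiplicative coordinates. *)
Definition laurent (p : {mpoly K[m + m]}) := exists (e : nat) (q : {mpoly K[n + n]}),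
  mover k q /\ forall z w, (forall j, w j != 0) ->
    q.@[Gpt z w] = (\prod_j w j) ^+ e * p.@[monomial_map z w].

Let W : {mpoly K[n + n]} := \prod_j 'X_(rshift n j).

Let Wk : W \is a mpolyOver _ (sfpred hk).
Proof. by apply: rpred_prod => j _; apply: mpolyOverX. Qed.

Let WE z w : W.@[Gpt z w] = \prod_j w j.
Proof.
by rewrite rmorph_prod; apply: eq_bigr => j _; rewrite /= mevalXU Gpt_r.
Qed.

Let laurentC c : k c -> laurent c%:MP.
Proof.
move=> kc; exists 0%N, c%:MP; split=> [|z w _]; last by rewrite expr0 mul1r !mevalC.
by apply/(moverP hk); rewrite mpolyOverC; apply/sfpredP.
Qed.

Let laurentD p q : laurent p -> laurent q -> laurent (p + q).
Proof.
move=> [e [p' [/(moverP hk) kp pE]]] [e' [q' [/(moverP hk) kq qE]]].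
exists (e + e')%N, (W ^+ e' * p' + W ^+ e * q'); split=> [|z w w0].
  by apply/(moverP hk); rewrite rpredD // rpredM // rpredX.
by rewrite !mevalD !mevalM !rmorphXn /= WE pE // qE // exprD; ring.
Qed.

Let laurentM p q : laurent p -> laurent q -> laurent (p * q).
Proof.
move=> [e [p' [/(moverP hk) kp pE]]] [e' [q' [/(moverP hk) kq qE]]].
exists (e + e')%N, (p' * q'); split=> [|z w w0]; first by apply/(moverP hk); rewrite rpredM.
by rewrite !mevalM pE // qE // exprD; ring.
Qed.

Lemma laurent_clear p : mover k p -> laurent p.
Proof.
move=> kp; rewrite (mpolyE p).
have h0 : k 0 by case: hk.
have h1 : k 1 by case: hk.
elim/big_ind: _ => [|u v|mm _]; [by rewrite -mpolyC0; apply: laurentC|exact: laurentD|].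
rewrite -mul_mpolyC; apply: laurentM; first exact: laurentC.
rewrite mpolyXE_id; elim/big_ind: _ => [|u v|i _]; [by rewrite -mpolyC1; apply: laurentC|exact: laurentM|].
elim: (mm i) => [|d IH]; first by rewrite expr0 -mpolyC1; apply: laurentC.
rewrite exprS; apply: laurentM IH => {mm d}.
have intk (a : int) : a%:~R \in sfpred hk by apply: rpred_int.
rewrite -(splitK i); case: (split i) => j /=.
  exists 0%N, (\sum_l (M j l)%:~R *: 'X_(lshift n l)); split=> [|z w _].
    apply/(moverP hk); apply: rpred_sum => l _; rewrite -mul_mpolyC.
    by rewrite rpredM ?mpolyOverX // mpolyOverC.
  rewrite expr0 mul1r mevalXU /monomial_map Gpt_l rmorph_sum /=; apply: eq_bigr => l _.
  by rewrite mevalZ mevalXU Gpt_l.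
pose e := (\sum_l `|M j l|)%N.
exists e, (\prod_l 'X_(rshift n l) ^+ `|M j l + e%:Z|); split=> [|z w w0].
  by apply/(moverP hk); apply: rpred_prod => l _; rewrite rpredX ?mpolyOverX.
rewrite mevalXU /monomial_map Gpt_r rmorph_prod /= -prodrXl -big_split /=; apply: eq_bigr => l _.
rewrite rmorphXn /= mevalXU Gpt_r.
have le : (`|M j l| <= e)%N by rewrite /e (bigD1 l) //= leq_addr.
have : 0 <= M j l + e%:Z by lia.
by move=> /gez0_abs h; rewrite !exprnP h addrC expfzDr ?w0.
Qed.

End LaurentSubstitution.

Section CountableClosure.
Variables (K : closedFieldType) (ch : [pchar K] =i pred0).
Variables (E : K -> K) (w : K) (fe : free_exp ch E w).
Local Notation iQ := (Q2K ch).
Local Notation B := (fe_B fe).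
Local Notation X := (fe_X fe).
Local Notation fr := (fe_fr fe).

(** If x and y differed but shared a fresh variable, the one of lower level would have both itself
    and its exponential free of its own fresh variable. *)
Lemma free_fr_inj x y : X x -> X y -> fr x = fr y -> x = y.
Proof.
have aux x' y' : X x' -> X y' -> fr x' = fr y' -> (fe_lev fe x' <= fe_lev fe y')%N -> x' = y'.
  move=> Xx Xy e le; apply: contrapT => ne; have := fe_prev Xy Xx ne le; rewrite -e.
  by case: (fe_free Xx) => -[h1 h2] [h3 h4].
move=> Xx Xy e; have [le|/ltnW le] := leqP (fe_lev fe x) (fe_lev fe y); first exact: aux.
by apply/esym/aux.
Qed.

(** The function [th] brings in a basis element as soon as its fresh variable is in [C], and [sp]
    brings in a finite support of every element. Hence [C] avoids the fresh variable of each basis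
    element it does not contain, as [free_rank] demands. One chosen logarithm per value suffices, as
    the kernel is generated by [w]. *)
Lemma countable_strong_closure (s : seq K) : exists C : K -> Prop,
  [/\ exists f : nat -> K, forall x, C x -> exists k, f k = x,
      forall x, x \in s -> C x, forall x, acl C x -> C x,
      (forall x, C x -> C (E x)) /\ (forall x, C (E x) -> C x) &
      forall m (z : 'I_m -> K),
        (forall q : 'I_m -> rat, C (\sum_i iQ (q i) * z i) -> forall i, q i = 0) ->
        (0 < m)%N -> exists t, [/\ indep C t, size t = m.+1 & forall y, y \in t -> y \in zEz E z]].
Proof.
have /choice[lg lgP] y : exists x, y != 0 -> E x = y.
  have [->|/(fe_log fe)[x xy]] := eqVneq y 0; [by exists 0|by exists x].
have /choice[th thP] b : exists x, forall x', X x' -> fr x' = b -> x = x'.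
  have [[x [Xx xb]]|no] := EM (exists x, X x /\ fr x = b).
    by exists x => x' Xx' x'b; apply: free_fr_inj => //; rewrite x'b.
  by exists 0 => x Xx xb; case: no; exists x.
have /choice[sp spP] z : exists t : seq K, (forall b, b \in t -> B b) /\ acl (fun b => b \in t) z.
  have := fe_basis fe z; move/acl_fin => [t [tB tz]]; by exists t.
pose C := hull (w :: s) E lg th sp.
have CC x : acl C x -> C x by apply: hull_acl.
have hC : subfield C := hull_subfield _ _ _ _ _.
have Cw : C w by apply: hull_gen; rewrite mem_head.
have CE x : C x -> C (E x) by apply: hull_E.
have CL x : C (E x) -> C x.
  move=> /hull_lg; rewrite -/C; set l := lg _ => Cl.
  have lE : E l = E x by apply: lgP; apply: (fe_neq0 fe).
  have [n ln] : exists n : int, x - l = w *~ n.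
    by apply: (fe_ker fe); rewrite (fe_E fe) (fe_EN fe) lE mulfV ?(fe_neq0 fe).
  rewrite -(subrK l x) ln; apply/(sfpredP hC); rewrite rpredD ?rpredMz //; exact/sfpredP.
exists C; split=> //; first exact: hull_countable.
  by move=> x xs; apply: hull_gen; rewrite inE xs orbT.
pose J x := X x /\ C (fr x).
have CJ x : X x -> J x -> C x /\ C (E x).
  move=> Xx [_ Cx]; suff h : C x by split=> //; apply: CE.
  by have := hull_th Cx; rewrite (thP _ _ Xx).
have CO x : X x -> ~ J x -> forall z, C z -> acl (fun b => B b /\ b <> fr x) z.
  move=> Xx nJ z Cz; have [sB sz] := spP z; apply: acl_mono sz => b bs; split; first exact: sB.
  by move=> bx; apply: nJ; split=> //; rewrite -bx; apply: hull_sp Cz bs.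
move=> m z hz m0.
have [||t [it st tC]] := free_rank CC Cw CJ CO (plus := true) (z := z).
- by move=> _; split.
- by move=> q /(spanned_C CC Cw CJ); apply: hz.
have [t' [tt it' st']] := indep_sub it tC.
exists t'; split=> //; first by rewrite st' st m0 addn1.
by move=> y; apply: mem_subseq.
Qed.

End CountableClosure.

Lemma integer_multiple m n (A : 'M[rat]_(m, n)) :
  exists (d : int) (M : 'M[int]_(m, n)), d != 0 /\ map_mx intr M = d%:~R *: A.
Proof.
pose D (P : pred ('I_m * 'I_n)) : int := \prod_(p : 'I_m * 'I_n | P p) denq (A p.1 p.2).
exists (D predT), (\matrix_(i, j) (numq (A i j) * D (fun p => p != (i, j)))); split.
  by apply/prodf_neq0 => p _; apply: denq_neq0.
apply/matrixP => i j; rewrite !mxE intrM numqE.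
have -> : D predT = denq (A i j) * D (fun p => p != (i, j)) by rewrite /D (bigD1 (i, j)).
by rewrite [in RHS]intrM; ring.
Qed.

Lemma indep_zdim_lt (K : closedFieldType) (ch : [pchar K] =i pred0) (n : nat)
    (V : ('I_(n + n) -> K) -> Prop) (k : K -> Prop) (z y : 'I_n -> K) :
  subfield k -> zirreducible (@Gdom K n) V -> zclosed_over k (@Gdom K n) V ->
  ~ zdim_ge (@Gdom K n) V n.+1 -> V (Gpt z y) ->
  (exists t, [/\ indep k t, size t = n & forall v, v \in t -> v \in codom (Gpt z y)]) ->
  forall p, mover k p -> p.@[Gpt z y] = 0 -> forall v, V v -> p.@[v] = 0.
Proof.
move=> hk irV cV dV Vz [t [it st tz]] p.
pose d : {mpoly K[n + n]} := \prod_j 'X_(rshift n j).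
have dD v : Gdom v <-> d.@[v] != 0.
  rewrite rmorph_prod /=; split=> [Dv|/prodf_neq0 h j].
    by apply/prodf_neq0 => j _; rewrite mevalXU; apply: Dv.
  by have := h j isT; rewrite mevalXU.
have dk k' : subfield k' -> mover k' d.
  by move=> hk'; apply/(moverP hk'); apply: rpred_prod => j _; apply: mpolyOverX.
exact: (generic_point_vanishing dD dk hk irV cV Vz it st tz dV).
Qed.

Section CountableClosureProperty.
Variables (K : closedFieldType) (ch : [pchar K] =i pred0).
Variables (E : K -> K) (w : K) (fe : free_exp ch E w).
Local Notation iQ := (Q2K ch).

(** A matrix of maximal rank among those with all rows in the space of relations modulo [C]: a
    relation outside its row space would increase the rank. *)
Lemma relation_matrix (C : K -> Prop) n (z : 'I_n -> K) : subfield C ->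
  exists A : 'M[rat]_n, forall u : 'rV[rat]_n,
    C (\sum_j iQ (u 0 j) * z j) <-> (u <= A)%MS.
Proof.
move=> hC; pose U (u : 'rV[rat]_n) := C (\sum_j iQ (u 0 j) * z j).
have iC q : C (iQ q).
  by have := @Q2K_gen K ch (fun _ => False) q; apply.
have UD (a b : 'rV_n) (q q' : rat) : U a -> U b -> U (q *: a + q' *: b).
  move=> Ua Ub; have -> : U (q *: a + q' *: b) = C (iQ q * (\sum_j iQ (a 0 j) * z j) + iQ q' * (\sum_j iQ (b 0 j) * z j)).
    congr C; rewrite !mulr_sumr -big_split; apply: eq_bigr => j _ /=.
    by rewrite !mxE rmorphD !rmorphM; ring.
  apply/(sfpredP hC); rewrite rpredD // rpredM //; exact/sfpredP.
have Usub m (A : 'M_(m, n)) u : (forall i, U (row i A)) -> (u <= A)%MS -> U u.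
  move=> UA /submxP[D ->]; rewrite mulmx_sum_row; elim/big_ind: _ => //.
  - by rewrite /U big1 => [|j _]; [case: hC|rewrite mxE rmorph0 mul0r].
  - by move=> a b Ua Ub; have := UD a b 1 1 Ua Ub; rewrite !scale1r.
  - by move=> i _; have := UD _ _ (D 0 i) 0 (UA i) (UA i); rewrite scale0r addr0.
pose P r := `[< exists A : 'M[rat]_n, (forall i, U (row i A)) /\ \rank A = r >].
have P0 : exists r, P r.
  exists 0%N; apply/asboolP; exists 0; split=> [i|]; last exact: mxrank0.
  by rewrite row0 /U big1 => [|j _]; [case: hC|rewrite mxE rmorph0 mul0r].
have Pn r : P r -> (r <= n)%N by move=> /asboolP[A [_ <-]]; apply: rank_leq_row.
have [r /asboolP[A [UA rA]] maxr] := ex_maxnP P0 Pn.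
exists A => u; split; last exact: Usub.
move=> Uu; apply: contrapT => /negP nu.
have : (A < A + u)%MS.
  rewrite ltmxE addsmxSl /=; apply: contra nu; apply: submx_trans; exact: addsmxSr.
move=> /rank_ltmx; rewrite rA ltnNge; case/negP; apply: maxr.
apply/asboolP; exists (A + u)%MS; split=> // i.
have := row_sub i (A + u)%MS; move=> /sub_addsmxP[[D1 D2] /= ->].
have := UD (D1 *m A) (D2 *m u) 1 1; rewrite !scale1r; apply.
  by apply: Usub UA _; apply: submxMl.
by rewrite [D2]mx11_scalar mul_scalar_mx; have := UD _ _ (D2 0 0) 0 Uu Uu; rewrite scale0r addr0.
Qed.

(** Let r be the rank of the relations modulo [C], and suppose r < n. The image under the relation
    matrix has transcendence degree at least r over [k] and lies in [C]; the n - r complementary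
    combinations contribute n - r + 1 over [C]. The sum n + 1 contradicts genericity. *)
Lemma generic_solution_closed (C : K -> Prop) (s : seq K) n (V : ('I_(n + n) -> K) -> Prop) z i :
  (forall x, acl C x -> C x) -> (forall x, C x -> C (E x)) -> (forall x, x \in s -> C x) ->
  (forall m (z : 'I_m -> K),
    (forall q : 'I_m -> rat, C (\sum_i iQ (q i) * z i) -> forall i, q i = 0) ->
    (0 < m)%N -> exists t, [/\ indep C t, size t = m.+1 & forall y, y \in t -> y \in zEz E z]) ->
  zirreducible (@Gdom K n) V -> rotund V -> depth0 V -> E_defined E s V ->
  generic_solution E s V z -> C (z i).
Proof.
move=> CC CE sC Crank irV rotV [dVn dVn1] cV [Vz [d [[dVd dVd1] [td td1]]]].
set k := in_gen_field _ in cV td td1; have hk : subfield k := subfield_in_gen_field _.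
have hC : subfield C.
  have [C0 C1 Cs Ci] := subfield_acl C; split; try exact: CC.
    by move=> x y Cx Cy; have [h1 h2] := Cs x y (acl_incl Cx) (acl_incl Cy); split; apply: CC.
  by move=> x Cx x0; apply/CC/Ci => //; apply: acl_incl.
have kC x : k x -> C x.
  apply=> //; move=> y; rewrite mem_cat => /orP[/sC//|/mapP[v /sC vC ->]]; exact: CE.
have mono a b : (a <= b)%N -> zdim_ge (@Gdom K n) V b -> zdim_ge (@Gdom K n) V a.
  move=> ab [Ch [h1 h2]]; exists Ch; split=> j ja; [apply: h1|apply: h2]; exact: leq_trans ja ab.
have dn : d = n.
  apply/eqP; rewrite eqn_leq; apply/andP; split; rewrite leqNgt; apply/negP => lt.
    by apply: dVn1; apply: mono lt dVd.
  by apply: dVd1; apply: mono lt dVn.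
subst d; have [t [it st tz]] := trdeg_ge_indep hk td.
have cod v : (v \in codom (Gpt z (fun i => E (z i)))) = (v \in zEz E z).
  apply/codomP/idP=> [[j ->]|/zEz_P[j [] ->]]; last 2 first.
  - by exists (lshift n j); rewrite Gpt_l.
  - by exists (rshift n j); rewrite Gpt_r.
  by rewrite -(splitK j); case: (split j) => l; rewrite /= ?Gpt_l ?Gpt_r; [apply: zEz_l|apply: zEz_r].
have van := indep_zdim_lt ch hk irV cV dVn1 Vz.
have {}van : forall p, mover k p -> p.@[Gpt z (fun i => E (z i))] = 0 -> forall v, V v -> p.@[v] = 0.
  by apply: van; exists t; split=> // v /tz; rewrite cod.
have [A AP] := relation_matrix z hC.
apply: contrapT => nCi.
have rA : (\rank A < n)%N.
  rewrite ltn_neqAle rank_leq_row andbT; apply/negP => rf; apply: nCi.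
  have : ((delta_mx 0 i : 'rV[rat]_n) <= A)%MS by apply: submx_full.
  move/AP; rewrite (bigD1 i) //= mxE !eqxx rmorph1 mul1r big1 ?addr0 // => j /negbTE ji.
  by rewrite mxE ji andbF rmorph0 mul0r.
have [e [M [e0 ME]]] := integer_multiple A.
have rM : \rank (map_mx intr M : 'M[rat]_n) = \rank A.
  by rewrite ME mxrank_scale_nz // intr_eq0.
have := rotV M; rewrite rM => rot.
pose yM := monomial_map M z (fun i => E (z i)).
(* A relation of the image point over [k] pulls back, with denominators cleared, to a polynomial
   vanishing at the generic point and thus on [V]. Hence it holds on the whole image, as
   [chain_trdeg] requires. *)
have [s1 [is1 ss1 s1y]] : exists s1, [/\ indep k s1, size s1 = \rank A & forall v, v \in s1 -> v \in codom yM].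
  apply: (chain_trdeg (k := k) (y := yM) hk rot) => p kp py v [Dv]; apply=> _ [z' [y' [Vzy ->]]].
  have [l [q [kq qE]]] := laurent_clear M hk kp.
  have y'0 j : y' j != 0.
    by have [[S VS] _ _] := irV; case/VS: Vzy => /(_ j); rewrite Gpt_r.
  have q0 : q.@[Gpt z (fun i => E (z i))] = 0.
    by rewrite qE ?py ?mulr0 // => j; apply: (fe_neq0 fe).
  have := qE z' y' y'0; rewrite (van q kq q0 _ Vzy) => /esym/eqP.
  rewrite mulf_eq0 expf_eq0 => /orP[/andP[_ h]|/eqP //].
  by move: h; apply/contraTeq => _; apply/prodf_neq0.
have yMP v : v \in codom yM ->
    exists l, let u := \sum_j iQ (M l j)%:~R * z j in v = u \/ v = E u.
  move=> /codomP[j ->]; rewrite /yM /monomial_map -(splitK j); case: (split j) => l /=; exists l.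
    by left; rewrite Gpt_l; apply: eq_bigr => j' _; rewrite rmorph_int.
  right; rewrite Gpt_r (fe_Esum fe); apply: eq_bigr => j' _.
  by rewrite rmorph_int mulrzl (fe_Ez fe).
have s1C v : v \in s1 -> C v.
  have CM l : C (\sum_j iQ (M l j)%:~R * z j).
    have : (row l A <= A)%MS by apply: row_sub.
    move/AP => h; have -> : \sum_j iQ (M l j)%:~R * z j = e%:~R * (\sum_j iQ (row l A 0 j) * z j).
      rewrite mulr_sumr; apply: eq_bigr => j _; rewrite mulrA; congr (_ * _).
      have := congr1 (fun N : 'M[rat]_n => iQ (N l j)) ME.
      by rewrite !mxE rmorphM (rmorph_int iQ e).
    by apply/(sfpredP hC); rewrite rpredM ?rpred_int //; apply/sfpredP.
  by move=> /s1y/yMP[l [] ->]; [apply: CM|apply/CE/CM].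
(* A combination of complementary rows that lands in [C] belongs to the row space of [A] as well,
   hence is zero; so these n - r vectors are independent modulo [C]. *)
pose R := row_base (A^C)%MS.
have rR : row_free R by apply: row_base_free.
pose z' l := \sum_j iQ (R l j) * z j.
have szR : (\rank (A^C)%MS = n - \rank A)%N by apply: mxrank_compl.
have [||t' [it' st' tz']] := Crank _ z'.
- move=> q; pose qv : 'rV_(\rank (A^C)%MS) := \row_l q l.
  have -> : \sum_l iQ (q l) * z' l = \sum_j iQ ((qv *m R) 0 j) * z j.
    rewrite /z'; under eq_bigr => l _ do rewrite mulr_sumr.
    rewrite exchange_big; apply: eq_bigr => j _ /=; rewrite mxE rmorph_sum mulr_suml.
    by apply: eq_bigr => l _; rewrite [qv 0 l]mxE rmorphM mulrA.
  move/AP => h l; have : (qv *m R <= A :&: A^C)%MS.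
    by rewrite sub_capmx h (submx_trans (submxMl _ _)) // eq_row_base.
  rewrite capmx_compl submx0 mulmx_free_eq0 // => /eqP/rowP/(_ l); by rewrite !mxE.
- by rewrite szR subn_gt0.
apply: td1; have it1 : indep k (t' ++ s1).
  apply/indep_cat; split=> //; apply: indep_mono it' => v [/kC|/s1C]; exact: acl_incl.
have zS j : acl (adds k (zEz E z)) (z j) /\ acl (adds k (zEz E z)) (E (z j)).
  by split; apply: acl_incl; right; [apply: zEz_l|apply: zEz_r].
have lin (q : 'I_n -> rat) := @acl_Esum_scale K ch E w fe (adds k (zEz E z)) _ (index_enum _) q z (fun j _ => zS j).
have [|u [su iu szu]] := indep_sub (t := zEz E z) it1.
  move=> v; rewrite mem_cat => /orP[/tz'/zEz_P[j [] ->]|/s1y/yMP[l [] ->]].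
  - by have [] := lin (R j).
  - by have [] := lin (R j).
  - by have [] := lin (fun j => (M l j)%:~R).
  - by have [] := lin (fun j => (M l j)%:~R).
apply: (@indep_trdeg_ge _ _ _ u) => //; first by case: hk.
  by rewrite szu size_cat st' ss1 szR addSn subnK // ltnW.
by move=> v; apply: mem_subseq.
Qed.

Lemma free_CCP : axiom_CCP E.
Proof.
move=> n V s irV _ rotV dV cV.
have [C [[f fP] sC CC [CE _] Crank]] := countable_strong_closure fe s.
exists (fun k => if (unpickle k : option {ffun 'I_n -> nat}) is Some g then (fun i => f (g i)) else (fun=> 0)).
move=> z sz; have /choice[g gP] i : exists k, f k = z i.
  by apply: fP; apply: (@generic_solution_closed C s n V z i CC CE sC Crank irV rotV dV cV sz).
exists (pickle [ffun i => g i]); rewrite pickleK; apply: funext => i; by rewrite ffunE.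
Qed.

End CountableClosureProperty.

(** * Rational powers and bases over Q *)

Section RationalPowers.
Variables (K : fieldType) (h : nat -> K).
Hypotheses (hS : forall n, h n.+1 ^+ n.+1 = h n) (h0 : h 0%N != 0).

Let hn0 n : h n != 0.
Proof. by elim: n => // n; apply: contraNneq => e; rewrite -hS e expr0n. Qed.

(** h_N is an N!-th root of h_0, compatibly in N, so k/N! is sent to the k-th power of h_N. *)
Let pw (q : rat) v N (k : int) := q * (N`!)%:R = k%:~R /\ v = h N ^ k.

Let pw_up q v N k M : pw q v N k -> (N <= M)%N -> exists k', pw q v M k'.
Proof.
move=> pk; elim: M => [|M IH]; first by rewrite leqn0 => /eqP <-; exists k.
rewrite leq_eqVlt => /orP[/eqP<-|]; first by exists k.
rewrite ltnS => /IH[k' [e ->]]; exists (M.+1%:Z * k'); split.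
  by rewrite factS natrM mulrCA e intrM.
by rewrite -[in LHS]hS exprnP exprz_exp.
Qed.

Let pw_uniq q v v' N N' k k' : pw q v N k -> pw q v' N' k' -> v = v'.
Proof.
move=> p p'; have [l [e ->]] := pw_up p (leq_maxl N N').
have [l' [e' ->]] := pw_up p' (leq_maxr N N').
by congr (_ ^ _); apply: (@intr_inj rat); rewrite -e -e'.
Qed.

Lemma rat_power_system : exists phi : rat -> K,
  [/\ forall x y, phi (x + y) = phi x * phi y, phi 1 = h 0%N,
      forall q, exists n k, phi q = h n ^ k &
      forall n, phi (n.+1%:R^-1) = h n.+1 ^+ n`!].
Proof.
have ex q : exists v N k, pw q v N k.
  pose d := `|denq q|%N; have dE : denq q = d%:Z by rewrite /d gtz0_abs ?denq_gt0.
  have d0 : (0 < d)%N by rewrite -ltz_nat -dE denq_gt0.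
  exists (h d ^ (numq q * ((d.-1)`!)%:Z)), d, (numq q * ((d.-1)`!)%:Z); split=> //.
  by rewrite -[in LHS](prednK d0) factS (prednK d0) natrM mulrA intrM numqE dE.
have /choice[phi phiP] := ex; exists phi; split.
- move=> x y; have [N [k p]] := phiP x; have [N' [k' p']] := phiP y.
  have [l [e ve]] := pw_up p (leq_maxl N N'); have [l' [e' ve']] := pw_up p' (leq_maxr N N').
  have [M [m pm]] := phiP (x + y).
  have : pw (x + y) (phi x * phi y) (maxn N N') (l + l').
    by split; [rewrite mulrDl e e' -intrD|rewrite ve ve' -expfzDr].
  exact: (pw_uniq pm).
- have [N [k p]] := phiP 1; have : pw 1 (h 0%N) 0%N 1 by split.
  exact: (pw_uniq p).
- by move=> q; have [N [k [_ ->]]] := phiP q; exists N, k.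
move=> n; have [N [k p]] := phiP n.+1%:R^-1.
have : pw n.+1%:R^-1 (h n.+1 ^+ n`!) n.+1 n`! by split; rewrite // factS natrM mulKf ?pnatr_eq0.
exact: (pw_uniq p).
Qed.

End RationalPowers.

Lemma collect_terms (T : eqType) (G : Type) (idx : G) (op : Monoid.com_law idx)
    (F : T -> rat -> G) (s : seq (T * rat)) :
  (forall x, F x 0 = idx) -> (forall x, {morph F x : a b / a + b >-> op a b}) ->
  \big[op/idx]_(p <- s) F p.1 p.2 =
  \big[op/idx]_(x <- undup (map fst s)) F x (\sum_(p <- s | p.1 == x) p.2).
Proof.
move=> F0 FD; under [RHS]eq_bigr => x _ do rewrite (big_morph (F x) (FD x) (F0 x)).
rewrite (exchange_big_dep predT) //= [LHS]big_seq [RHS]big_seq; apply: eq_bigr => p ps.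
rewrite -big_filter (eq_filter (a2 := pred1 p.1)); last by move=> x; rewrite /= eq_sym.
by rewrite filter_pred1_uniq ?undup_uniq ?mem_undup ?map_f // big_seq1.
Qed.

Section LinearCombinations.
Variables (K : closedFieldType) (ch : [pchar K] =i pred0).
Local Notation iQ := (Q2K ch).
Implicit Types (s : seq (K * rat)) (Z : K -> Prop).

Definition lincomb s := \sum_(p <- s) iQ p.2 * p.1.
Definition coef s x := \sum_(p <- s | p.1 == x) p.2.
Definition scaled a s := [seq (p.1, a * p.2) | p <- s].
Definition in_list Z s := forall p, p \in s -> Z p.1.

Lemma lincomb_cat s s' : lincomb (s ++ s') = lincomb s + lincomb s'.
Proof. exact: big_cat. Qed.
Lemma lincomb_scaled a s : lincomb (scaled a s) = iQ a * lincomb s.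
Proof. by rewrite /lincomb big_map mulr_sumr; apply: eq_bigr => p _; rewrite rmorphM mulrA. Qed.
Lemma coef_cat s s' x : coef (s ++ s') x = coef s x + coef s' x.
Proof. exact: big_cat. Qed.
Lemma coef_scaled a s x : coef (scaled a s) x = a * coef s x.
Proof. by rewrite /coef big_map mulr_sumr. Qed.
Lemma in_list_cat Z s s' : in_list Z s -> in_list Z s' -> in_list Z (s ++ s').
Proof. by move=> h h' p; rewrite mem_cat => /orP[/h|/h']. Qed.
Lemma in_list_scaled Z a s : in_list Z s -> in_list Z (scaled a s).
Proof. by move=> h _ /mapP[p /h ? ->]. Qed.
Lemma in_list_sub Z Z' s : (forall x, Z x -> Z' x) -> in_list Z s -> in_list Z' s.
Proof. by move=> h h' p /h'/h. Qed.

Lemma lincomb_collect s : lincomb s = \sum_(x <- undup (map fst s)) iQ (coef s x) * x.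
Proof.
apply: (collect_terms (F := fun x q => iQ q * x)) => [x|x a b]; first by rewrite rmorph0 mul0r.
by rewrite rmorphD mulrDl.
Qed.

Lemma coef0 s x : x \notin map fst s -> coef s x = 0.
Proof.
move=> xs; rewrite /coef big_seq_cond big1 // => p /andP[ps /eqP e].
by case/negP: xs; rewrite -e map_f.
Qed.

Definition lin_free Z := forall (s : seq K) (q : K -> rat), uniq s -> (forall x, x \in s -> Z x) ->
  \sum_(x <- s) iQ (q x) * x = 0 -> forall x, x \in s -> q x = 0.

Variables (Z : K -> Prop).
Hypotheses (Zfree : lin_free Z) (Zspan : forall z, exists s, in_list Z s /\ z = lincomb s).

Let coef_lincomb0 s : in_list Z s -> lincomb s = 0 -> forall x, coef s x = 0.
Proof.
move=> sZ s0 x; have [xs|/coef0//] := boolP (x \in map fst s).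
apply: (Zfree (s := undup (map fst s)) (q := coef s)); rewrite ?undup_uniq ?mem_undup //.
  by move=> y; rewrite mem_undup => /mapP[p /sZ ? ->].
by rewrite -lincomb_collect.
Qed.

Let diff0 s s' : in_list Z s -> in_list Z s' -> lincomb s = lincomb s' ->
  in_list Z (s ++ scaled (-1) s') /\ lincomb (s ++ scaled (-1) s') = 0.
Proof.
move=> sZ s'Z e; split; first by apply: in_list_cat => //; apply: in_list_scaled.
by rewrite lincomb_cat lincomb_scaled e rmorphN1 mulN1r subrr.
Qed.

Lemma coef_uniq s s' : in_list Z s -> in_list Z s' -> lincomb s = lincomb s' -> coef s =1 coef s'.
Proof.
move=> sZ s'Z /(diff0 sZ s'Z)[dZ /(coef_lincomb0 dZ) d0] x.
by have := d0 x; rewrite coef_cat coef_scaled mulN1r => /eqP; rewrite subr_eq0 => /eqP.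
Qed.

Lemma coordinates : exists c : K -> K -> rat,
  [/\ forall z, exists s : seq K, [/\ uniq s, forall x, x \in s -> Z x,
        z = \sum_(x <- s) iQ (c z x) * x & forall x, c z x != 0 -> x \in s],
      forall z z' x, c (z + z') x = c z x + c z' x,
      forall q z x, c (iQ q * z) x = q * c z x &
      forall x y, Z x -> c x y = (y == x)%:R].
Proof.
have /choice[r rP] := Zspan; exists (fun z => coef (r z)).
have rZ z : in_list Z (r z) by case: (rP z).
have rE z : lincomb (r z) = z by case: (rP z).
split.
- move=> z; exists (undup (map fst (r z))); split; first exact: undup_uniq.
  + by move=> x; rewrite mem_undup => /mapP[p /rZ ? ->].
  + by rewrite -lincomb_collect rE.
  + by move=> x; rewrite mem_undup; apply: contraR => /coef0->.
- move=> z z' x; rewrite -coef_cat; apply: coef_uniq => //; first exact: in_list_cat.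
  by rewrite lincomb_cat !rE.
- move=> q z x; rewrite -coef_scaled; apply: coef_uniq => //; first exact: in_list_scaled.
  by rewrite lincomb_scaled !rE.
move=> x y Zx; rewrite (coef_uniq (s' := [:: (x, 1)])) //.
- by rewrite /coef big_cons big_nil eq_sym; case: eqP => _; rewrite ?addr0.
- by move=> p /[!inE]/eqP->.
- by rewrite rE /lincomb big_seq1 rmorph1 mul1r.
Qed.

(** E is computed from a chosen expansion. Two expansions of one element differ by a list all of
    whose collected coefficients vanish, so the corresponding product is 1. *)
Lemma hom_of_basis (phi : K -> rat -> K) :
  (forall x a b, Z x -> phi x (a + b) = phi x a * phi x b) -> (forall x, Z x -> phi x 0 = 1) ->
  exists E : K -> K, axiom_E E /\
    forall s, in_list Z s -> E (lincomb s) = \prod_(p <- s) phi p.1 p.2.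
Proof.
move=> phiD phi0; have /choice[r rP] := Zspan.
have rZ z : in_list Z (r z) by case: (rP z).
have rE z : lincomb (r z) = z by case: (rP z).
(* The value 1 outside [Z] makes [psi x] additive for every [x], as [collect_terms] requires. *)
pose psi x q := if `[< Z x >] then phi x q else 1.
have psiE s : in_list Z s -> \prod_(p <- s) phi p.1 p.2 = \prod_(p <- s) psi p.1 p.2.
  move=> sZ; rewrite big_seq [RHS]big_seq; apply: eq_bigr => p /sZ Zp.
  by rewrite /psi asboolT.
have psi0 x : psi x 0 = 1 by rewrite /psi; case: asboolP => // /phi0.
have psiD x : {morph psi x : a b / a + b >-> a * b}.
  by move=> a b; rewrite /psi; case: asboolP => [Zx|_]; rewrite ?mulr1 ?phiD.
have psiN x a : psi x a * psi x (- a) = 1 by rewrite -psiD subrr.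
have psiN0 x a : psi x a != 0.
  by apply/eqP => e; have /eqP := psiN x a; rewrite e mul0r eq_sym oner_eq0.
have prod1 s : in_list Z s -> lincomb s = 0 -> \prod_(p <- s) psi p.1 p.2 = 1.
  move=> sZ s0; rewrite (collect_terms (F := psi)) // big1 // => x _.
  by have := coef_lincomb0 sZ s0 x; rewrite /coef => ->.
have Es s : in_list Z s -> \prod_(p <- r (lincomb s)) psi p.1 p.2 = \prod_(p <- s) psi p.1 p.2.
  move=> sZ; have [dZ d0] := diff0 (rZ (lincomb s)) sZ (rE _).
  have := prod1 _ dZ d0; rewrite big_cat big_map /= => /eqP.
  have -> : \prod_(p <- s) psi p.1 (-1 * p.2) = (\prod_(p <- s) psi p.1 p.2)^-1.
    rewrite -prodfV; apply: eq_bigr => p _; rewrite mulN1r; apply: (mulfI (psiN0 p.1 p.2)).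
    by rewrite psiN mulfV.
  by move=> h; apply/divr1_eq/eqP.
exists (fun z => \prod_(p <- r z) phi p.1 p.2); split=> [x y|s sZ]; last by rewrite !psiE ?Es.
rewrite !psiE // -[RHS]big_cat -(Es (r x ++ r y)); last by apply: in_list_cat.
by rewrite lincomb_cat !rE.
Qed.

End LinearCombinations.

(** * Infinitesimals *)

Section GroupPowers.
Variables (C : numClosedFieldType).
Implicit Types (x y g : C) (G P : C -> Prop).

Definition rat_hom (phi : rat -> C) := phi 0 = 1 /\ forall a b, phi (a + b) = phi a * phi b.

Lemma group_rat_power G g : (forall x N, G x -> (0 < N)%N -> exists y, y ^+ N = x /\ G y) ->
  (forall x, G x -> x != 0) -> G 1 -> (forall x y, G x -> G y -> G (x * y)) ->
  (forall x, G x -> G x^-1) -> G g ->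
  exists phi, [/\ rat_hom phi, phi 1 = g & forall q, G (phi q)].
Proof.
move=> Groot G0 G1 GM GV Gg.
have /choice[rt rtP] (u : C * nat) : exists y, G u.1 -> y ^+ u.2.+1 = u.1 /\ G y.
  have [Gu|nG] := EM (G u.1); last by exists 0.
  by have [y hy] := Groot u.1 u.2.+1 Gu isT; exists y.
pose h := fix h n := if n is n'.+1 then rt (h n', n') else g.
have Gh n : G (h n) by elim: n => //= n /(rtP (_, n))[].
have hS n : h n.+1 ^+ n.+1 = h n by have [] := rtP (h n, n) (Gh n).
have [phi [phiD phi1 phiE _]] := rat_power_system hS (G0 _ Gg).
have Gphi q : G (phi q).
  have [n [k ->]] := phiE q; case: k => k; rewrite ?NegzE.
    by elim: k => //= k IH; rewrite -exprnP exprS; apply: GM.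
  rewrite -exprnN; apply: GV; elim: k => [|k IH]; first by rewrite expr1.
  by rewrite exprS; apply: GM.
exists phi; split=> //; split=> //.
by apply: (mulIf (G0 _ (Gphi 0))); rewrite -phiD addr0 mul1r.
Qed.

Lemma rat_hom_neq0 phi q : rat_hom phi -> phi q != 0.
Proof.
move=> [p0 pD]; apply/eqP => e; have /eqP := pD q (- q).
by rewrite subrr p0 e mul0r oner_eq0.
Qed.

Lemma rat_homN phi q : rat_hom phi -> phi (- q) = (phi q)^-1.
Proof.
move=> h; have [p0 pD] := h; apply: (mulIf (rat_hom_neq0 q h)).
by rewrite -pD addNr p0 mulVf // rat_hom_neq0.
Qed.

Lemma rat_homM phi q n : rat_hom phi -> phi (q * n%:R) = phi q ^+ n.
Proof.
move=> [p0 pD]; elim: n => [|n IH]; first by rewrite mulr0 expr0.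
by rewrite mulrS mulrDr mulr1 pD IH exprS.
Qed.

Lemma rat_homMz phi q (k : int) : rat_hom phi -> phi (q * k%:~R) = phi q ^ k.
Proof.
move=> h; case: k => n; first exact: rat_homM.
by rewrite NegzE mulrNz mulrN rat_homN // -exprnN (rat_homM q n.+1 h).
Qed.

(** The positive reals, fixed by conjugation, and the unit circle, inverted by it. For E to commute
    with conjugation on the basis, real elements go to the first group and imaginary ones to the
    second. Accordingly [onaxis (0 < y) y] says that [y] is positive or of norm 1. *)
Definition onaxis (r : bool) x := if r then is_true (0 < x) else `|x| = 1.

Lemma onaxis1 r : onaxis r 1. Proof. by case: r; rewrite /onaxis ?ltr01 ?normr1. Qed.
Lemma onaxisM r x y : onaxis r x -> onaxis r y -> onaxis r (x * y).
Proof. by case: r => /= hx hy; [apply: mulr_gt0|rewrite normrM hx hy mulr1]. Qed.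
Lemma onaxisV r x : onaxis r x -> onaxis r x^-1.
Proof. by case: r => /= hx; [rewrite invr_gt0|rewrite normfV hx invr1]. Qed.
Lemma onaxis_neq0 r x : onaxis r x -> x != 0.
Proof. by case: r => /= [/lt0r_neq0//|x1]; rewrite -normr_eq0 x1 oner_eq0. Qed.
Lemma onaxis_conj r x : onaxis r x -> x^* = if r then x else x^-1.
Proof.
case: r => /= [x0|x1]; last by rewrite invC_norm x1 expr1n invr1 mul1r.
by apply: conj_Creal; apply: gtr0_real.
Qed.

Lemma norm_root1 N x y : (0 < N)%N -> y ^+ N = x -> `|x| = 1 -> `|y| = 1.
Proof. by move=> N0 yx x1; apply/eqP; rewrite -(@eqrXn2 _ N) // -normrX yx x1 expr1n. Qed.

Lemma onaxis_rat_power r g : onaxis r g ->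
  exists phi, [/\ rat_hom phi, phi 1 = g & forall q, onaxis r (phi q)].
Proof.
move=> rg; apply: group_rat_power rg; first last.
- exact: onaxisV. - exact: onaxisM. - exact: onaxis1. - exact: onaxis_neq0.
move=> x N rx N0; exists (N.-root x); rewrite rootCK //; split=> //; case: r rx => /= rx.
  by rewrite rootC_gt0.
by apply: (norm_root1 N0) rx; rewrite rootCK.
Qed.

End GroupPowers.

Section Infinitesimals.
Variables (C : numClosedFieldType) (ch : [pchar C] =i pred0).
Variables (Kn : nat -> C -> Prop).
Hypotheses (Kf : forall n, subfield (Kn n)) (Ka : forall n z, acl (Kn n) z -> Kn n z)
  (Kc : forall n z, Kn n z -> Kn n z^*) (Ks : forall n z, Kn n z -> Kn n.+1 z).
Local Notation iQ := (Q2K ch).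

Lemma iQ_conj q : (iQ q)^* = iQ q.
Proof. by rewrite -Q2KE fmorph_rat. Qed.

Lemma iQ_Kn n q : Kn n (iQ q).
Proof. by have := @Q2K_gen C ch (fun _ => False) q; apply. Qed.

Lemma Kn_le m n z : (m <= n)%N -> Kn m z -> Kn n z.
Proof.
elim: n => [|n IH]; first by rewrite leqn0 => /eqP->.
by rewrite leq_eqVlt => /orP[/eqP->|/IH h /h/Ks].
Qed.

Lemma Kn_root n N x : (0 < N)%N -> Kn n (x ^+ N) -> Kn n x.
Proof.
move=> N0 Kx; apply: Ka; apply: (acl_root (p := 'X^N - (x ^+ N)%:P)).
- by rewrite -size_poly_gt0 size_XnsubC.
- have h := subfield_acl (Kn n); apply/(poverP h); apply: rpredB; first exact/rpredX/polyOverX.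
  by rewrite polyOverC; apply/sfpredP; apply: acl_incl.
- by rewrite hornerD hornerN hornerXn hornerC subrr.
Qed.

Lemma Kn_norm n x : Kn n x -> Kn n `|x|.
Proof.
move=> Kx; apply: (@Kn_root n 2) => //; rewrite normCK; apply/(sfpredP (Kf n)).
by rewrite rpredM //; apply/sfpredP => //; apply: Kc.
Qed.

Definition infsmall j (z : C) := forall p, Kn j p -> 0 < p -> `|z| < p.

Lemma infsmall0 j : infsmall j 0. Proof. by move=> p _; rewrite normr0. Qed.

Lemma infsmallD j x y : infsmall j x -> infsmall j y -> infsmall j (x + y).
Proof.
move=> hx hy p Kp p0; have Kp2 : Kn j (p / 2%:R).
  by apply/(sfpredP (Kf j)); rewrite rpred_div ?rpred_nat //; apply/sfpredP.
have p2 : 0 < p / 2%:R by rewrite divr_gt0 ?ltr0n.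
apply: le_lt_trans (ler_normD _ _) _; have -> : p = p / 2%:R + p / 2%:R.
  by rewrite -mulr2n -[X in _ = X]mulr_natr divfK ?pnatr_eq0.
exact: ltrD (hx _ Kp2 p2) (hy _ Kp2 p2).
Qed.

Lemma infsmallN j x : infsmall j x -> infsmall j (- x).
Proof. by move=> hx p Kp p0; rewrite normrN; apply: hx. Qed.

Lemma infsmallB j x y : infsmall j x -> infsmall j y -> infsmall j (x - y).
Proof. by move=> hx /infsmallN; apply: infsmallD. Qed.

Lemma infsmallM j u p x : Kn j p -> `|u| <= p -> infsmall j x -> infsmall j (u * x).
Proof.
move=> Kp up hx r Kr r0; have p1 : 0 < p + 1 by apply: ltr_wpDl => //; apply: le_trans up.
have Kp1 : Kn j (r / (p + 1)).
  by apply/(sfpredP (Kf j)); rewrite rpred_div ?rpredD ?rpred1 //; apply/sfpredP.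
rewrite normrM; apply: (@le_lt_trans _ _ ((p + 1) * `|x|)).
  by rewrite ler_wpM2r // (le_trans up) // lerDl.
by rewrite -ltr_pdivlMl // mulrC; apply: hx => //; apply: divr_gt0.
Qed.

Lemma infsmallQ j q x : infsmall j x -> infsmall j (iQ q * x).
Proof. by apply: infsmallM (Kn_norm (iQ_Kn j q)) _. Qed.

Lemma infsmall_le j k x : (j <= k)%N -> infsmall k x -> infsmall j x.
Proof. by move=> jk hx p /(Kn_le jk); apply: hx. Qed.

Lemma infsmall_Kn j x : Kn j x -> infsmall j x -> x = 0.
Proof.
move=> Kx mx; apply/eqP; apply: contrapT => /negP x0.
by have := mx _ (Kn_norm Kx); rewrite normr_gt0 x0 ltxx => /(_ isT).
Qed.

Lemma infsmall_conj j x : infsmall j x -> infsmall j x^*.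
Proof. by move=> hx p; rewrite norm_conjC; apply: hx. Qed.

Lemma infsmall_lt1 j x : infsmall j x -> `|x| < 1.
Proof. by apply; rewrite ?ltr01 //; case: (Kf j). Qed.

Lemma infsmall1M j x y : infsmall j (x - 1) -> infsmall j (y - 1) -> infsmall j (x * y - 1).
Proof.
move=> hx hy; have -> : x * y - 1 = (x - 1) + ((y - 1) + (x - 1) * (y - 1)) by ring.
apply: infsmallD => //; apply: infsmallD => //; apply: (infsmallM (p := 1)) => //; first by case: (Kf j).
exact/ltW/(infsmall_lt1 hx).
Qed.

Lemma infsmall1V j x : x != 0 -> infsmall j (x - 1) -> infsmall j (x^-1 - 1).
Proof.
move=> x0 hx; have -> : x^-1 - 1 = - x^-1 * (x - 1) by rewrite mulrBr mulr1 mulNr mulVf //; ring.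
have K2 : Kn j 2%:R by apply/(sfpredP (Kf j)); rewrite rpred_nat.
apply: (infsmallM K2) => //; rewrite normrN normfV -[leRHS]invrK lef_pV2 ?posrE ?invr_gt0 ?ltr0n ?normr_gt0 //.
have K2' : Kn j 2%:R^-1 by apply/(sfpredP (Kf j)); rewrite rpredV rpred_nat.
have := hx _ K2'; rewrite invr_gt0 ltr0n => /(_ isT) lt.
have : 1 <= `|x| + `|x - 1|.
  by have := ler_normB x (x - 1); rewrite opprB addrC subrK normr1.
move=> le1; have e : 2%:R^-1 = 1 - 2%:R^-1 :> C by field.
by rewrite e lerBlDr (le_trans le1) // lerD2l ltW.
Qed.

Lemma infsmall_factor j (r : seq C) : infsmall j (\prod_(x <- r) (1 - x)) -> exists x, x \in r /\ infsmall j (1 - x).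
Proof.
move=> hr; apply: contrapT => no.
have : exists p, [/\ Kn j p, 0 < p & p <= `|\prod_(x <- r) (1 - x)|].
  elim: r {hr} no => [|x r IH] no.
    by exists 1; rewrite big_nil normr1 lexx ltr01; split=> //; case: (Kf j).
  have [|p [Kp p0 pr]] := IH.
    by move=> [y [yr hy]]; apply: no; exists y; rewrite inE yr orbT.
  have [q [Kq q0 qx]] : exists q, [/\ Kn j q, 0 < q & q <= `|1 - x|].
    apply: contrapT => noq; apply: no; exists x; rewrite mem_head; split=> // q Kq q0.
    rewrite real_ltNge ?normr_real ?gtr0_real //; apply/negP => qx; apply: noq; by exists q.
  exists (q * p); split; last by rewrite big_cons normrM; apply: ler_pM => //; apply: ltW.
    by apply/(sfpredP (Kf j)); rewrite rpredM //; apply/sfpredP.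
  exact: mulr_gt0.
by move=> [p [Kp p0 /le_lt_trans/(_ (hr p Kp p0))]]; rewrite ltxx.
Qed.

(** Evaluating the factorisation of X^N - x at 1 writes the infinitesimal 1 - x as the product of
    the 1 - y over all roots y, and one factor must be infinitesimal. *)
Lemma infsmall1_root j N x : (0 < N)%N -> infsmall j (x - 1) -> exists y, y ^+ N = x /\ infsmall j (y - 1).
Proof.
move=> N0 hx; have [r rE] := closed_field_poly_normal ('X^N - x%:P).
rewrite (monicP _) ?scale1r in rE; last exact: monicXnsubC.
have [|y [yr hy]] := @infsmall_factor j r.
  have := congr1 (fun p => p.[1]) rE; rewrite hornerD hornerN hornerXn hornerC expr1n horner_prod => e.
  have <- : 1 - x = \prod_(y <- r) (1 - y).
    by rewrite e; apply: eq_bigr => y _; rewrite hornerXsubC.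
  by rewrite -opprB; apply: infsmallN.
exists y; split; last by rewrite -opprB; apply: infsmallN.
have := congr1 (fun p => p.[y]) rE; rewrite hornerD hornerN hornerXn hornerC horner_prod.
by rewrite (big_rem y) //= hornerXsubC subrr mul0r => /eqP; rewrite subr_eq0 => /eqP.
Qed.

(** The positive root y satisfies |y - 1| <= |x - 1|, because 1 + y + ... + y^(N-1) is at least
    1. *)
Lemma infsmall1_real_root j N x : (0 < N)%N -> 0 < x -> infsmall j (x - 1) ->
  exists y, y ^+ N = x /\ 0 < y /\ infsmall j (y - 1).
Proof.
move=> N0 x0 hx; exists (N.-root x); rewrite rootCK // rootC_gt0 //; split=> //; split=> // p Kp p0.
apply: le_lt_trans (hx p Kp p0); rewrite -{2}(rootCK N0 x) subrX1 normrM ler_peMr //.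
have y0 : 0 < N.-root x by rewrite rootC_gt0.
move: (N.-root x) y0 => u u0; rewrite -(prednK N0) big_ord_recl expr0 ger0_norm.
  by rewrite lerDl sumr_ge0 // => i _; rewrite exprn_ge0 ?ltW.
by rewrite addr_ge0 ?ler01 ?sumr_ge0 // => i _; rewrite exprn_ge0 ?ltW.
Qed.

Lemma near1_rat_power j r g : infsmall j (g - 1) -> onaxis r g ->
  exists phi, [/\ rat_hom phi, phi 1 = g, forall q, infsmall j (phi q - 1) &
    forall q, onaxis r (phi q)].
Proof.
move=> hg rg; have [||||||phi [h p1 hG]] := @group_rat_power C (fun x => onaxis r x /\ infsmall j (x - 1)) g.
- move=> x N [rx hx] N0; case: r rx {rg} => [x0|x1].
    by have [y [yx [y0 hy]]] := infsmall1_real_root N0 x0 hx; exists y.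
  by have [y [yx hy]] := infsmall1_root N0 hx; exists y; split=> //; split=> //; apply: norm_root1 yx x1.
- by move=> x [/onaxis_neq0].
- by split; [apply: onaxis1|rewrite subrr; apply: infsmall0].
- by move=> x y [x0 hx] [y0 hy]; split; [apply: onaxisM|apply: infsmall1M].
- by move=> x [x0 hx]; split; [apply: onaxisV|apply: infsmall1V => //; apply: onaxis_neq0 x0].
- by [].
by exists phi; split=> // q; case: (hG q).
Qed.

Definition axial (x : C) := x^* = x \/ x^* = - x.

Lemma lincomb_conj s : in_list axial s -> (lincomb ch s)^* =
  lincomb ch [seq (p.1, if p.1^* == p.1 then p.2 else - p.2) | p <- s].
Proof.
move=> hs; rewrite /lincomb rmorph_sum big_map big_seq [RHS]big_seq; apply: eq_bigr => p ps /=.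
rewrite rmorphM /= iQ_conj; case: eqP => [->//|n].
by case: (hs p ps) => // ->; rewrite rmorphN mulrN mulNr.
Qed.

Definition qspan (P : C -> Prop) v := exists s, in_list P s /\ v = lincomb ch s.

Lemma qspanD P u v : qspan P u -> qspan P v -> qspan P (u + v).
Proof.
move=> [s [sP ->]] [s' [s'P ->]]; exists (s ++ s'); rewrite lincomb_cat; split=> //.
exact: in_list_cat.
Qed.

Lemma qspanZ P q v : qspan P v -> qspan P (iQ q * v).
Proof.
move=> [s [sP ->]]; exists (scaled q s); rewrite lincomb_scaled; split=> //.
exact: in_list_scaled.
Qed.

Lemma qspan0 P : qspan P 0.
Proof. by exists [::]; rewrite /lincomb big_nil; split. Qed.

Lemma qspan_sub (P Q : C -> Prop) v : (forall x, P x -> Q x) -> qspan P v -> qspan Q v.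
Proof. by move=> PQ [s [sP ->]]; exists s; split=> //; apply: in_list_sub sP. Qed.

Lemma qspan_mem (P : C -> Prop) x : P x -> qspan P x.
Proof.
exists [:: (x, 1)]; split=> [p /[!inE]/eqP->//|].
by rewrite /lincomb big_seq1 rmorph1 mul1r.
Qed.

Lemma qspan_conj (P : C -> Prop) v : (forall x, P x -> axial x) -> qspan P v -> qspan P v^*.
Proof.
move=> hP [s [sP ->]]; rewrite lincomb_conj; last exact: in_list_sub hP sP.
by eexists; split; [|reflexivity] => p /mapP[p' /sP ? ->].
Qed.

Lemma qspan_uniq (P : C -> Prop) v : qspan P v -> exists (s : seq C) (q : C -> rat),
  [/\ uniq s, forall x, x \in s -> P x & v = \sum_(x <- s) iQ (q x) * x].
Proof.
move=> [s [sP ->]]; exists (undup (map fst s)), (coef s); split; rewrite ?undup_uniq //.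
  by move=> x; rewrite mem_undup => /mapP[p /sP ? ->].
exact: lincomb_collect.
Qed.

Lemma qspan_sum (P : C -> Prop) (s : seq C) (q : C -> rat) : (forall x, x \in s -> P x) ->
  qspan P (\sum_(x <- s) iQ (q x) * x).
Proof.
move=> sP; exists [seq (x, q x) | x <- s]; rewrite /lincomb big_map; split=> //.
by move=> _ /mapP[x /sP ? ->].
Qed.

Section AdaptedBasis.
Variables (n : nat) (D : C -> Prop).
Hypotheses (DK : forall d, D d -> Kn n d) (D0 : D 0)
  (DD : forall d d', D d -> D d' -> D (d + d')) (DZ : forall q d, D d -> D (iQ q * d))
  (Dc : forall d, D d -> D d^*).

(** Independence over Q modulo [D] together with absence of cancellation: a sum is infinitesimal
    only if its [D]-part is. Continuity at a general element thus reduces to [D], where E comes from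
    lower levels. *)
Definition adapted (A : C -> Prop) := [/\ forall a, A a -> Kn n a, forall a, A a -> axial a &
  forall (s : seq C) (q : C -> rat) d, uniq s -> (forall a, a \in s -> A a) -> D d ->
    (forall j, infsmall j (d + \sum_(a <- s) iQ (q a) * a) -> infsmall j d) /\
    (d + \sum_(a <- s) iQ (q a) * a = 0 -> forall a, a \in s -> q a = 0)].

Let V (A : C -> Prop) z := exists d v, [/\ D d, qspan A v & z = d + v].

Let VD A x y : V A x -> V A y -> V A (x + y).
Proof.
move=> [d [v [hd hv ->]]] [d' [v' [hd' hv' ->]]]; exists (d + d'), (v + v').
by split; [apply: DD|apply: qspanD|ring].
Qed.

Let VZ A q x : V A x -> V A (iQ q * x).
Proof.
move=> [d [v [hd hv ->]]]; exists (iQ q * d), (iQ q * v).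
by split; [apply: DZ|apply: qspanZ|ring].
Qed.

(* A new homogeneous element is translated by the span of A so as to lie in the smallest
   possible ideal of infinitesimals; this keeps the family adapted. *)
Lemma adapted_extend A z : adapted A -> Kn n z -> axial z -> ~ V A z ->
  exists a, [/\ ~ V A a, V A (z - a) & adapted (fun x => A x \/ x = a)].
Proof.
move=> [AK Ah Ai] Kz hz nVz.
have VK x : V A x -> Kn n x.
  move=> [d [v [/DK Kd [s [sA ->]] ->]]]; apply/(sfpredP (Kf n)); apply: rpredD; first exact/sfpredP.
  rewrite /lincomb big_seq; apply: rpred_sum => p /sA/AK Kp; apply: rpredM; apply/sfpredP => //.
  exact: iQ_Kn.
(* Here x has conjugate e x with e = 1 or -1. Replacing v by (v + e conj(v))/2 keeps x + v
   infinitesimal and makes v and x + v axial. *)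
have Vm j x : (exists v, V A v /\ infsmall j (x + v)) -> axial x -> exists v, [/\ V A v, axial v, axial (x + v) & infsmall j (x + v)].
  move=> [v [Vv mv]] hx; pose e : rat := if x^* == x then 1 else -1.
  have xe : x^* = iQ e * x.
    rewrite /e; case: eqP => [->|nx]; first by rewrite rmorph1 mul1r.
    by case: hx => // ->; rewrite rmorphN1 mulN1r.
  have ee : iQ e * iQ e = 1.
    by rewrite -rmorphM /e; case: ifP => _; rewrite ?mulrNN mulr1 rmorph1.
  pose v' := iQ 2%:R^-1 * (v + iQ e * v^*).
  have Vv' : V A v'.
    apply: VZ; apply: VD => //; apply: VZ; have [d [u [hd hu ->]]] := Vv.
    by exists d^*, u^*; rewrite rmorphD; split; [apply: Dc|apply: qspan_conj|].
  have he u : u^* = iQ e * u -> axial u.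
    by move=> uc; rewrite /axial uc /e; case: ifP => _; rewrite ?rmorphN1 ?rmorph1 ?mulN1r ?mul1r; [left|right].
  have v'c : v'^* = iQ e * v'.
    rewrite /v' rmorphM rmorphD rmorphM /= !iQ_conj conjCK.
    transitivity (iQ 2%:R^-1 * (iQ e * v + (iQ e * iQ e) * v^*)); last by ring.
    by rewrite ee; ring.
  exists v'; split=> //; first exact: he.
    by apply: he; rewrite rmorphD /= xe v'c; ring.
  have -> : x + v' = iQ 2%:R^-1 * ((x + v) + iQ e * (x + v)^*).
    rewrite rmorphD /= xe /v' [iQ e * (_ + _)]mulrDr [iQ e * (iQ e * x)]mulrA ee.
    have e2 : iQ 2%:R^-1 * (x + x) = x.
      by rewrite mulrDr -mulrDl -rmorphD (_ : _ + _ = 1) ?rmorph1 ?mul1r //; field.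
    by rewrite -{1}e2; ring.
  by apply: infsmallQ; apply: infsmallD => //; apply: infsmallQ; apply: infsmall_conj.
have [a [Va ha Ka' amax]] : exists a, [/\ V A (z - a), axial a, Kn n a &
    forall j v, V A v -> infsmall j (a + v) -> infsmall j a].
  (* Only j <= n can occur: a translate of [z] infinitesimal over a level beyond n would be zero and
     put [z] into the span. The largest such j gives the smallest ideal of infinitesimals. *)
  pose P j := `[< exists v, V A v /\ infsmall j (z + v) >].
  have Pn j : P j -> (j <= n)%N.
    move=> /asboolP[v [Vv mv]]; rewrite leqNgt; apply/negP => /ltnW nj; apply: nVz.
    have Kzv : Kn n (z + v) by apply/(sfpredP (Kf n)); rewrite rpredD //; apply/sfpredP => //; apply: VK.
    have -> : z = iQ (-1) * v.
      by rewrite rmorphN1 mulN1r; apply/eqP; rewrite -addr_eq0 (infsmall_Kn (Kn_le nj Kzv) mv).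
    exact: VZ.
  have V0 : V A 0 by exists 0, 0; rewrite addr0; split=> //; apply: qspan0.
  have [[j0 Pj0]|noP] := EM (exists j, P j); last first.
    exists z; rewrite subrr; split=> // j v Vv mv; case: noP; exists j; apply/asboolP; by exists v.
  have [j /asboolP Pj jmax] := ex_maxnP (ex_intro _ j0 Pj0) Pn.
  have [v [Vv hv hzv mv]] := Vm j z Pj hz; exists (z + v); split=> //.
  - have -> : z - (z + v) = iQ (-1) * v by rewrite rmorphN1; ring.
    exact: VZ.
  - by apply/(sfpredP (Kf n)); rewrite rpredD //; apply/sfpredP => //; apply: VK.
  move=> k u Vu mu; have : P k by apply/asboolP; exists (v + u); rewrite addrA; split=> //; apply: VD.
  by move=> /jmax kj; apply: infsmall_le kj mv.
have nVa : ~ V A a by move=> h; apply: nVz; rewrite -(subrK a z); apply: VD.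
exists a; split=> //; split=> [x [/AK//|->//]|x [/Ah//|->//]|s q d us sA Dd].
have nA : ~ A a by move=> Aa; apply: nVa; exists 0, a; rewrite add0r; split=> //; apply: qspan_mem.
have sub (s' : seq C) : (forall x, x \in s' -> A x \/ x = a) -> a \notin s' -> forall x, x \in s' -> A x.
  by move=> h ns x xs; have [//|e] := h x xs; rewrite e (negbTE ns) in xs.
have [as_|ns] := boolP (a \in s); last exact: Ai us (sub s sA ns) Dd.
have sE : \sum_(x <- s) iQ (q x) * x = iQ (q a) * a + \sum_(x <- rem a s) iQ (q x) * x.
  by rewrite (big_rem a).
have rA : forall x, x \in rem a s -> A x.
  apply: sub => [x /mem_rem/sA//|]; by rewrite mem_rem_uniqF.
have ur := rem_uniq a us; have [hm h0] := Ai _ q d ur rA Dd.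
set w := \sum_(x <- rem a s) _ in sE hm h0.
have Vdw : V A (d + w) by exists d, w; split=> //; apply: qspan_sum.
have qa : q a != 0 -> forall j, infsmall j (d + (iQ (q a) * a + w)) -> infsmall j a.
  move=> qa j mj; apply: (amax j (iQ (q a)^-1 * (d + w))); first exact: VZ.
  have -> : a + iQ (q a)^-1 * (d + w) = iQ (q a)^-1 * (d + (iQ (q a) * a + w)).
    have e : iQ (q a)^-1 * iQ (q a) = 1 by rewrite -rmorphM mulVf // rmorph1.
    by rewrite -[X in X + _]mul1r -e; ring.
  exact: infsmallQ.
rewrite sE; split=> [j mj|e0].
  have [q0|q0] := eqVneq (q a) 0; first by apply: hm; move: mj; rewrite q0 rmorph0 mul0r add0r.
  apply: hm; have -> : d + w = d + (iQ (q a) * a + w) - iQ (q a) * a by ring.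
  by apply: infsmallB => //; apply/infsmallQ/qa.
have q0 : q a = 0.
  apply/eqP; apply: contrapT => /negP/qa h; have : infsmall n a by apply: h; rewrite e0; apply: infsmall0.
  move=> /(infsmall_Kn Ka') a0; apply: nVa; rewrite a0; exists 0, 0.
  by rewrite addr0; split=> //; apply: qspan0.
move: e0; rewrite q0 rmorph0 mul0r add0r => /h0 h x xs.
have [->//|xa] := eqVneq x a; apply: h; by rewrite mem_rem_uniq // inE xa.
Qed.

Lemma adapted_basis : exists A, adapted A /\
  forall z, Kn n z -> exists d v, [/\ D d, qspan A v & z = d + v].
Proof.
have [||A [hA _ mA]] := @zorn_sets C adapted (fun _ => False).
- split=> // s q d _ s0 Dd; case: s s0 => [|a s] s0; last by case: (s0 a); rewrite mem_head.
  by rewrite big_nil addr0; split.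
- move=> Ch neCh hCh tot; split=> [a [A [/hCh[h _ _]]]|a [A [/hCh[_ h _]]]|s q d us sU Dd]; try exact: h.
  have [A [/hCh[_ _ h] sA]] := chain_list neCh tot sU; exact: h.
exists A; split=> //; rewrite -/(V A).
have hom z : Kn n z -> axial z -> V A z.
  move=> Kz hz; apply: contrapT => nV; have [a [nVa _ ha]] := adapted_extend hA Kz hz nV.
  apply: nVa; exists 0, a; rewrite add0r; split=> //; apply: qspan_mem.
  by apply: (mA _ ha); [left|right].
have KB e z : Kn n z -> Kn n (iQ 2%:R^-1 * (z + iQ e * z^*)).
  move=> Kz; apply/(sfpredP (Kf n)); apply: rpredM; first exact/sfpredP/iQ_Kn.
  apply: rpredD; first exact/sfpredP; apply: rpredM; first exact/sfpredP/iQ_Kn.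
  exact/sfpredP/Kc.
move=> z Kz; have -> : z = iQ 2%:R^-1 * (z + iQ 1 * z^*) + iQ 2%:R^-1 * (z + iQ (-1) * z^*).
  rewrite rmorph1 rmorphN1; transitivity (iQ 2%:R^-1 * (z * iQ 2%:R)).
    by rewrite mulrCA -rmorphM mulVf // rmorph1 mulr1.
  by rewrite rmorph_nat; ring.
by apply: VD; apply: hom; try exact: KB; rewrite /axial !rmorphM /= !iQ_conj rmorphD rmorphM /= iQ_conj conjCK ?rmorph1 ?rmorphN1; [left|right]; ring.
Qed.

End AdaptedBasis.
End Infinitesimals.

(** * The tower *)

Section MultiplicativeBasis.
Variables (C : numClosedFieldType) (Kp I : C -> Prop).
Hypotheses (I1 : I 1) (IV : forall x, I x -> I x^-1).

(** A maximal family multiplicatively independent modulo [I]. Maximality controls only a power of a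
    given z, whence the exponent [N]; roots are extracted later by means of torsion. *)
Lemma mult_basis : exists Y : C -> Prop, [/\ forall y, Y y -> Kp y /\ onaxis (0 < y) y,
  forall (s : seq C) (k : C -> int), uniq s -> (forall y, y \in s -> Y y) ->
    I (\prod_(y <- s) y ^ k y) -> forall y, y \in s -> k y = 0 &
  forall z, Kp z -> z != 0 -> onaxis (0 < z) z -> exists N (s : seq C) (k : C -> int),
    [/\ (0 < N)%N, forall y, y \in s -> Y y & I (z ^+ N * \prod_(y <- s) y ^ k y)]].
Proof.
pose Q (Y : C -> Prop) := (forall y, Y y -> Kp y /\ onaxis (0 < y) y) /\
  forall (s : seq C) (k : C -> int), uniq s -> (forall y, y \in s -> Y y) ->
    I (\prod_(y <- s) y ^ k y) -> forall y, y \in s -> k y = 0.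
have [||Y [[YK Yf] _ mY]] := @zorn_sets C Q (fun _ => False).
- by split=> // s k _ s0 _ y /s0.
- move=> Ch neCh hCh tot; split=> [y [A [/hCh[h _]]]|s k us sU]; first exact: h.
  have [A [/hCh[_ h] sA]] := chain_list neCh tot sU; exact: h.
exists Y; split=> // z Kz z0 az; have [Yz|nYz] := EM (Y z).
  exists 1%N, [:: z], (fun=> -1); split=> // [y /[!inE]/eqP->//|].
  by rewrite big_seq1 expr1 mulfV.
have [s [k [us sYz Is [y0 [y0s ky0]]]]] : exists (s : seq C) (k : C -> int),
    [/\ uniq s, forall y, y \in s -> Y y \/ y = z, I (\prod_(y <- s) y ^ k y) &
      exists y, y \in s /\ k y != 0].
  apply: contrapT => no; apply: nYz; apply: (mY (fun y => Y y \/ y = z)); [|by left|by right].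
  split=> [y [/YK//|->//]|s k us sY Is y ys]; apply/eqP; apply: contrapT => /negP ky.
  by apply: no; exists s, k; split=> //; exists y.
have sub (s' : seq C) : (forall y, y \in s' -> Y y \/ y = z) -> z \notin s' -> forall y, y \in s' -> Y y.
  by move=> h ns y ys; have [//|e] := h y ys; rewrite e (negbTE ns) in ys.
have [zs|ns] := boolP (z \in s); last by have := Yf s k us (sub s sYz ns) Is y0 y0s; move/eqP: ky0.
have spareY y : y \in rem z s -> Y y.
  by move: y; apply: sub => [y /mem_rem/sYz//|]; rewrite mem_rem_uniqF.
rewrite (big_rem z) //= in Is.
have kz : k z != 0.
  apply: contra ky0 => /eqP kz; rewrite kz expr0z mul1r in Is; apply/eqP.
  have [->//|yz] := eqVneq y0 z; apply: (Yf _ k (rem_uniq z us) spareY Is).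
  by rewrite mem_rem_uniq // inE yz.
exists `|k z|%N, (rem z s); rewrite absz_gt0.
case: (k z) kz Is => m m0 Is; first by exists k; split.
exists (fun y => - k y); split=> //; move: (IV Is); rewrite NegzE invfM.
rewrite -exprnN invrK -prodfV abszN /=.
by congr (I (_ * _)); apply: eq_bigr => y _; rewrite invr_expz.
Qed.

End MultiplicativeBasis.

Lemma rat_hom_acl (C : numClosedFieldType) (phi : rat -> C) (S : C -> Prop) q :
  rat_hom phi -> acl S (phi 1) -> acl S (phi q).
Proof.
move=> h aS; have hS := subfield_acl S.
pose d := `|denq q|%N; have dE : denq q = d%:Z by rewrite /d gtz0_abs ?denq_gt0.
have d0 : (0 < d)%N by rewrite -ltz_nat -dE denq_gt0.
have e : phi q ^+ d = phi 1 ^ numq q.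
  by rewrite -(rat_homM q d h) -(rat_homMz 1 _ h) mul1r numqE dE.
apply: (acl_root (p := 'X^d - (phi 1 ^ numq q)%:P)).
- by rewrite -size_poly_gt0 size_XnsubC.
- apply/(poverP hS); apply: rpredB; first exact/rpredX/polyOverX.
  rewrite polyOverC; case: (numq q) => n; rewrite ?NegzE -?exprnN -?exprnP ?rpredV;
    apply/rpredX/sfpredP; exact: aS.
- by rewrite hornerD hornerN hornerXn hornerC e subrr.
Qed.

Lemma rat_hom_acl1 (C : numClosedFieldType) (phi : rat -> C) (S : C -> Prop) q :
  rat_hom phi -> q != 0 -> acl S (phi q) -> acl S (phi 1).
Proof.
move=> [p0 pD] q0 aS; have := @rat_hom_acl C (fun r => phi (q * r)) S q^-1.
rewrite mulr1 mulfV //; apply=> //; split; first by rewrite mulr0.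
by move=> a b; rewrite mulrDr.
Qed.

Lemma acl_conj (C : numClosedFieldType) (S : C -> Prop) z :
  (forall b, S b -> b^* = b) -> acl S z -> acl S z^*.
Proof.
move=> Sc [p [p0 Sp pz]]; exists (map_poly (@Num.conj C) p); split.
- by rewrite map_poly_eq0.
- move=> i; rewrite coef_map /=.
  suff [] : gen S (p`_i)^* /\ gen S p`_i by [].
  apply: (Sp i (fun x => gen S x^* /\ gen S x)).
    have [g0 g1 gs gi] := subfield_gen S; split=> [||x y [h1 h2] [h3 h4]|x [h1 h2] x0].
    - by rewrite rmorph0.
    - by rewrite rmorph1.
    - rewrite rmorphB rmorphM /=; have [u1 u2] := gs _ _ h1 h3; by have [v1 v2] := gs _ _ h2 h4.
    - by rewrite fmorphV /=; split; apply: gi; rewrite ?fmorph_eq0.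
  by move=> c Sc'; rewrite Sc //; split; apply: gen_incl.
- by rewrite horner_map /= pz rmorph0.
Qed.

Section TorsionHom.
Variables (C : numClosedFieldType).

(** A root of 1 + X + ... + X^(p-1) has order p, which is prime to (p-1)!. *)
Lemma prime_root_ex p : prime p -> exists z : C, z ^+ p = 1 /\ z ^+ (p.-1)`! != 1.
Proof.
move=> pp; have p0 := prime_gt0 pp; have p1 := prime_gt1 pp.
have /closed_rootP[z] : size (\poly_(i < p) (1 : C)) != 1%N.
  rewrite -(prednK p0) size_poly_eq ?oner_eq0 // prednK //; by rewrite neq_ltn p1 orbT.
rewrite /root horner_poly => /eqP zs; have zp : z ^+ p = 1.
  apply/eqP; rewrite -subr_eq0 subrX1; under [X in _ * X]eq_bigr => i _ do rewrite -[_ ^+ _]mul1r.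
  by rewrite zs mulr0.
exists z; split=> //; apply/eqP => zf.
have cp : coprime (p.-1)`! p.
  rewrite coprime_sym prime_coprime //; have : (p.-1 < p)%N by rewrite prednK.
  elim: (p.-1) => [|m IH] mp; first by rewrite fact0 gtnNdvd.
  by rewrite factS Euclid_dvdM // negb_or gtnNdvd //= IH // ltnW.
have [u uE] := coprimeP _ (fact_gt0 _) cp.
have z1 : z = 1.
  have : (u.1 * (p.-1)`! = u.2 * p + 1)%N by lia.
  move/(congr1 (fun m => z ^+ m)); rewrite mulnC exprM zf expr1n exprD mulnC exprM zp expr1n mul1r expr1.
  by move=> <-.
move/eqP: zs; rewrite z1; under eq_bigr => i _ do rewrite expr1n mulr1.
by rewrite sumr_const card_ord pnatr_eq0 => /eqP e; rewrite e in p0.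
Qed.

(** The analogue of q -> exp(2 pi i q). Since tau(1/(n+1)) is the n!-th power of h_(n+1), the roots
    are chosen with this power different from 1 whenever n + 1 is prime. No prime denominator is
    then killed and the kernel is Z. Consequently tau(1/N) is a primitive N-th root of unity, which
    gives surjectivity. *)
Lemma torsion_hom : exists tau : rat -> C, [/\ rat_hom tau, tau 1 = 1,
  forall q, tau q = 1 -> exists k : int, q = k%:~R &
  forall N z, (0 < N)%N -> z ^+ N = 1 -> exists q, tau q = z].
Proof.
have /choice[rt rtP] (u : C * nat) : exists y, u.1 != 0 ->
    y ^+ u.2.+1 = u.1 /\ (prime u.2.+1 -> y ^+ (u.2)`! != 1).
  case: u => x n /=; have [->|x0] := eqVneq x 0; first by exists 0.
  (* If the chosen root has the forbidden power 1, it is multiplied by the root of unity of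
     [prime_root_ex]. *)
  pose y := n.+1.-root x; have yx : y ^+ n.+1 = x by rewrite rootCK.
  have [pn|np] := boolP (prime n.+1); last by exists y.
  have [yf|yf] := eqVneq (y ^+ n`!) 1; last by exists y.
  have [z [zp zf]] := prime_root_ex pn.
  by exists (y * z); rewrite !exprMn yx zp yf mulr1 mul1r.
pose h := fix h n := if n is n'.+1 then rt (h n', n') else 1.
have h0 n : h n != 0.
  elim: n => [|n IH] /=; first exact: oner_neq0.
  have [e _] := rtP (h n, n) IH; apply: contraNneq IH => z; by rewrite -[h n]e /= z expr0n.
have hS n : h n.+1 ^+ n.+1 = h n by have [] := rtP (h n, n) (h0 n).
have [tau [tD t1 _ tV]] := rat_power_system hS (h0 0%N).
have ht : rat_hom tau.
  split=> //; have := tD 0 1; rewrite add0r t1 /= mulr1; by [].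
have tz (k : int) : tau k%:~R = 1 by rewrite -[k%:~R]mul1r rat_homMz // t1 exp1rz.
have tp n : prime n.+1 -> tau (n.+1%:R^-1) != 1.
  by move=> pn; rewrite tV; have [_] := rtP (h n, n) (h0 n); apply.
have ker q : tau q = 1 -> exists k : int, q = k%:~R.
  move=> tq; pose d := `|denq q|%N; have dE : denq q = d%:Z by rewrite /d gtz0_abs ?denq_gt0.
  have d0 : (0 < d)%N by rewrite -ltz_nat -dE denq_gt0.
  have qd : q * d%:R = (numq q)%:~R by rewrite numqE dE.
  have [d1|d1] := eqVneq d 1%N; first by exists (numq q); rewrite -qd d1 mulr1.
  have pp : prime (pdiv d) by rewrite pdiv_prime // ltn_neqAle eq_sym d1.
  have : coprimez (numq q) (denq q) by rewrite coprimezE coprime_num_den.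
  move/coprimezP => [[u v] /= uv].
  (* By Bezout 1/d = q u + v with integers u and v, so the kernel contains 1/d and with it 1/p for a
     prime divisor p of d. *)
  have td : tau (d%:R^-1) = 1.
    have -> : d%:R^-1 = q * u%:~R + v%:~R.
      have nd : d%:R != 0 :> rat by rewrite pnatr_eq0 -lt0n.
      apply: (mulIf nd); rewrite mulVf // mulrDl mulrAC qd.
      have := congr1 (fun k : int => k%:~R : rat) uv; rewrite intrD !intrM dE /= => e.
      transitivity (u%:~R * (numq q)%:~R + v%:~R * d%:R : rat); first exact: esym e.
      by rewrite [X in X + _]mulrC.
    by rewrite tD rat_homMz // tq exp1rz mul1r.
  have /tp : prime (pdiv d).-1.+1 by rewrite prednK // prime_gt0.
  rewrite prednK ?prime_gt0 //; case/negP; apply/eqP.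
  have -> : (pdiv d)%:R^-1 = d%:R^-1 * (d %/ pdiv d)%:R :> rat.
    have nd : d%:R != 0 :> rat by rewrite pnatr_eq0 -lt0n.
    have np : (pdiv d)%:R != 0 :> rat by rewrite pnatr_eq0 -lt0n prime_gt0.
    apply: (mulIf np); rewrite mulVf // -mulrA -natrM divnK ?pdiv_dvd // mulVf //.
  by rewrite rat_homM // td expr1n.
exists tau; split=> // N z N0 zN.
have pr : N.-primitive_root (tau N%:R^-1).
  apply/andP; split=> //; apply/forallP => i; apply/eqP.
  have NR : N%:R != 0 :> rat by rewrite pnatr_eq0 -lt0n.
  rewrite unity_rootE -rat_homM //; apply/eqP/eqP => [/ker[k kE]|->]; last by rewrite mulVf.
  have : (i.+1)%:Z = k * N%:Z.
    apply: (@intr_inj rat); rewrite intrM -kE -pmulrn mulrAC mulVf // mul1r; by [].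
  by move: (ltn_ord i); case: k {kE} => [[|[|k]]|k] iN e; move: e; rewrite ?NegzE ?mul1r ?mul0r; nia.
have [i ->] := prim_rootP pr zN; exists (N%:R^-1 * i%:R); by rewrite rat_homM.
Qed.

End TorsionHom.

Section Levels.
Variables (L : fieldType) (B : L -> Prop) (bb : L -> nat -> L).
Hypotheses (spanB : forall z, acl B z)
  (bb_inj : forall x m y l, bb x m = bb y l -> x = y /\ m = l).

(** Four indices per level. Members of [B] outside the range of [bb] satisfy the bound vacuously and
    belong to every level, so the levels exhaust [B]. *)
Definition level n b := B b /\ forall x m, b = bb x m -> (m <= 4 * n)%N.

Lemma level_all z : exists n, acl (level n) z.
Proof.
have [s [sB sz]] := acl_fin (spanB z).
have [n sn] : exists n, forall b, b \in s -> level n b.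
  elim: s sB {sz} => [|b s IH] sB; first by exists 0%N.
  have [n sn] := IH (fun y ys => sB y (mem_behead (s := b :: s) ys)).
  have [k bk] : exists k, forall x m, b = bb x m -> (m <= k)%N.
    have [[x [m bm]]|no] := EM (exists x m, b = bb x m).
      by exists m => y l; rewrite bm => /bb_inj[_ ->].
    by exists 0%N => x m e; case: no; exists x, m.
  exists (n + k)%N => c /[!inE]/orP[/eqP->|/sn[Bc cn]].
    by split=> [|x m /bk h]; [apply: sB; rewrite mem_head|lia].
  by split=> // x m /cn h; lia.
by exists n; apply: acl_mono sz.
Qed.

End Levels.

Section Tower.
Variables (C : numClosedFieldType) (ch : [pchar C] =i pred0).
Variables (B : C -> Prop) (bb : C -> nat -> C).
Local Notation iQ := (Q2K ch).
Local Notation lvl := (level B bb).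
Local Notation Kn := (fun n => acl (lvl n)).
Definition eps n := bb 0 (4 * n).+1.
Hypotheses (iB : indepset B) (spanB : forall z, acl B z) (Bbb : forall x m, B (bb x m))
  (bb_inj : forall x m y l, bb x m = bb y l -> x = y /\ m = l)
  (Bpos : forall b, B b -> 0 < b) (tsmall : forall n p, acl (lvl n) p -> 0 < p -> eps n < p).

(* Three kinds of variables enter at level n+1: [eps n] and, for each element of [Kn n], one fresh
   variable for its exponential and one for its logarithm; [spareY y n] is already in [Kn n]. *)
Definition freshA a n := bb a (4 * n).+2.
Definition freshY y n := bb y (4 * n).+3.
Definition spareY y n := bb y (4 * n).
(** Lies strictly between 0 and 1 for positive [b] and generates the same field as [b]. *)
Definition frac (b : C) := b / (1 + b).
Definition smallA a n := eps n * frac (freshA a n).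
Definition beta a n := if a^* == a then 1 + smallA a n else (1 + 'i * smallA a n) / (1 - 'i * smallA a n).
Definition unitY (y : C) : C := if 0 < y then 1 else 'i.
Definition logval y n := unitY y * (spareY y n / eps n + frac (freshY y n)).
(** The generator of the kernel, in place of 2 pi i. It is imaginary, and its variable has index 0,
    which is never the index of a fresh variable. *)
Definition omega := 'i * bb 0 0.

Lemma lvl_subfield n : subfield (Kn n). Proof. exact: subfield_acl. Qed.
Lemma lvl_acl n z : acl (Kn n) z -> Kn n z. Proof. exact: acl_sub. Qed.
Lemma Bconj b : B b -> b^* = b.
Proof. by move=> /Bpos b0; apply: conj_Creal; apply: gtr0_real. Qed.
Lemma lvl_conj n z : Kn n z -> Kn n z^*. Proof. by apply: acl_conj => b [/Bconj]. Qed.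
Lemma lvl_succ n z : Kn n z -> Kn n.+1 z.
Proof.
by apply: acl_mono => b [Bb bm]; split=> // x m /bm h; rewrite (leq_trans h) // leq_mul2l leqnSn orbT.
Qed.
Lemma lvl_exhaust z : exists n, Kn n z. Proof. exact: level_all. Qed.

Lemma lvl_bb n x m : (m <= 4 * n)%N -> lvl n (bb x m).
Proof. by move=> mn; split=> // y l /bb_inj[_ <-]. Qed.
Lemma Kn_bb n x m : (m <= 4 * n)%N -> Kn n (bb x m).
Proof. by move=> mn; apply/acl_incl/lvl_bb. Qed.
Lemma Kn_i n : Kn n 'i.
Proof.
apply: (Kn_root lvl_acl (N := 2)) => //; rewrite sqrCi; apply/(sfpredP (lvl_subfield n)); rewrite rpredN; exact: rpred1.
Qed.

Lemma bbpos x m : 0 < bb x m. Proof. exact/Bpos. Qed.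
Lemma frac_gt0 x m : 0 < frac (bb x m).
Proof. by rewrite divr_gt0 ?bbpos // addr_gt0 ?bbpos. Qed.
Lemma frac_lt1 x m : frac (bb x m) < 1.
Proof. by rewrite ltr_pdivrMr ?mul1r ?ltrDr ?addr_gt0 ?bbpos. Qed.
Lemma eps_gt0 n : 0 < eps n. Proof. exact: bbpos. Qed.
Lemma smallA_gt0 a n : 0 < smallA a n. Proof. by rewrite mulr_gt0 ?eps_gt0 ?frac_gt0. Qed.

Lemma smallA_conj a n : (smallA a n)^* = smallA a n.
Proof. by apply: conj_Creal; apply: gtr0_real; apply: smallA_gt0. Qed.

Lemma infsmall_smallA a n : infsmall Kn n (smallA a n).
Proof.
move=> p Kp p0; rewrite ger0_norm ?ltW ?smallA_gt0 //; apply: lt_trans (tsmall Kp p0).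
by rewrite /smallA gtr_pMr ?eps_gt0 ?frac_lt1.
Qed.

Lemma cayley_den a n : 1 - 'i * smallA a n != 0 /\ 1 <= `|1 - 'i * smallA a n|.
Proof.
have h : 1 <= `|1 - 'i * smallA a n|.
  rewrite -(@ler_pXn2r _ 2) ?nnegrE ?normr_ge0 // expr1n normCK rmorphB rmorphM /= conjCi smallA_conj rmorph1.
  have -> : (1 - 'i * smallA a n) * (1 - - 'i * smallA a n) = 1 - 'i ^+ 2 * smallA a n ^+ 2 by ring.
  by rewrite sqrCi mulN1r opprK lerDl exprn_ge0 // ltW ?smallA_gt0.
by split=> //; rewrite -normr_gt0 (lt_le_trans _ h).
Qed.

Lemma beta_axis a n : onaxis (a^* == a) (beta a n).
Proof.
rewrite /beta; case: ifP => _ /=; first by rewrite addr_gt0 ?smallA_gt0.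
have [d0 _] := cayley_den a n; rewrite normf_div -[X in X / _]norm_conjC rmorphD rmorphM /= conjCi smallA_conj.
by rewrite rmorph1 mulNr divff // normr_eq0.
Qed.

Lemma infsmall_beta a n : infsmall Kn n (beta a n - 1).
Proof.
have me := @infsmall_smallA a n; rewrite /beta; case: ifP => _; first by rewrite addrC addrA addNr add0r.
have [d0 d1] := cayley_den a n.
have -> : (1 + 'i * smallA a n) / (1 - 'i * smallA a n) - 1 = (2%:R * 'i / (1 - 'i * smallA a n)) * smallA a n.
  by field.
have K2 : Kn n 2%:R by apply/(sfpredP (lvl_subfield n)); rewrite rpred_nat.
apply: (infsmallM lvl_subfield K2) => //; rewrite normf_div normrM normCi mulr1 normr_nat.
by rewrite ler_pdivrMr ?normr_gt0 // ler_peMr ?ler0n.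
Qed.

Lemma phiA_ex : exists phi : nat -> C -> rat -> C, forall n a,
  [/\ rat_hom (phi n a), phi n a 1 = beta a n, forall q, infsmall Kn n (phi n a q - 1) &
    forall q, onaxis (a^* == a) (phi n a q)].
Proof.
have /choice[phi phiP] (u : nat * C) := near1_rat_power lvl_subfield (@infsmall_beta u.2 u.1) (@beta_axis u.2 u.1).
by exists (fun n a => phi (n, a)) => n a; apply: (phiP (n, a)).
Qed.

Lemma phiY_ex : exists phi : C -> rat -> C, forall y, onaxis (0 < y) y ->
  [/\ rat_hom (phi y), phi y 1 = y & forall q, onaxis (0 < y) (phi y q)].
Proof.
have /choice[phi phiP] (y : C) : exists phi, onaxis (0 < y) y ->
    [/\ rat_hom phi, phi 1 = y & forall q, onaxis (0 < y) (phi q)].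
  have [/onaxis_rat_power[phi h]|no] := EM (onaxis (0 < y) y); first by exists phi.
  by exists (fun=> 0).
by exists phi.
Qed.

Lemma logval_axial y n : axial (logval y n).
Proof.
have h : (spareY y n / eps n + frac (freshY y n))^* = spareY y n / eps n + frac (freshY y n).
  apply: conj_Creal; apply: gtr0_real; apply: addr_gt0; last exact: frac_gt0.
  by apply: divr_gt0; apply: bbpos.
rewrite /axial /logval rmorphM /= h /unitY; case: ifP => _; first by left; rewrite rmorph1.
by right; rewrite conjCi mulNr.
Qed.

Lemma Kn_frac n x m : (m <= 4 * n)%N -> Kn n (frac (bb x m)).
Proof.
move=> mn; apply/(sfpredP (lvl_subfield n)); have h : bb x m \in sfpred (lvl_subfield n) by apply/sfpredP/Kn_bb.
by rewrite rpred_div ?rpredD ?rpred1.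
Qed.

Lemma Kn_logval y n : Kn n.+1 (logval y n).
Proof.
have h1 : unitY y \in sfpred (lvl_subfield n.+1).
  by rewrite /unitY; case: ifP => _; [rewrite rpred1|apply/sfpredP/Kn_i].
have h2 : spareY y n \in sfpred (lvl_subfield n.+1) by apply/sfpredP/Kn_bb; lia.
have h3 : eps n \in sfpred (lvl_subfield n.+1) by apply/sfpredP/Kn_bb; lia.
have h4 : frac (freshY y n) \in sfpred (lvl_subfield n.+1) by apply/sfpredP/Kn_frac; lia.
by apply/(sfpredP (lvl_subfield n.+1)); rewrite rpredM // rpredD // rpred_div.
Qed.

Lemma Kn_beta a n : Kn n.+1 (beta a n).
Proof.
have he : smallA a n \in sfpred (lvl_subfield n.+1).
  by rewrite rpredM //; apply/sfpredP; [apply: Kn_bb|apply: Kn_frac]; lia.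
have hi : 'i \in sfpred (lvl_subfield n.+1) by apply/sfpredP/Kn_i.
apply/(sfpredP (lvl_subfield n.+1)); rewrite /beta; case: ifP => _; first by rewrite rpredD ?rpred1.
have hie : 'i * smallA a n \in sfpred (lvl_subfield n.+1) by rewrite rpredM.
by rewrite rpred_div ?rpredB ?rpredD ?rpred1.
Qed.

Lemma bb_free x m : ~ acl (fun b => B b /\ b <> bb x m) (bb x m).
Proof. exact: iB. Qed.

Lemma acl_i (S : C -> Prop) : acl S 'i.
Proof.
apply: (@acl_mono _ (fun _ => False)) => //; apply: (acl_root (p := 'X^2 - (-1)%:P)).
- by rewrite -size_poly_gt0 size_XnsubC.
- have h := subfield_acl (fun _ : C => False); apply/(poverP h).
  by rewrite rpredB ?rpredX ?polyOverX // polyOverC rpredN rpred1.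
- by rewrite hornerD hornerN hornerXn hornerC sqrCi subrr.
Qed.

Lemma acl_unitY (S : C -> Prop) y : acl S (unitY y).
Proof.
rewrite /unitY; case: ifP => _; last exact: acl_i.
by case: (subfield_acl S).
Qed.

(* [eps n] is infinitesimal over [Kn n] and the [spareY y n] in [Kn n] are independent over Q,
   so a nontrivial combination of the [logval y n] is infinite over [Kn n]. *)
Lemma logval_infinite n (s : seq C) (q : C -> rat) k : uniq s -> Kn n k ->
  `|k + \sum_(y <- s) iQ (q y) * logval y n| <= 1 -> forall y, y \in s -> q y = 0.
Proof.
move=> us Kk le1 y0 y0s; apply/eqP; apply: contrapT => /negP q0.
pose rho := \sum_(y <- s) iQ (q y) * (unitY y * spareY y n).
pose sg := \sum_(y <- s) iQ (q y) * (unitY y * frac (freshY y n)).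
have sE : \sum_(y <- s) iQ (q y) * logval y n = rho / eps n + sg.
  by rewrite mulr_suml -big_split; apply: eq_bigr => y _; rewrite /logval /=; ring.
have u1 y : `|unitY y| = 1 by rewrite /unitY; case: ifP => _; rewrite ?normr1 ?normCi.
pose Q := \sum_(y <- s) `|iQ (q y)|.
have KQ : Kn n Q.
  by apply/(sfpredP (lvl_subfield n)); apply: rpred_sum => y _; apply/sfpredP/(Kn_norm lvl_subfield lvl_acl lvl_conj)/(iQ_Kn ch lvl_subfield).
have Q0 : 0 <= Q by apply: sumr_ge0 => y _; apply: normr_ge0.
have sgQ : `|sg| <= Q.
  apply: le_trans (ler_norm_sum _ _ _) _; apply: ler_sum => y _.
  rewrite normrM [`|unitY y * _|]normrM u1 mul1r ler_piMr ?normr_ge0 // [`|frac _|]ger0_norm.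
    by apply: ltW; apply: frac_lt1.
  by apply: ltW; apply: frac_gt0.
have Krho : Kn n rho.
  apply/(sfpredP (lvl_subfield n)); apply: rpred_sum => y _; apply: rpredM; first exact/sfpredP/(iQ_Kn ch lvl_subfield).
  by apply: rpredM; apply/sfpredP; [apply: acl_unitY|apply: Kn_bb; lia].
(* Otherwise the spare variable of [y0] would be algebraic over the other elements of [B]. *)
have rho0 : rho != 0.
  apply/eqP => r0; apply: (@bb_free y0 (4 * n)).
  have hO := subfield_acl (fun b => B b /\ b <> bb y0 (4 * n)%N).
  have iO q' : iQ q' \in sfpred hO by apply/sfpredP; apply: acl_gen; apply: Q2K_gen.
  have uO y : unitY y \in sfpred hO by apply/sfpredP; apply: acl_unitY.
  have uy : unitY y0 != 0 by rewrite -normr_eq0 u1 oner_eq0.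
  have iq0 : iQ (q y0) != 0 by rewrite fmorph_eq0.
  have e : bb y0 (4 * n)%N = - (\sum_(y <- rem y0 s) iQ (q y) * (unitY y * spareY y n)) / (iQ (q y0) * unitY y0).
    move: r0; rewrite /rho (big_rem y0) //= => /eqP; rewrite addr_eq0 => /eqP <-.
    by rewrite mulrA mulrAC mulfV ?mul1r // mulf_neq0.
  apply/(sfpredP hO); rewrite [X in X \in _]e rpred_div ?rpredM // rpredN big_seq; apply: rpred_sum => y ys.
  rewrite rpredM // rpredM //; apply/sfpredP/acl_incl; split=> [|/bb_inj[yy0 _]]; first exact: Bbb.
  by move: ys; rewrite yy0 mem_rem_uniqF.
(* A bound in K_n on |rho|/eps_n would make |rho|/N a positive element of K_n not above eps_n. *)
pose N := 1 + `|k| + Q; have N0 : 0 < N by rewrite ltr_wpDr // ltr_wpDr ?ltr01.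
have leN : `|rho| / eps n <= N.
  have -> : `|rho| / eps n = `|rho / eps n| by rewrite normf_div (gtr0_norm (eps_gt0 n)).
  have -> : rho / eps n = (k + \sum_(y <- s) iQ (q y) * logval y n) - k - sg by rewrite sE; ring.
  apply: le_trans (ler_normB _ _) _; apply: lerD sgQ; apply: le_trans (ler_normB _ _) _.
  by rewrite lerD2r.
have Kp : Kn n (`|rho| / N).
  apply/(sfpredP (lvl_subfield n)); rewrite rpred_div //; first exact/sfpredP/(Kn_norm lvl_subfield lvl_acl lvl_conj).
  by rewrite !rpredD ?rpred1 //; apply/sfpredP => //; apply/(Kn_norm lvl_subfield lvl_acl lvl_conj).
have := tsmall Kp; rewrite divr_gt0 ?normr_gt0 // => /(_ isT).
move: leN; rewrite ler_pdivrMr ?eps_gt0 // ltr_pdivlMr // mulrC => le lt.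
by have := lt_le_trans lt le; rewrite ltxx.
Qed.

Section TowerSpaces.
Variables (phiA : nat -> C -> rat -> C).
Hypothesis phiAP : forall n a, [/\ rat_hom (phiA n a), phiA n a 1 = beta a n,
  forall q, infsmall Kn n (phiA n a q - 1) & forall q, onaxis (a^* == a) (phiA n a q)].

Lemma Kn_phiA n a q : Kn n.+1 (phiA n a q).
Proof. by have [h e _ _] := phiAP n a; apply: rat_hom_acl h _; rewrite e; apply: Kn_beta. Qed.

(* [D n] is the part of [Kn n] where E is determined by the levels below n, and [I n] is its image
   under E: one step adds the logarithms of [Kn n], the other the exponentials. *)
Definition nextD n (Y : C -> Prop) z := exists k (s : seq (C * rat)),
  [/\ Kn n k, in_list Y s & z = k + \sum_(p <- s) iQ p.2 * logval p.1 n].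
Definition nextI n (A : C -> Prop) z := exists k (s : seq (C * rat)),
  [/\ Kn n k, k != 0, in_list A s & z = k * \prod_(p <- s) phiA n p.1 p.2].

Definition additive_ok n (D : C -> Prop) := [/\ forall d, D d -> Kn n d, D 0,
  forall d d', D d -> D d' -> D (d + d'), forall q d, D d -> D (iQ q * d) &
  forall d, D d -> D d^*].
Definition mult_ok n (I : C -> Prop) := [/\ forall x, I x -> Kn n x /\ x != 0, I 1,
  forall x y, I x -> I y -> I (x * y), forall x, I x -> I x^-1 &
  forall N x, (0 < N)%N -> x != 0 -> I (x ^+ N) -> I x].
Definition adapted_ok n D A := adapted ch Kn n D A /\
  forall z, Kn n z -> exists d v, [/\ D d, qspan ch A v & z = d + v].
Definition mbasis_ok n (I Y : C -> Prop) := [/\ forall y, Y y -> Kn n y /\ onaxis (0 < y) y,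
  forall (s : seq C) (k : C -> int), uniq s -> (forall y, y \in s -> Y y) ->
    I (\prod_(y <- s) y ^ k y) -> forall y, y \in s -> k y = 0 &
  forall z, Kn n z -> z != 0 -> onaxis (0 < z) z -> exists N (s : seq C) (k : C -> int),
    [/\ (0 < N)%N, forall y, y \in s -> Y y & I (z ^+ N * \prod_(y <- s) y ^ k y)]].

(** The start of the recursion: E is first known on the rational multiples of [omega], by [tau], and
    its image there is the group of roots of unity. *)
Definition rat_periods z := exists q, z = iQ q * omega.
Definition roots_of_unity (z : C) := exists N, (0 < N)%N /\ z ^+ N = 1.

Lemma KnD n x y : Kn n x -> Kn n y -> Kn n (x + y).
Proof. by move=> hx hy; apply/(sfpredP (lvl_subfield n)); rewrite rpredD //; apply/sfpredP. Qed.
Lemma KnM n x y : Kn n x -> Kn n y -> Kn n (x * y).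
Proof. by move=> hx hy; apply/(sfpredP (lvl_subfield n)); rewrite rpredM //; apply/sfpredP. Qed.

Lemma omega_conj : omega^* = - omega.
Proof. by rewrite /omega rmorphM /= conjCi Bconj // mulNr. Qed.

Lemma additive0 : additive_ok 0 rat_periods.
Proof.
split.
- move=> _ [q ->]; apply: KnM; first exact: (iQ_Kn ch lvl_subfield).
  by apply: KnM; [apply: Kn_i|apply: Kn_bb].
- by exists 0; rewrite rmorph0 mul0r.
- by move=> _ _ [q ->] [q' ->]; exists (q + q'); rewrite rmorphD mulrDl.
- by move=> q _ [q' ->]; exists (q * q'); rewrite rmorphM mulrA.
- by move=> _ [q ->]; exists (- q); rewrite rmorphM /= iQ_conj omega_conj rmorphN mulrN mulNr.
Qed.

Lemma mult0 : mult_ok 0 roots_of_unity.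
Proof.
split.
- move=> x [N [N0 xN]]; split; last by apply: contraTneq N0 => x0; move/eqP: xN; rewrite x0 expr0n; case: N => // N; rewrite eq_sym oner_eq0.
  by apply: (Kn_root lvl_acl N0); rewrite xN; case: (lvl_subfield 0).
- by exists 1%N; rewrite expr1n.
- by move=> x y [N [N0 xN]] [M [M0 yM]]; exists (N * M)%N; rewrite muln_gt0 N0 M0 exprMn exprM xN mulnC exprM yM !expr1n mulr1.
- by move=> x [N [N0 xN]]; exists N; rewrite exprVn xN invr1.
- by move=> N x N0 _ [M [M0 e]]; exists (N * M)%N; rewrite muln_gt0 N0 M0 exprM.
Qed.

Lemma nextD_additive n Y : additive_ok n.+1 (nextD n Y).
Proof.
have sumZ q (s : seq (C * rat)) :
    \sum_(p <- scaled q s) iQ p.2 * logval p.1 n = iQ q * \sum_(p <- s) iQ p.2 * logval p.1 n.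
  by rewrite big_map mulr_sumr; apply: eq_bigr => p _; rewrite rmorphM mulrA.
split.
- move=> _ [k [s [Kk _ ->]]]; apply: KnD; first exact: lvl_succ.
  apply/(sfpredP (lvl_subfield n.+1)); apply: rpred_sum => p _; apply/sfpredP; apply: KnM; first exact: (iQ_Kn ch lvl_subfield).
  exact: Kn_logval.
- by exists 0, [::]; rewrite big_nil addr0; split=> //; case: (lvl_subfield n).
- move=> _ _ [k [s [Kk sY ->]]] [k' [s' [Kk' s'Y ->]]]; exists (k + k'), (s ++ s').
  by split; [apply: KnD|apply: in_list_cat|rewrite big_cat /=; ring].
- move=> q _ [k [s [Kk sY ->]]]; exists (iQ q * k), (scaled q s); rewrite sumZ mulrDr; split=> //.
    by apply: KnM => //; apply: (iQ_Kn ch lvl_subfield).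
  exact: in_list_scaled.
move=> _ [k [s [Kk sY ->]]]; exists k^*, [seq (p.1, if (logval p.1 n)^* == logval p.1 n then p.2 else - p.2) | p <- s].
split; [exact: lvl_conj|by move=> _ /mapP[p /sY ? ->]|].
rewrite rmorphD rmorph_sum big_map; congr (_ + _); apply: eq_bigr => p _ /=.
rewrite rmorphM /= iQ_conj; case: eqP => [->//|h].
by case: (logval_axial p.1 n) => // ->; rewrite rmorphN mulrN mulNr.
Qed.

Lemma phiA_neq0 n a q : phiA n a q != 0.
Proof. by have [h _ _ _] := phiAP n a; apply: rat_hom_neq0. Qed.

Lemma prod_phiA_scaled n q (s : seq (C * rat)) N : q * N%:R = 1 ->
  (\prod_(p <- scaled q s) phiA n p.1 p.2) ^+ N = \prod_(p <- s) phiA n p.1 p.2.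
Proof.
move=> qN; rewrite big_map -prodrXl; apply: eq_bigr => p _ /=.
by have [h _ _ _] := phiAP n p.1; rewrite -rat_homM // mulrAC qN mul1r.
Qed.

Lemma nextI_mult n A : mult_ok n.+1 (nextI n A).
Proof.
have K1 m : Kn m 1 by case: (lvl_subfield m).
split.
- move=> _ [k [s [Kk k0 _ ->]]]; split.
    apply: KnM; first exact: lvl_succ.
    by apply/(sfpredP (lvl_subfield n.+1)); apply: rpred_prod => p _; apply/sfpredP/Kn_phiA.
  by rewrite mulf_neq0 // prodf_seq_neq0; apply/allP => p _; apply: phiA_neq0.
- by exists 1, [::]; rewrite big_nil mulr1 oner_neq0; split.
- move=> _ _ [k [s [Kk k0 sA ->]]] [k' [s' [Kk' k'0 s'A ->]]]; exists (k * k'), (s ++ s').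
  split; [exact: KnM|exact: mulf_neq0|exact: in_list_cat|rewrite big_cat /=; ring].
- move=> _ [k [s [Kk k0 sA ->]]]; exists k^-1, (scaled (-1) s); rewrite invr_neq0 //; split=> //.
  + exact: subfieldV (lvl_subfield n) Kk.
  + exact: in_list_scaled.
  rewrite invfM big_map -prodfV; congr (_ * _); apply: eq_bigr => p _ /=.
  by have [h _ _ _] := phiAP n p.1; rewrite mulN1r rat_homN.
move=> N x N0 x0 [k [s [Kk k0 sA e]]]; pose P := \prod_(p <- scaled N%:R^-1 s) phiA n p.1 p.2.
have P0 : P != 0 by rewrite prodf_seq_neq0; apply/allP => p _; apply: phiA_neq0.
have PN : P ^+ N = \prod_(p <- s) phiA n p.1 p.2.
  by apply: prod_phiA_scaled; rewrite mulVf // pnatr_eq0 -lt0n.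
exists (x / P), (scaled N%:R^-1 s); split; last by rewrite divfK.
- by apply: (Kn_root lvl_acl N0); rewrite expr_div_n e PN mulfK // -PN expf_neq0.
- by rewrite mulf_neq0 ?invr_eq0.
- exact: in_list_scaled.
Qed.

Lemma tower_exists : exists D I A Y : nat -> C -> Prop,
  [/\ D 0%N = rat_periods /\ I 0%N = roots_of_unity,
      forall n, D n.+1 = nextD n (Y n) /\ I n.+1 = nextI n (A n),
      forall n, additive_ok n (D n) /\ mult_ok n (I n),
      forall n, adapted_ok n (D n) (A n) & forall n, mbasis_ok n (I n) (Y n)].
Proof.
pose S := (((C -> Prop) * (C -> Prop)) * ((C -> Prop) * (C -> Prop)))%type.
pose Inv n (u : S) := [/\ n = 0%N -> u.1.1 = rat_periods /\ u.1.2 = roots_of_unity,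
  additive_ok n u.1.1, mult_ok n u.1.2, adapted_ok n u.1.1 u.2.1 & mbasis_ok n u.1.2 u.2.2].
pose Rel n (u v : S) := v.1.1 = nextD n u.2.2 /\ v.1.2 = nextI n u.2.1.
have mk n D I : additive_ok n D -> mult_ok n I -> (n = 0%N -> D = rat_periods /\ I = roots_of_unity) ->
    exists A Y, Inv n ((D, I), (A, Y)).
  move=> [d1 d2 d3 d4 d5] [i1 i2 i3 i4 i5] h0.
  have [A hA] := adapted_basis lvl_subfield lvl_acl lvl_conj lvl_succ d1 d2 d3 d4 d5.
  have [Y [y1 y2 y3]] := @mult_basis C (Kn n) I i2 i4.
  by exists A, Y; split.
have [||f fP] := @dependent_sequence S Inv Rel.
- by have [A [Y h]] := mk 0%N rat_periods roots_of_unity additive0 mult0 (fun _ => conj erefl erefl); exists ((rat_periods, roots_of_unity), (A, Y)).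
- move=> n u [_ _ _ _ _].
  have [A [Y h]] := mk n.+1 _ _ (nextD_additive n u.2.2) (nextI_mult n u.2.1) (fun e => match O_S n (esym e) with end).
  by exists ((nextD n u.2.2, nextI n u.2.1), (A, Y)).
exists (fun n => (f n).1.1), (fun n => (f n).1.2), (fun n => (f n).2.1), (fun n => (f n).2.2).
have h0 : (f 0%N).1.1 = rat_periods /\ (f 0%N).1.2 = roots_of_unity by have [[h _ _ _ _] _] := fP 0%N; apply: h.
by split=> // n; have [[h h1 h2 h3 h4] hr] := fP n.
Qed.

End TowerSpaces.
Local Notation Om f := (acl (fun b => B b /\ b <> f)).

Lemma Om_bb f x m : bb x m <> f -> Om f (bb x m).
Proof. by move=> ne; apply: acl_incl; split. Qed.

Lemma Om_Kn n x l z : (4 * n < l)%N -> Kn n z -> Om (bb x l) z.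
Proof.
move=> nl; apply: acl_mono => b [Bb bl]; split=> // e.
by have := bl _ _ e; rewrite leqNgt nl.
Qed.

Lemma Om_frac f x m : Om f (frac (bb x m)) <-> Om f (bb x m).
Proof.
have h := subfield_acl (fun b => B b /\ b <> f); set O := sfpred h.
have b1 : 1 + bb x m != 0 by rewrite gt_eqF // addr_gt0 ?bbpos.
split=> /(sfpredP h) hb; apply/(sfpredP h); last by rewrite rpred_div ?rpredD ?rpred1.
have -> : bb x m = frac (bb x m) / (1 - frac (bb x m)); last by rewrite rpred_div ?rpredB ?rpred1.
by rewrite /frac; field; rewrite b1 addrK oner_eq0.
Qed.

Lemma Om_beta f a n : freshA a n <> f -> eps n <> f -> Om f (beta a n).
Proof.
move=> fa ft; have h := subfield_acl (fun b => B b /\ b <> f).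
have he : smallA a n \in sfpred h by rewrite rpredM //; apply/sfpredP; [apply: Om_bb|apply/Om_frac/Om_bb].
have hie : 'i * smallA a n \in sfpred h by rewrite rpredM //; apply/sfpredP/acl_i.
apply/(sfpredP h); rewrite /beta; case: ifP => _; first by rewrite rpredD ?rpred1.
by rewrite rpred_div ?rpredB ?rpredD ?rpred1.
Qed.

Lemma nOm_beta a n : ~ Om (freshA a n) (beta a n).
Proof.
have h := subfield_acl (fun b => B b /\ b <> freshA a n) => /(sfpredP h) hb.
have ht : eps n \in sfpred h by apply/sfpredP/Om_bb => /bb_inj[_]; lia.
have hi : 'i \in sfpred h by apply/sfpredP/acl_i.
apply: (@bb_free a (4 * n).+2); apply/Om_frac/(sfpredP h).
have t0 : eps n != 0 by rewrite gt_eqF ?eps_gt0.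
have -> : frac (bb a (4 * n).+2) = smallA a n / eps n by rewrite /smallA mulrAC mulfV ?mul1r.
rewrite rpred_div //; move: hb; rewrite /beta; case: ifP => _ hb.
  by rewrite (_ : smallA a n = (1 + smallA a n) - 1) ?rpredB ?rpred1 //; ring.
have [d0 _] := cayley_den a n; set b := _ / _ in hb.
have bE : 1 + b = 2%:R / (1 - 'i * smallA a n) by rewrite /b; field.
have b1 : 1 + b != 0 by rewrite bE mulf_neq0 ?invr_eq0 ?pnatr_eq0.
have -> : smallA a n = (b - 1) / ('i * (1 + b)).
  apply: (mulIf (mulf_neq0 (neq0Ci C) b1)); rewrite divfK; last by rewrite mulf_neq0 ?neq0Ci.
  by rewrite bE /b; field.
by rewrite rpred_div ?rpredM ?rpredB ?rpredD ?rpred1.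
Qed.

Lemma Om_logval f y n : spareY y n <> f -> eps n <> f -> freshY y n <> f -> Om f (logval y n).
Proof.
move=> fr ft fy; have h := subfield_acl (fun b => B b /\ b <> f).
have h1 : unitY y \in sfpred h by apply/sfpredP; apply: acl_unitY.
have h2 : spareY y n \in sfpred h by apply/sfpredP/Om_bb.
have h3 : eps n \in sfpred h by apply/sfpredP/Om_bb.
have h4 : frac (freshY y n) \in sfpred h by apply/sfpredP/Om_frac/Om_bb.
by apply/(sfpredP h); rewrite rpredM // rpredD // rpred_div.
Qed.

Lemma unitY_neq0 y : unitY y != 0.
Proof. by rewrite /unitY; case: ifP => _; rewrite ?oner_neq0 ?neq0Ci. Qed.

Lemma nOm_logval y n : ~ Om (freshY y n) (logval y n).
Proof.
have h := subfield_acl (fun b => B b /\ b <> freshY y n) => /(sfpredP h) hb.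
have h1 : unitY y \in sfpred h by apply/sfpredP; apply: acl_unitY.
have h2 : spareY y n \in sfpred h by apply/sfpredP/Om_bb => /bb_inj[_]; lia.
have h3 : eps n \in sfpred h by apply/sfpredP/Om_bb => /bb_inj[_]; lia.
apply: (@bb_free y (4 * n).+3); apply/Om_frac/(sfpredP h).
have -> : frac (bb y (4 * n).+3) = logval y n / unitY y - spareY y n / eps n.
  by rewrite /logval mulrAC mulfV ?unitY_neq0 // mul1r addrC addKr.
by rewrite rpredB // rpred_div.
Qed.

(** The logarithm is real exactly when its value is positive, so that E commutes with conjugation on
    it. *)
Lemma logval_real y n : ((logval y n)^* == logval y n) = (0 < y).
Proof.
have h0 : 0 < spareY y n / eps n + frac (freshY y n).
  by apply: addr_gt0; [apply: divr_gt0; apply: bbpos|apply: frac_gt0].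
have h : (spareY y n / eps n + frac (freshY y n))^* = spareY y n / eps n + frac (freshY y n).
  by apply: conj_Creal; apply: gtr0_real.
rewrite /logval rmorphM /= h /unitY; case: ifP => _; first by rewrite rmorph1 eqxx.
by rewrite conjCi mulNr eqNr mulf_eq0 (negbTE (neq0Ci C)) gt_eqF.
Qed.

Lemma omega_neq0 : omega != 0.
Proof. by rewrite mulf_neq0 ?neq0Ci // gt_eqF ?bbpos. Qed.

(** * The exponential on the union of the levels *)

Section Assembly.
Variables (phiA : nat -> C -> rat -> C) (phiY : C -> rat -> C) (tau : rat -> C).
Hypothesis phiAP : forall n a, [/\ rat_hom (phiA n a), phiA n a 1 = beta a n,
  forall q, infsmall Kn n (phiA n a q - 1) & forall q, onaxis (a^* == a) (phiA n a q)].
Hypothesis phiYP : forall y, onaxis (0 < y) y ->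
  [/\ rat_hom (phiY y), phiY y 1 = y & forall q, onaxis (0 < y) (phiY y q)].
Hypotheses (htau : rat_hom tau) (tau1 : tau 1 = 1)
  (tauK : forall q, tau q = 1 -> exists k : int, q = k%:~R)
  (tauS : forall N z, (0 < N)%N -> z ^+ N = 1 -> exists q, tau q = z).
Variables (D I A Y : nat -> C -> Prop).
Hypotheses (hDI0 : D 0%N = rat_periods /\ I 0%N = roots_of_unity)
  (hDIS : forall n, D n.+1 = nextD n (Y n) /\ I n.+1 = nextI phiA n (A n))
  (hDI : forall n, additive_ok n (D n) /\ mult_ok n (I n))
  (hA : forall n, adapted_ok n (D n) (A n)) (hY : forall n, mbasis_ok n (I n) (Y n)).

(** The basis elements that complete D_n to D_(n+1): first the adapted family up to K_n, then the
    logarithms beyond K_n. *)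
Let Xn n x := A n x \/ exists y, Y n y /\ x = logval y n.
Let X x := exists n, Xn n x.
Let Z x := X x \/ x = omega.

Let D_Kn n z : D n z -> Kn n z. Proof. by have [[h _ _ _ _] _] := hDI n; apply: h. Qed.
Let D_0 n : D n 0. Proof. by have [[_ h _ _ _] _] := hDI n. Qed.
Let D_D n x y : D n x -> D n y -> D n (x + y).
Proof. by have [[_ _ h _ _] _] := hDI n; apply: h. Qed.
Let D_Z n q x : D n x -> D n (iQ q * x).
Proof. by have [[_ _ _ h _] _] := hDI n; apply: h. Qed.
Let Kn_D n z : Kn n z -> D n.+1 z.
Proof. by have [-> _] := hDIS n => Kz; exists z, [::]; rewrite big_nil addr0. Qed.
Let D_le m n z : (m <= n)%N -> D m z -> D n z.
Proof.
elim: n => [|n IH]; first by rewrite leqn0 => /eqP->.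
by rewrite leq_eqVlt => /orP[/eqP->//|/IH h /h/D_Kn/Kn_D].
Qed.
Let A_Kn n a : A n a -> Kn n a. Proof. by have [[h _ _] _] := hA n; apply: h. Qed.
Let Y_Kn n y : Y n y -> Kn n y. Proof. by have [h _ _] := hY n => /h[]. Qed.
Let Y_axis n y : Y n y -> onaxis (0 < y) y. Proof. by have [h _ _] := hY n => /h[]. Qed.
Let logval_D n y : Y n y -> D n.+1 (logval y n).
Proof.
have [-> _] := hDIS n => Yy; exists 0, [:: (y, 1)]; rewrite big_seq1 rmorph1 mul1r add0r.
by split=> // [|p /[!inE]/eqP->//]; case: (lvl_subfield n).
Qed.
Let Xn_D n x : Xn n x -> D n.+1 x.
Proof. by case=> [/A_Kn/Kn_D|[y [/logval_D h ->]]]. Qed.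
Let omega_D n : D n omega.
Proof.
apply: (@D_le 0) => //; have [-> _] := hDI0; exists 1; by rewrite rmorph1 mul1r.
Qed.
Let D_sum n (s : seq C) (q : C -> rat) (F : C -> C) : (forall x, x \in s -> D n (F x)) ->
  D n (\sum_(x <- s) iQ (q x) * F x).
Proof.
move=> h; rewrite big_seq; elim/big_ind: _ => // [x y|x xs]; [exact: D_D|exact/D_Z/h].
Qed.

Let D_split n z : D n.+1 z -> exists d (s : seq C) (q : C -> rat) (t : seq C) (r : C -> rat),
  [/\ D n d, uniq s /\ (forall a, a \in s -> A n a), uniq t /\ (forall y, y \in t -> Y n y) &
    z = d + \sum_(a <- s) iQ (q a) * a + \sum_(y <- t) iQ (r y) * logval y n].
Proof.
have [-> _] := hDIS n => -[k [s' [Kk s'Y ->]]].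
have [_ /(_ k Kk)[d [v [Dd /qspan_uniq[s [q [us sA ->]]] ->]]]] := hA n.
exists d, s, q, (undup (map fst s')), (fun y => \sum_(p <- s' | p.1 == y) p.2).
rewrite undup_uniq; split=> //; first by split=> // y; rewrite mem_undup => /mapP[p /s'Y ? ->].
congr (_ + _); apply: (collect_terms (F := fun y q => iQ q * logval y n)) => [y|y a b].
  by rewrite rmorph0 mul0r.
by rewrite rmorphD mulrDl.
Qed.

Let split_sum (P : C -> bool) (s : seq C) (F : C -> C) :
  \sum_(x <- s) F x = \sum_(x <- filter P s) F x + \sum_(x <- filter (predC P) s) F x.
Proof. by rewrite !big_filter (bigID P). Qed.

(** Everything but the logarithms lies in K_n, so [logval_infinite] kills the logarithmic
    coefficients first; adaptedness then kills the others. *)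
Let Xn_free n (s : seq C) (q : C -> rat) d : uniq s -> (forall x, x \in s -> Xn n x) -> D n d ->
  d + \sum_(x <- s) iQ (q x) * x = 0 -> forall x, x \in s -> q x = 0.
Proof.
move=> us sX Dd; rewrite (split_sum (fun x => `[< A n x >])).
set sA := filter _ s; set sY := filter _ s => e.
have sAA x : x \in sA -> A n x by rewrite mem_filter => /andP[/asboolP].
have /choice[g gP] x : exists y, x \in sY -> Y n y /\ x = logval y n.
  have [xs|xs] := boolP (x \in sY); last by exists 0.
  have := xs; rewrite mem_filter => /andP[/asboolP nA /sX[//|[y h]]]; by exists y.
have sYE : \sum_(x <- sY) iQ (q x) * x = \sum_(y <- map g sY) iQ (q (logval y n)) * logval y n.
  by rewrite big_map [LHS]big_seq [RHS]big_seq; apply: eq_bigr => x /gP[_ <-].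
have uY : uniq (map g sY).
  rewrite map_inj_in_uniq ?filter_uniq // => x x' /gP[_ e1] /gP[_ e2] gg.
  by rewrite e1 e2 gg.
have KA : Kn n (d + \sum_(x <- sA) iQ (q x) * x).
  apply: KnD; first exact: D_Kn.
  apply/(sfpredP (lvl_subfield n)); rewrite big_seq; apply: rpred_sum => x /sAA/A_Kn Kx; apply/sfpredP.
  by apply: KnM => //; apply: (iQ_Kn ch lvl_subfield).
have qY x : x \in sY -> q x = 0.
  move=> xs; have [_ {1}->] := gP x xs; apply: (logval_infinite (q := fun y => q (logval y n)) uY KA); last exact: map_f.
  by rewrite -sYE -addrA e normr0 ler01.
have e' : d + \sum_(x <- sA) iQ (q x) * x = 0.
  move: e; rewrite [X in _ + (_ + X)]big_seq [X in _ + (_ + X)]big1 ?addr0 // => x /qY->.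
  by rewrite rmorph0 mul0r.
move=> x xs; have [/asboolP Ax|nA] := boolP `[< A n x >]; last by apply: qY; rewrite mem_filter /= nA.
have [[_ _ hfree] _] := hA n; have [_ /(_ e')] := hfree sA q d (filter_uniq _ us) sAA Dd.
by apply; rewrite mem_filter xs andbT; apply/asboolP.
Qed.

Let Xn_notD n x : Xn n x -> ~ D n x.
Proof.
move=> Xx Dx; have sX y : y \in [:: x] -> Xn n y by move=> /[!inE]/eqP->.
have := @Xn_free n [:: x] (fun=> -1) x isT sX Dx; rewrite big_seq1 rmorphN1 mulN1r subrr.
by move=> /(_ erefl x (mem_head _ _))/eqP; rewrite oppr_eq0 oner_eq0.
Qed.

(** A basis element of level n is in D_(n+1) but not in D_n. *)
Let X_level m n x : Xn m x -> Xn n x -> m = n.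
Proof.
have aux m' n' : (m' < n')%N -> Xn m' x -> ~ Xn n' x.
  by move=> lt /Xn_D/(D_le lt) h /Xn_notD.
by move=> Xm Xn'; case: (ltngtP m n) => // /aux; [case/(_ Xm)|case/(_ Xn')].
Qed.

Let A_not_logval n y : ~ A n (logval y n).
Proof.
move=> /A_Kn Ka'; have := @logval_infinite n [:: y] (fun=> -1) _ isT Ka'.
rewrite big_seq1 rmorphN1 mulN1r subrr normr0 ler01 => /(_ isT y (mem_head _ _))/eqP.
by rewrite oppr_eq0 oner_eq0.
Qed.

Let logval_inj n y y' : logval y n = logval y' n -> y = y'.
Proof.
move=> e; apply/eqP; apply: contrapT => /negP ne.
have := @logval_infinite n [:: y; y'] (fun x => if x == y then 1 else -1) 0.
rewrite /= inE ne big_cons big_seq1 eqxx eq_sym (negbTE ne) rmorph1 rmorphN1 e mul1r mulN1r subrr addr0 normr0 ler01.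
by case: (lvl_subfield n) => K0 _ _ _ /(_ isT K0 isT y (mem_head _ _))/eqP; rewrite eqxx oner_eq0.
Qed.

Let Z_free : lin_free ch Z.
Proof.
have main n : forall (s : seq C) (q : C -> rat), uniq s ->
    (forall x, x \in s -> (exists m, (m < n)%N /\ Xn m x) \/ x = omega) ->
    \sum_(x <- s) iQ (q x) * x = 0 -> forall x, x \in s -> q x = 0.
  elim: n => [|n IH] s q us sZ e x xs.
    have sw y : y \in s -> y = omega by move=> /sZ[[m []]|].
    have : s = [:: omega].
      case: s us sw xs {e sZ} => [|y [|y' s]] us sw _ //; first by rewrite (sw y) ?mem_head.
      have y'w : y' = omega by apply: sw; rewrite !inE eqxx orbT.
      by move: us; rewrite y'w (sw y) ?mem_head //= inE eqxx.
    move=> sE; move: e; rewrite sE big_seq1 => /eqP; rewrite mulf_eq0 fmorph_eq0.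
    rewrite (negbTE omega_neq0) orbF => /eqP.
    by move: xs; rewrite sE inE => /eqP->.
  have := e; rewrite (split_sum (fun x => `[< Xn n x >])).
  set s1 := filter _ s; set s2 := filter _ s => e12.
  have s2Z y : y \in s2 -> (exists m, (m < n)%N /\ Xn m y) \/ y = omega.
    rewrite mem_filter => /andP[/asboolP nX /sZ[[m [mn Xm]]|->]]; last by right.
    left; exists m; split=> //; move: mn; rewrite ltnS leq_eqVlt => /orP[/eqP mn|//].
    by rewrite -mn in nX.
  have D2 : D n (\sum_(x <- s2) iQ (q x) * x).
    apply: (@D_sum n s2 q id) => y /s2Z[[m [mn /Xn_D]]|->]; [exact: D_le|exact: omega_D].
  have q1 y : y \in s1 -> q y = 0.
    apply: (@Xn_free n s1 q _ (filter_uniq _ us) _ D2); last by rewrite addrC.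
    by move=> y'; rewrite mem_filter => /andP[/asboolP].
  have [/asboolP Xx|nX] := boolP `[< Xn n x >].
    by apply: q1; rewrite mem_filter xs andbT; apply/asboolP.
  apply: (IH s2 q) => //; rewrite ?filter_uniq //; last by rewrite mem_filter /= nX.
  move: e12; rewrite [X in X + _]big_seq [X in X + _]big1 ?add0r // => y /q1->.
  by rewrite rmorph0 mul0r.
move=> s q us sZ; have [n sn] : exists n, forall x, x \in s -> (exists m, (m < n)%N /\ Xn m x) \/ x = omega.
  elim: s sZ {us} => [|x s IH] sZ; first by exists 0%N.
  have [n sn] := IH (fun y ys => sZ y (mem_behead (s := x :: s) ys)).
  have [[k Xk]|xw] := sZ x (mem_head _ _); last first.
    by exists n => y /[!inE]/orP[/eqP->|/sn]; [right|].
  exists (n + k.+1)%N => y /[!inE]/orP[/eqP->|/sn[[m [mn Xm]]|]]; last by right.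
    by left; exists k; split=> //; rewrite addnS ltnS leq_addl.
  by left; exists m; split=> //; apply: leq_trans mn (leq_addr _ _).
exact: (main n).
Qed.

Let Z_span_D n z : D n z -> qspan ch Z z.
Proof.
elim: n z => [|n IH] z.
  by have [-> _] := hDI0 => -[q ->]; apply/qspanZ/qspan_mem; right.
move=> /D_split[d [s [q [t [r [/IH hd [_ sA] [_ tY] ->]]]]]].
apply: qspanD; first apply: qspanD => //.
  apply: (qspan_sub (P := A n)); first by move=> x Ax; left; exists n; left.
  exact: qspan_sum.
rewrite big_seq; elim/big_ind: _ => [|x y|y /tY Yy]; [exact: qspan0|exact: qspanD|].
by apply/qspanZ/qspan_mem; left; exists n; right; exists y.
Qed.

Let Z_span z : exists s, in_list Z s /\ z = lincomb ch s.
Proof. by have [n /Kn_D/Z_span_D] := lvl_exhaust z. Qed.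

(** Level, fresh variable and rational powers attached to [x]. They are well defined because the
    level is unique, an adapted element is never a logarithm of the same level, and a logarithm
    determines its value. *)
Let Z_data x : exists u : nat * C * (rat -> C), [/\ x = omega -> u.2 = tau,
  forall n, A n x -> u = (n, freshA x n, phiA n x) &
  forall n y, Y n y -> x = logval y n -> u = (n, freshY y n, phiY y)].
Proof.
have [[n Xx]|nX] := EM (X x); last first.
  exists (0%N, 0, tau); split=> // [n Ax|n y Yy xy]; case: nX; exists n; [by left|by right; exists y].
have nw : x <> omega by move=> e; apply: (Xn_notD Xx); rewrite e.
case: (Xx) => [Ax|[y [Yy xy]]].
  exists (n, freshA x n, phiA n x); split=> // m.
    by move=> Am; rewrite (@X_level m n x) //; left.
  move=> y Yy xy; have e : m = n by apply: (@X_level m n x) => //; right; exists y.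
  by case: (@A_not_logval n y); rewrite -{2}e -xy.
exists (n, freshY y n, phiY y); split=> // m.
  move=> Am; have e : m = n by apply: (@X_level m n x) => //; left.
  by case: (@A_not_logval n y); rewrite -xy -e.
move=> y' Yy' xy'; have e : m = n by apply: (@X_level m n x) => //; right; exists y'.
by move: xy'; rewrite e xy => /logval_inj->.
Qed.

Let sp_ex : exists sp : C -> nat * C * (rat -> C), forall x, [/\ x = omega -> (sp x).2 = tau,
  forall n, A n x -> sp x = (n, freshA x n, phiA n x) &
  forall n y, Y n y -> x = logval y n -> sp x = (n, freshY y n, phiY y)].
Proof. by have /choice[sp h] := Z_data; exists sp. Qed.
Let sp := sval (cid sp_ex).
Let spP := svalP (cid sp_ex).
Let lev x := (sp x).1.1.
Let fr x := (sp x).1.2.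
Let phi x := (sp x).2.

Let phi_omega : phi omega = tau. Proof. by have [h _ _] := spP omega; apply: h. Qed.
Let sp_A n a : A n a -> sp a = (n, freshA a n, phiA n a).
Proof. by have [_ h _] := spP a; apply: h. Qed.
Let sp_Y n y : Y n y -> sp (logval y n) = (n, freshY y n, phiY y).
Proof. by have [_ _ h] := spP (logval y n) => Yy; apply: h. Qed.
Let phi_A n a : A n a -> phi a = phiA n a. Proof. by rewrite /phi => /sp_A->. Qed.
Let phi_Y n y : Y n y -> phi (logval y n) = phiY y. Proof. by rewrite /phi => /sp_Y->. Qed.

Let phiY_hom n y : Y n y -> rat_hom (phiY y). Proof. by move=> /Y_axis/phiYP[]. Qed.
Let phi_hom x : Z x -> rat_hom (phi x).
Proof.
case=> [[n [Ax|[y [Yy ->]]]]|->]; last by rewrite phi_omega.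
  by rewrite (phi_A Ax); have [] := phiAP n x.
by rewrite (phi_Y Yy); apply: phiY_hom Yy.
Qed.

Let E_ex := hom_of_basis Z_free Z_span (fun x a b Zx => proj2 (phi_hom Zx) a b)
  (fun x Zx => proj1 (phi_hom Zx)).
Let E := sval (cid E_ex).
Let E_D : axiom_E E. Proof. exact: (proj1 (svalP (cid E_ex))). Qed.
Let E_lincomb s : in_list Z s -> E (lincomb ch s) = \prod_(p <- s) phi p.1 p.2.
Proof. exact: (proj2 (svalP (cid E_ex))). Qed.
Let E_0 : E 0 = 1.
Proof. by have := @E_lincomb [::] (fun p h => match notF h with end); rewrite /lincomb !big_nil. Qed.
Let E_neq0 x : E x != 0.
Proof. by apply/eqP => e; have /eqP := E_D x (- x); rewrite subrr E_0 e mul0r oner_eq0. Qed.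
Let E_N x : E (- x) = (E x)^-1.
Proof. by apply: (mulIf (E_neq0 x)); rewrite -E_D addNr E_0 mulVf. Qed.
Let E_sum (T : Type) (s : seq T) (F : T -> C) : E (\sum_(x <- s) F x) = \prod_(x <- s) E (F x).
Proof. by elim/big_rec2: _ => [|i y z _ <-]; rewrite ?E_0 ?E_D. Qed.
Let E_1 x q : Z x -> E (iQ q * x) = phi x q.
Proof.
move=> Zx; have := @E_lincomb [:: (x, q)]; rewrite /lincomb !big_seq1; apply.
by move=> p /[!inE]/eqP->.
Qed.
Let Z_A n a : A n a -> Z a. Proof. by move=> Aa; left; exists n; left. Qed.
Let Z_Y n y : Y n y -> Z (logval y n). Proof. by move=> Yy; left; exists n; right; exists y. Qed.
Let Z_omega : Z omega. Proof. by right. Qed.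
Let E_omega q : E (iQ q * omega) = tau q. Proof. by rewrite E_1 // phi_omega. Qed.
Let E_A n a q : A n a -> E (iQ q * a) = phiA n a q.
Proof. by move=> Aa; rewrite (E_1 q (Z_A Aa)) (phi_A Aa). Qed.
Let E_Y n y q : Y n y -> E (iQ q * logval y n) = phiY y q.
Proof. by move=> Yy; rewrite (E_1 q (Z_Y Yy)) (phi_Y Yy). Qed.

Let E_split n d (s t : seq C) (q r : C -> rat) :
  (forall a, a \in s -> A n a) -> (forall y, y \in t -> Y n y) ->
  E (d + \sum_(a <- s) iQ (q a) * a + \sum_(y <- t) iQ (r y) * logval y n) =
  E d * \prod_(a <- s) phiA n a (q a) * \prod_(y <- t) phiY y (r y).
Proof.
move=> sA tY; rewrite !E_D !E_sum; congr (_ * _ * _); rewrite big_seq [RHS]big_seq.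
  by apply: eq_bigr => a /sA; apply: E_A.
by apply: eq_bigr => y /tY; apply: E_Y.
Qed.

Let Kn_phiY n y q : Y n y -> Kn n (phiY y q).
Proof.
move=> Yy; have [h e _] := phiYP (Y_axis Yy).
by apply: (rat_hom_acl (S := lvl n)) => //; rewrite e; apply: Y_Kn.
Qed.

Let tau_torsion q : exists N, (0 < N)%N /\ tau q ^+ N = 1.
Proof.
pose d := `|denq q|%N; have dE : denq q = d%:Z by rewrite /d gtz0_abs ?denq_gt0.
exists d; rewrite -ltz_nat -dE denq_gt0; split=> //.
have e : q * d%:R = (numq q)%:~R by rewrite numqE dE.
by rewrite -rat_homM // e -[X in tau X]mul1r rat_homMz // tau1 exp1rz.
Qed.

Let E_in_I n z : D n z -> I n (E z).
Proof.
elim: n z => [|n IH] z.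
  by have [-> ->] := hDI0 => -[q ->]; rewrite E_omega; apply: tau_torsion.
move=> /D_split[d [s [q [t [r [Dd [_ sA] [_ tY] ->]]]]]]; rewrite E_split //.
have [_ ->] := hDIS n; exists (E d * \prod_(y <- t) phiY y (r y)), [seq (a, q a) | a <- s].
have [_ [hI _ _ _ _]] := hDI n; have [KE _] := hI _ (IH _ Dd); split.
- apply: KnM => //; apply/(sfpredP (lvl_subfield n)); rewrite big_seq; apply: rpred_prod => y /tY Yy.
  by apply/sfpredP/Kn_phiY.
- rewrite mulf_neq0 // prodf_seq_neq0; apply/allP => y /tY Yy.
  by apply: rat_hom_neq0; apply: phiY_hom Yy.
- by move=> _ /mapP[a /sA ? ->].
- by rewrite big_map mulrAC.
Qed.

(** Dividing a logarithm of z^N by N gives [z] up to a root of unity, which a rational multiple of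
    [omega] corrects. *)
Let E_root n N z : (0 < N)%N -> z != 0 -> (exists u, D n u /\ E u = z ^+ N) -> exists u, D n u /\ E u = z.
Proof.
move=> N0 z0 [u [Du Eu]]; pose v := iQ N%:R^-1 * u.
have Ev : E v ^+ N = z ^+ N.
  rewrite -Eu; transitivity (E (\sum_(i < N) v)); first by rewrite E_sum prodr_const card_ord.
  have e : iQ N%:R^-1 * N%:R = 1.
    by rewrite -(rmorph_nat iQ) -rmorphM mulVf ?rmorph1 // pnatr_eq0 -lt0n.
  by rewrite sumr_const card_ord -mulr_natr /v mulrAC e mul1r.
have [|q qE] := @tauS N (z / E v) N0; first by rewrite expr_div_n Ev mulfV ?expf_neq0.
exists (iQ q * omega + v); split; first by apply: D_D; apply: D_Z => //; apply: omega_D.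
by rewrite E_D E_omega qE divfK.
Qed.

(** Polar decomposition: the square of z is the product of z conj(z), which is positive, and z /
    conj(z), which has norm 1. The basis [Y n] provides logarithms of powers of both. *)
Let I_in_E n : (forall z, I n z -> exists u, D n u /\ E u = z) ->
  forall z, Kn n z -> z != 0 -> exists u, D n.+1 u /\ E u = z.
Proof.
move=> hE; have axis z : Kn n z -> z != 0 -> onaxis (0 < z) z -> exists u, D n.+1 u /\ E u = z.
  move=> Kz z0 az; have [_ _ /(_ z Kz z0 az)[N [s [k [N0 sY /hE[d [Dd Ed]]]]]]] := hY n.
  apply: (E_root N0 z0); exists (d - \sum_(y <- s) iQ (k y)%:~R * logval y n); split.
    apply: D_D; first exact: D_le Dd.
    rewrite -mulN1r -(rmorphN1 iQ); apply: D_Z; apply: (@D_sum n.+1 s (fun y => (k y)%:~R) (fun y => logval y n)).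
    by move=> y /sY/logval_D.
  rewrite E_D E_N E_sum Ed.
  have -> : \prod_(y <- s) E (iQ (k y)%:~R * logval y n) = \prod_(y <- s) y ^ k y.
    rewrite big_seq [RHS]big_seq; apply: eq_bigr => y /sY Yy; rewrite (E_Y _ Yy).
    by have [h e _] := phiYP (Y_axis Yy); rewrite -[X in phiY y X]mul1r rat_homMz // e.
  rewrite mulfK // big_seq prodf_seq_neq0; apply/allP => y _; apply/implyP => /sY/Y_axis/onaxis_neq0.
  exact: expfz_neq0.
move=> z Kz z0; apply: (E_root (N := 2)) => //.
have zc0 : z^* != 0 by rewrite conjC_eq0.
have [|||u [Du Eu]] := axis (z * z^*).
- by apply: KnM => //; apply: lvl_conj.
- exact: mulf_neq0.
- by have h : 0 < z * z^*; [rewrite mul_conjC_gt0|rewrite /onaxis h].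
have [|||v [Dv Ev]] := axis (z / z^*).
- by apply: KnM => //; apply: subfieldV (lvl_subfield n) (lvl_conj Kz).
- by rewrite mulf_neq0 ?invr_eq0.
- by rewrite /onaxis; case: ifP => // _; rewrite normf_div norm_conjC mulfV ?normr_eq0.
exists (u + v); split; first exact: D_D.
by rewrite E_D Eu Ev; field.
Qed.

Let E_onto n z : I n z -> exists u, D n u /\ E u = z.
Proof.
elim: n z => [|n IH] z.
  have [_ ->] := hDI0 => -[N [N0 /(tauS N0)[q qz]]]; exists (iQ q * omega); rewrite E_omega; split=> //.
  exact/D_Z/omega_D.
have [_ ->] := hDIS n => -[k [s [Kk k0 sA ->]]].
have [u [Du Eu]] := I_in_E IH Kk k0; exists (u + lincomb ch s); split.
  apply: D_D => //; apply: Kn_D; apply/(sfpredP (lvl_subfield n)); rewrite /lincomb big_seq.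
  by apply: rpred_sum => p /sA/A_Kn Kp; apply/sfpredP/KnM => //; apply: (iQ_Kn ch lvl_subfield).
rewrite E_D Eu; congr (_ * _); rewrite E_sum big_seq [RHS]big_seq; apply: eq_bigr => p /sA.
exact: E_A.
Qed.

Let E_log : axiom_LOG E.
Proof.
move=> y y0; have [n Ky] := lvl_exhaust y.
by have [u [_ Eu]] := I_in_E (@E_onto n) Ky y0; exists u.
Qed.

Let common_den (t : seq C) (r : C -> rat) : exists N (k : C -> int), (0 < N)%N /\
  forall y, y \in t -> r y * N%:R = (k y)%:~R.
Proof.
elim: t => [|y t [N [k [N0 kE]]]]; first by exists 1%N, (fun=> 0).
pose d := `|denq (r y)|%N; have dE : denq (r y) = d%:Z by rewrite /d gtz0_abs ?denq_gt0.
exists (N * d)%N, (fun x => if x == y then numq (r y) * N%:Z else k x * d%:Z); split.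
  by rewrite muln_gt0 N0 -ltz_nat -dE denq_gt0.
move=> x; rewrite inE; case: eqP => [->|_] /= xt; rewrite intrM natrM.
  by rewrite mulrCA mulrC numqE dE.
by rewrite mulrA kE.
Qed.

(** A nonzero adapted coefficient would express its exponential without its fresh variable. The
    remaining product of values of [phiY] is then the inverse of E d and so in [I n]; a common power
    turns it into integral powers, and independence of [Y n] modulo [I n] ends the proof. *)
Let E_kernel_step n z : D n.+1 z -> E z = 1 -> D n z.
Proof.
move=> /D_split[d [s [q [t [r [Dd [us sA] [ut tY] ->]]]]]]; rewrite E_split // => e.
have [_ [hI I1 IM IV _]] := hDI n; have [KE _] := hI _ (E_in_I Dd).
have q0 a : a \in s -> q a = 0.
  move=> as_; apply/eqP; apply: contrapT => /negP qa; apply: (@nOm_beta a n).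
  have [ha <- _ _] := phiAP n a; apply: (rat_hom_acl1 (q := q a) (S := fun b => B b /\ b <> freshA a n)) => //.
  have hO := subfield_acl (fun b => B b /\ b <> freshA a n); apply/(sfpredP hO).
  move: e; rewrite (big_rem a) //=; set P := \prod_(y <- rem a s) _; set R := \prod_(y <- t) _ => e.
  have e' : phiA n a (q a) * (E d * P * R) = 1 by rewrite -e; ring.
  have e0 : E d * P * R != 0.
    by apply/eqP => e0; move/eqP: e'; rewrite e0 mulr0 eq_sym oner_eq0.
  have -> : phiA n a (q a) = (E d * P * R)^-1 by apply: (mulIf e0); rewrite mulVf.
  rewrite rpredV rpredM //; last first.
    rewrite /R big_seq; apply: rpred_prod => y /tY Yy; apply/sfpredP.
    by apply: (@Om_Kn n) (Kn_phiY _ Yy); lia.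
  rewrite rpredM //; first by apply/sfpredP; apply: (@Om_Kn n) KE; lia.
  rewrite /P big_seq; apply: rpred_prod => a' a's; apply/sfpredP.
  have [ha' ea' _ _] := phiAP n a'; apply: (rat_hom_acl (S := fun b => B b /\ b <> freshA a n)) => //.
  rewrite ea'; apply: Om_beta => /bb_inj[]; last by lia.
  by move=> aa; move: a's; rewrite aa mem_rem_uniqF.
have sum0 : \sum_(a <- s) iQ (q a) * a = 0.
  by rewrite big_seq big1 // => a /q0->; rewrite rmorph0 mul0r.
have prod1 : \prod_(a <- s) phiA n a (q a) = 1.
  by rewrite big_seq big1 // => a /q0->; have [[-> _] _ _ _] := phiAP n a.
rewrite prod1 mulr1 in e.
have IR : I n (\prod_(y <- t) phiY y (r y)).
  have -> : \prod_(y <- t) phiY y (r y) = (E d)^-1.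
    by apply: (mulfI (E_neq0 d)); rewrite e mulfV.
  exact/IV/E_in_I.
have [N [k [N0 kE]]] := common_den t r.
have IX x m : I n x -> I n (x ^+ m) by move=> Ix; elim: m => [|m IH]; rewrite ?expr0 // exprS; apply: IM.
have r0 y : y \in t -> r y = 0.
  move=> yt; have [_ free _] := hY n; have := free t k ut tY.
  have -> : \prod_(y <- t) y ^ k y = (\prod_(y <- t) phiY y (r y)) ^+ N.
    rewrite -prodrXl big_seq [RHS]big_seq; apply: eq_bigr => y' y't.
    have [h e' _] := phiYP (Y_axis (tY _ y't)).
    by rewrite -rat_homM // kE // -[X in phiY y' X]mul1r rat_homMz // e'.
  move=> /(_ (IX _ _ IR) y yt) ky; apply/eqP; have := kE y yt; rewrite ky => /eqP.
  by rewrite mulf_eq0 pnatr_eq0 [(N == _)%N]gtn_eqF // orbF.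
have -> : \sum_(y <- t) iQ (r y) * logval y n = 0.
  by rewrite big_seq big1 // => y /r0->; rewrite rmorph0 mul0r.
by rewrite sum0 !addr0.
Qed.

Let E_kernel z : E z = 1 -> exists k : int, z = omega *~ k.
Proof.
move=> Ez; have [n /Kn_D] := lvl_exhaust z; elim: n.+1 => {n} [|n IH Dz]; last exact/IH/E_kernel_step.
have [-> _] := hDI0 => -[q zE]; move: Ez; rewrite zE E_omega => /tauK[k ->].
by exists k; rewrite rmorph_int mulrzl.
Qed.

Let Z_axial x : Z x -> axial x.
Proof.
case=> [[n [Ax|[y [_ ->]]]]|->]; last by right; apply: omega_conj.
  by have [[_ h _] _] := hA n; apply: h.
exact: logval_axial.
Qed.

Let E_conj z : E z^* = (E z)^*.
Proof.
have [s [sZ ->]] := Z_span z; rewrite lincomb_conj; last exact: in_list_sub Z_axial sZ.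
rewrite !E_lincomb //; last by move=> _ /mapP[p /sZ ? ->].
rewrite big_map rmorph_prod big_seq [RHS]big_seq; apply: eq_bigr => p ps /=.
have sg (r : bool) (ph : rat -> C) : rat_hom ph -> (forall q, onaxis r (ph q)) -> ph (if r then p.2 else - p.2) = (ph p.2)^*.
  move=> h hr; rewrite (onaxis_conj (hr p.2)); case: r {hr} => //; exact: rat_homN.
case: (sZ p ps) => [[n [Ax|[y [Yy pE]]]]|pE].
- by rewrite (phi_A Ax); have [h _ _ hr] := phiAP n p.1; apply: sg.
- by rewrite pE (phi_Y Yy) logval_real; have [h _ hr] := phiYP (Y_axis Yy); apply: sg.
have -> : (p.1^* == p.1) = false.
  by rewrite pE omega_conj eqNr (negbTE omega_neq0).
have tq q : onaxis false (tau q).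
  by have [N [N0 e]] := tau_torsion q; apply: (norm_root1 N0 e); rewrite normr1.
by rewrite pE phi_omega; apply: (sg false tau htau tq).
Qed.

(** Induction on the level of z. For z in K_(n+1) with j <= n, adaptedness makes the part d in
    D_(n+1) infinitesimal. Its logarithmic part, being otherwise infinite, vanishes, so d is in K_n
    and induction applies. The adapted part has exponential near 1 over K_(n+1). When the level is
    at most j, z is zero. *)
Let E_cont n j z : Kn n z -> infsmall Kn j z -> infsmall Kn j (E z - 1).
Proof.
have small m u : (m <= j)%N -> Kn m u -> infsmall Kn j u -> infsmall Kn j (E u - 1).
  by move=> mj Ku mu; rewrite (infsmall_Kn lvl_subfield lvl_acl lvl_conj (Kn_le lvl_succ mj Ku) mu) E_0 subrr; apply: infsmall0.
elim: n z => [|n IH] z Kz mz; first exact: (@small 0%N z (leq0n j) Kz mz).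
have [nj|jn] := leqP n.+1 j; first exact: (@small n.+1 z nj Kz mz).
have [[AK _ adp] /(_ z Kz)[d [v [Dd /qspan_uniq[s [q [us sA vE]]] zE]]]] := hA n.+1.
have [hm _] := adp s q d us sA Dd; have {hm} md : infsmall Kn j d by apply: hm; rewrite -vE -zE.
have Kd : Kn n d.
  move: Dd md; have [-> _] := hDIS n => -[k [t' [Kk t'Y dE]]] md.
  have tE : \sum_(p <- t') iQ p.2 * logval p.1 n =
      \sum_(y <- undup (map fst t')) iQ (\sum_(p <- t' | p.1 == y) p.2) * logval y n.
    apply: (collect_terms (F := fun y q => iQ q * logval y n)) => [y|y a b]; first by rewrite rmorph0 mul0r.
    by rewrite rmorphD mulrDl.
  rewrite dE tE in md *; have r0 := logval_infinite (undup_uniq _) Kk (ltW (infsmall_lt1 lvl_subfield md)).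
  rewrite big_seq big1 ?addr0 // => y /r0->; by rewrite rmorph0 mul0r.
rewrite zE vE E_D; apply: infsmall1M => //; first exact: lvl_subfield.
  exact: IH.
rewrite E_sum big_seq; elim/big_ind: _ => [|x y|a /sA Aa]; first by rewrite subrr; apply: infsmall0.
  exact: (infsmall1M lvl_subfield).
rewrite (E_A _ Aa); have [_ _ h _] := phiAP n.+1 a.
exact: (infsmall_le lvl_succ (ltnW jn)).
Qed.

Let E_one x : E x = E (iQ 1 * x). Proof. by rewrite rmorph1 mul1r. Qed.

Let Xn_fr n x : Xn n x -> lev x = n /\ exists y m, [/\ fr x = bb y m, (4 * n < m)%N &
  m = (4 * n).+2 \/ m = (4 * n).+3].
Proof.
rewrite /lev /fr; case=> [/sp_A->|[y [/sp_Y h ->]]]; first by split=> //; exists x, (4 * n).+2; split; [|lia|left].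
by rewrite h; split=> //; exists y, (4 * n).+3; split; [|lia|right].
Qed.

Let fr_inj n m x y : Xn n x -> Xn m y -> fr x = fr y -> x = y.
Proof.
rewrite /fr; move=> Xx Xy; case: (Xx) => [Ax|[x' [Yx xE]]]; case: (Xy) => [Ay|[y' [Yy yE]]].
- by rewrite (sp_A Ax) (sp_A Ay) => /bb_inj[].
- by rewrite (sp_A Ax) yE (sp_Y Yy) => /bb_inj[_]; lia.
- by rewrite (sp_A Ay) xE (sp_Y Yx) => /bb_inj[_]; lia.
rewrite xE yE (sp_Y Yx) (sp_Y Yy) => /bb_inj[-> e].
by have -> : n = m by lia.
Qed.

(** The value of [beta] and of [logval] also involves [eps n], of index 4n + 1, which therefore has
    to be excluded for [f]. *)
Let Xn_Om n x f y m : Xn n x -> f = bb y m -> (4 * n < m)%N -> m <> (4 * n).+1 -> fr x <> f ->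
  Om f x /\ Om f (E x).
Proof.
move=> Xx -> nm m1; have tf : eps n <> bb y m by move=> /bb_inj[_ e]; apply: m1.
rewrite E_one; case: Xx => [Ax|[x' [Yx ->]]]; rewrite /fr.
  rewrite (sp_A Ax) (E_A _ Ax) => ff; have [_ -> _ _] := phiAP n x; split; last exact: Om_beta.
  exact: (Om_Kn y nm (A_Kn Ax)).
rewrite (sp_Y Yx) (E_Y _ Yx) => ff; have [_ -> _] := phiYP (Y_axis Yx); split; last exact: (Om_Kn y nm (Y_Kn Yx)).
apply: Om_logval => //; move=> /bb_inj[_ e]; by rewrite -e ltnn in nm.
Qed.

Lemma tower_exponential : exists (E : C -> C) (fe : free_exp ch E omega), [/\ E omega = 1, forall z, E z^* = (E z)^* &
  forall j z, infsmall Kn j z -> infsmall Kn j (E z - 1)].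
Proof.
have [c [c1 c2 c3 c4]] := coordinates Z_free Z_span.
suff fe : free_exp ch E omega.
  exists E, fe; split; first by have := E_omega 1; rewrite rmorph1 mul1r tau1.
    exact: E_conj.
  by move=> j z; have [n Kz] := lvl_exhaust z; apply: E_cont Kz.
apply: (@FreeExp C ch E omega B X lev fr c) => //.
- move=> q; rewrite E_omega; apply: rat_hom_acl htau _; rewrite tau1.
  by case: (subfield_acl (fun _ : C => False)).
- move=> hw; apply: (@bb_free 0 0); have h := subfield_acl (fun b => B b /\ b <> bb 0 0).
  have e : bb 0 0 = omega / 'i by rewrite /omega mulrAC mulfV ?mul1r ?neq0Ci.
  apply/(sfpredP h); rewrite [X in X \in _]e rpred_div //; last exact/sfpredP/acl_i.
  by apply/sfpredP; apply: acl_mono hw.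
- by move=> x [n /Xn_fr[_ [y [m [-> _ _]]]]].
- by move=> x y Xx; apply: c4; left.
- move=> x y [n Xx] [m Xy] yx; have [-> [u [l [fu lu l23]]]] := Xn_fr Xx; have [-> _] := Xn_fr Xy => mn.
  apply: (Xn_Om Xy fu); try lia.
  by move=> /(fr_inj Xy Xx).
- move=> x [n Xx]; have EO := E_one x; have [_ [u [l [fu lu l23]]]] := Xn_fr Xx.
  case: Xx => [Ax|[y [Yy xE]]]; [left|right].
    rewrite EO (E_A _ Ax); have [_ -> _ _] := phiAP n x; split.
      by rewrite fu; apply: (Om_Kn u lu (A_Kn Ax)).
    by rewrite /fr (sp_A Ax); apply: nOm_beta.
  rewrite EO xE (E_Y _ Yy); have [_ -> _] := phiYP (Y_axis Yy); split.
    by rewrite /fr (sp_Y Yy); apply: nOm_logval.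
  by rewrite -xE fu; apply: (Om_Kn u lu (Y_Kn Yy)).
move=> x [n /Xn_fr[_ [y [m [-> nm _]]]]].
have h := subfield_acl (fun b => B b /\ b <> bb y m); apply/(sfpredP h).
by rewrite rpredM //; apply/sfpredP; [apply: acl_i|apply: Om_bb => /bb_inj[_]; lia].
Qed.

End Assembly.
End Tower.

(** * Continuity *)

Section RealClosedUnion.
Variables (K : closedFieldType).

Lemma preord_sqrt (T : K -> Prop) x : preord T /\ algmax T -> T x -> exists y, T y /\ x = y ^+ 2.
Proof.
move=> h Tx; have [a ax] : exists a : rcl h, val a = x.
  have px : x \in sfpred (subfield_psub h.1) by apply/sfpredP; apply: (po_psub h.1).
  by exists (SField px).
have a0 : 0 <= a by apply/rcl_ge0P; rewrite ax.
exists (val (Num.sqrt a)); split; first by apply/rcl_ge0P; apply: sqrtr_ge0.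
by rewrite -ax -[in LHS](sqr_sqrtr a0) rmorphXn.
Qed.

Lemma rcstruct_of_chain (i : K) (T : nat -> K -> Prop) : i ^+ 2 = -1 ->
  (forall n, preord (T n) /\ algmax (T n)) -> (forall n x, T n x -> T n.+1 x) ->
  (forall z, exists n, acl (T n) z) ->
  exists S : rcstruct K, forall x, rc_T S x <-> exists n, T n x.
Proof.
move=> ii hT TS Tall.
have T_le m n x : (m <= n)%N -> T m x -> T n x.
  elim: n => [|n IH]; first by rewrite leqn0 => /eqP->.
  by rewrite leq_eqVlt => /orP[/eqP->//|/IH h /h/TS].
pose U x := exists A, (exists n, A = T n) /\ A x.
have UP x : U x <-> exists n, T n x.
  by split=> [[_ [[n ->] Tx]]|[n Tx]]; [exists n|exists (T n); split=> //; exists n].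
have hU : preord U.
  apply: po_chain; first by exists (T 0%N), 0%N.
  - by move=> _ [n ->]; case: (hT n).
  move=> _ _ [m ->] [n ->]; have [le|/ltnW le] := leqP m n; [left|right] => x; exact: T_le.
have pU n x : psub (T n) x -> psub U x.
  by move=> [u [v [Tu Tv ->]]]; exists u, v; split=> //; apply/UP; exists n.
have Ut x : psub U x -> U x \/ U (- x).
  move=> [u [v [/UP[m Tu] /UP[n Tv] ->]]].
  have p : psub (T (maxn m n)) (u - v).
    by exists u, v; split=> //; [apply: T_le Tu; apply: leq_maxl|apply: T_le Tv; apply: leq_maxr].
  have [h1 h2] := hT (maxn m n).
  by have [h|h] := algmax_total h1 h2 p; [left|right]; apply/UP; exists (maxn m n).
have Ur z : exists x y, [/\ psub U x, psub U y & z = x + i * y].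
  have [n az] := Tall z; have [x [y [px py e]]] := acl_re_im (hT n) ii az.
  by exists x, y; split; [apply: (pU n)|apply: (pU n)|].
have Us x : U x -> exists y, U y /\ x = y ^+ 2.
  by move=> /UP[n Tx]; have [y [Ty e]] := preord_sqrt (hT n) Tx; exists y; split=> //; apply/UP; exists n.
by exists (RCStruct hU ii Ut Ur Us).
Qed.

End RealClosedUnion.

Section Continuity.
Variables (C : numClosedFieldType) (Kn : nat -> C -> Prop) (E : C -> C) (d : nat -> C).
Hypotheses (Kf : forall n, subfield (Kn n)) (Ka : forall n z, acl (Kn n) z -> Kn n z)
  (Kc : forall n z, Kn n z -> Kn n z^*) (Ks : forall n z, Kn n z -> Kn n.+1 z)
  (Kall : forall z, exists n, Kn n z) (d0 : forall n, 0 < d n)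
  (dm : forall n p, Kn n p -> 0 < p -> d n < p).
Hypotheses (ED : forall x y, E (x + y) = E x * E y) (E0 : forall x, E x != 0)
  (Ec : forall j z, infsmall Kn j z -> infsmall Kn j (E z - 1)).

Lemma Kn_list (s : seq C) : exists n, forall x, x \in s -> Kn n x.
Proof.
elim: s => [|x s [n sn]]; first by exists 0%N.
have [m Kx] := Kall x; exists (maxn n m) => y /[!inE]/orP[/eqP->|/sn].
  by apply: (Kn_le Ks) Kx; apply: leq_maxr.
by apply: (Kn_le Ks); apply: leq_maxl.
Qed.

Let ltR_lt (a b : C) : a^* = a -> b^* = b -> ltR (@Num.conj C) a b <-> a < b.
Proof.
move=> ra rb; split=> [[ab [s [rs e]]]|ab].
  rewrite lt_neqAle ab -subr_ge0 e; apply: real_exprn_even_ge0 => //; exact/CrealP.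
split; first by rewrite lt_eqF.
exists (sqrtC (b - a)); rewrite sqrtCK; split=> //.
by apply/CrealP; apply: ger0_real; rewrite sqrtC_ge0 subr_ge0 ltW.
Qed.

(** The box of radius [d j] about z, for a level j containing E z and the given bounds, consists of
    points infinitely near z over K_j. There E v - E z = E z (E(v - z) - 1) is infinitesimal over
    K_j, as |E z| is in K_j. *)
Lemma exp_continuous (i : C) : i ^+ 2 = -1 -> scontinuous (@Num.conj C) i E.
Proof.
move=> ii; have i0 : i != 0 by rewrite -sqrf_eq0 ii oppr_eq0 oner_eq0.
have [i1 ic] : `|i| = 1 /\ i^* = - i.
  have : i == 'i \/ i == - 'i by apply/orP; rewrite -eqf_sqr ii sqrCi.
  by case=> /eqP->; [rewrite normCi conjCi|rewrite normrN normCi rmorphN /= conjCi].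
have reP (x : C) : (x + x^*)^* = x + x^* by rewrite rmorphD /= conjCK addrC.
have two : (2%:R : C)^* = 2%:R by rewrite rmorph_nat.
pose re (x : C) : C := (x + x^*) / 2%:R; pose im (x : C) : C := (x - x^*) / (2%:R * i).
have re_real x : (re x)^* = re x by rewrite /re rmorphM fmorphV /= two reP.
have im_real x : (im x)^* = im x.
  by rewrite /im rmorphM fmorphV rmorphM /= two ic rmorphB /= conjCK mulrN invrN mulrN -mulNr opprB.
have reimE x : x = re x + i * im x by rewrite /re /im; field.
have infsmall_re j x : infsmall Kn j x -> infsmall Kn j (re x) /\ infsmall Kn j (im x).
  move=> mx; have half y : `|y| = 2%:R -> infsmall Kn j (x + x^*) /\ infsmall Kn j (x - x^*) ->
      infsmall Kn j ((x + x^*) / y) /\ infsmall Kn j ((x - x^*) / y).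
    move=> y2 [h1 h2]; have K1 : Kn j 1 by case: (Kf j).
    have le : `|y^-1| <= 1 by rewrite normfV y2 invf_le1 ?ltr0n // ler1n.
    by split; rewrite mulrC; apply: (infsmallM Kf K1 le).
  have hx : infsmall Kn j (x + x^*) /\ infsmall Kn j (x - x^*).
    by split; [apply: (infsmallD Kf) => //|apply: (infsmallB Kf) => //]; apply: infsmall_conj.
  split; first by have [] := half 2%:R (normr_nat _ _) hx.
  by have [] := half (2%:R * i) _ hx; rewrite ?normrM ?i1 ?mulr1 ?normr_nat.
move=> U oU z [Uz Ez0].
have [a1 [a2 [b1 [b2 [ra1 ra2 rb1 rb2 [[a [b [ra rb eE [l1 l2 l3 l4]]]] sub]]]]]] := oU _ Uz.
move/(ltR_lt ra1 ra): l1 => l1; move/(ltR_lt ra ra2): l2 => l2.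
move/(ltR_lt rb1 rb): l3 => l3; move/(ltR_lt rb rb2): l4 => l4.
(* The coordinates [a] and [b] of E z are included, so that their distances to the bounds are
   positive elements of K_j. *)
have [j jP] := Kn_list [:: a1; a2; b1; b2; a; b; E z].
have dr : (d j)^* = d j by apply: conj_Creal; apply: gtr0_real.
have rB (x y : C) : x^* = x -> y^* = y -> (x - y)^* = x - y by move=> hx hy; rewrite rmorphB /= hx hy.
have rD (x y : C) : x^* = x -> y^* = y -> (x + y)^* = x + y by move=> hx hy; rewrite rmorphD /= hx hy.
exists (re z - d j), (re z + d j), (im z - d j), (im z + d j); split.
- by apply: rB. - by apply: rD. - by apply: rB. - by apply: rD.
split.
  exists (re z), (im z); split=> //.
  by split; apply/ltR_lt; rewrite ?rB ?rD // ?ltrDl ?gtrDl ?oppr_lt0.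
move=> v [x [y [rx ry -> [m1 m2 m3 m4]]]]; split=> //; apply: sub.
have near (u u' : C) : u^* = u -> u'^* = u' -> ltR (@Num.conj C) (u - d j) u' ->
    ltR (@Num.conj C) u' (u + d j) -> infsmall Kn j (u' - u).
  move=> ru ru' /(ltR_lt (rB _ _ ru dr) ru') h1 /(ltR_lt ru' (rD _ _ ru dr)) h2 p Kp p0.
  apply: lt_trans (dm Kp p0); rewrite real_ltr_distl ?h1 //; exact/CrealP/rB.
have mv : infsmall Kn j (x + i * y - z).
  have -> : x + i * y - z = (x - re z) + i * (y - im z) by rewrite {1}[z]reimE; ring.
  apply: (infsmallD Kf); first exact: near.
  have K1 : Kn j 1 by case: (Kf j).
  by apply: (infsmallM Kf K1); rewrite ?i1 //; apply: near.
pose D := E (x + i * y) - E z.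
have mD : infsmall Kn j D.
  have -> : D = E z * (E (x + i * y - z) - 1).
    by rewrite mulrBr mulr1 -ED [z + _]addrC subrK.
  have KE : Kn j (E z) by apply: jP; rewrite !inE eqxx !orbT.
  by apply: (infsmallM Kf (Kn_norm Kf Ka Kc KE)) => //; apply: Ec.
have [mr mi] := infsmall_re j D mD.
(* A strict inequality between elements of K_j survives an infinitesimal perturbation over K_j. *)
have gap (u u' e : C) : Kn j u -> Kn j u' -> u^* = u -> u'^* = u' -> e^* = e -> u < u' -> infsmall Kn j e ->
    u < u' + e /\ u + e < u'.
  move=> Ku Ku' ru ru' re' lt me; have Kg : Kn j (u' - u).
    by apply/(sfpredP (Kf j)); rewrite rpredB //; apply/sfpredP.
  have := me _ Kg; rewrite subr_gt0 => /(_ lt); rewrite real_ltr_norml; last exact/CrealP.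
  move=> /andP[h1 h2]; split; last by rewrite addrC -ltrBrDr.
  by rewrite -ltrBlDl -opprB.
have KK u : u \in [:: a1; a2; b1; b2; a; b; E z] -> Kn j u by apply: jP.
exists (a + re D), (b + im D); split; try exact: rD.
  have -> : E (x + i * y) = E z + D by rewrite /D; ring.
  by rewrite eE {1}[D]reimE; ring.
have inl k : (k < 6)%N -> Kn j [:: a1; a2; b1; b2; a; b; E z]`_k.
  by move=> k6; apply: jP; apply: mem_nth; apply: leq_trans k6 _.
split; apply/ltR_lt; try exact: rD; try by [].
- by have [] := gap a1 a (re D) (inl 0%N isT) (inl 4%N isT) ra1 ra (re_real D) l1 mr.
- by have [] := gap a a2 (re D) (inl 4%N isT) (inl 1%N isT) ra ra2 (re_real D) l2 mr.
- by have [] := gap b1 b (im D) (inl 2%N isT) (inl 5%N isT) rb1 rb (im_real D) l3 mi.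
- by have [] := gap b b2 (im D) (inl 5%N isT) (inl 3%N isT) rb rb2 (im_real D) l4 mi.
Qed.

End Continuity.

Lemma exponential_of_tower (C : numClosedFieldType) (ch : [pchar C] =i pred0)
    (B : C -> Prop) (bb : C -> nat -> C) :
  indepset B -> (forall z, acl B z) -> (forall x m, B (bb x m)) ->
  (forall x m y l, bb x m = bb y l -> x = y /\ m = l) -> (forall b, B b -> 0 < b) ->
  (forall n p, acl (level B bb n) p -> 0 < p -> eps bb n < p) ->
  exists E : C -> C, [/\ forall x, E x != 0, forall x, E x^* = (E x)^*,
    [/\ axiom_E E, axiom_LOG E, axiom_STD E, axiom_SP E & axiom_CCP E] &
    forall i : C, i ^+ 2 = -1 -> scontinuous (@Num.conj C) i E].
Proof.
move=> iB spanB Bbb bb_inj Bpos tsmall.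
have [phiA phiAP] := phiA_ex Bbb Bpos tsmall.
have [phiY phiYP] := phiY_ex C.
have [tau [htau tau1 tauK tauS]] := torsion_hom C.
have [D [I [A [Y [h0 hS hDI hA hY]]]]] := tower_exists ch Bbb bb_inj Bpos phiAP.
have [E [fe [E1 Ec Em]]] := tower_exponential iB spanB Bbb bb_inj Bpos tsmall phiAP phiYP
  htau tau1 tauK tauS h0 hS hDI hA hY.
exists E; split; [exact: (fe_neq0 fe)|exact: Ec| |].
  split; [exact: (fe_E fe)|exact: (fe_log fe)| |exact: (free_SP fe)|exact: (free_CCP fe)].
  exists (omega bb); split; first exact: (omega_neq0 Bbb Bpos).
  by move=> x; split=> [/(fe_ker fe)//|[k ->]]; rewrite (fe_Ez fe) E1 exp1rz.
apply: (exp_continuous (@lvl_subfield C B bb) (@lvl_acl C B bb) (@lvl_conj C B bb Bpos) (@lvl_succ C B bb)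
  (level_all spanB bb_inj) (fun n => eps_gt0 Bbb Bpos n) tsmall (fe_E fe) (fe_neq0 fe) Em).
Qed.

Theorem theorem12p7 (K : closedFieldType) (char0 : [pchar K] =i pred0)
    (sat : saturated K) :
  exists (E : K -> K) (sigma : {rmorphism K -> K}),
    [/\ (forall x, E x != 0),
        bijective sigma /\ (forall x, sigma (sigma x) = x) /\ (exists x, sigma x != x),
        (forall x, sigma (E x) = E (sigma x)),
        [/\ axiom_E E, axiom_LOG E, axiom_STD E, axiom_SP E & axiom_CCP E] &
        forall i : K, i ^+ 2 = -1 -> scontinuous sigma i E].
Proof.
have [B [iB spanB]] := transcendence_basis K.
have [f [injf Bf]] := saturated_basis_inj sat spanB.
pose bb x m := f (f x ^+ m.+1).
have bb_inj x m y l : bb x m = bb y l -> x = y /\ m = l.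
  by move=> e; have [-> ->] := indepset_double_inj iB injf Bf (e : bb (x, m).1 (x, m).2 = bb (y, l).1 (y, l).2).
have Bbb x m : B (bb x m) by apply: Bf.
have [i ii] : exists i : K, i ^+ 2 = -1.
  have /closed_rootP[j] : size ('X^2 - (-1)%:P : {poly K}) != 1%N by rewrite size_XnsubC.
  by rewrite /root hornerD hornerN hornerXn hornerC subr_eq0 => /eqP e; exists j.
pose t n := bb 0 (4 * n).+1.
have lS n b : level B bb n b -> level B bb n.+1 b.
  by move=> [Bb h]; split=> // x m /h le; lia.
have lt n : level B bb n.+1 (t n) by split=> [|x m /bb_inj[_ <-]]; [apply: Bbb|lia].
have nlt n : ~ level B bb n (t n) by move=> [_ /(_ 0 (4 * n).+1 erefl)]; lia.
have [T hT] := @real_closed_chain K (level B bb) t B char0 iB (fun n x h => h.1) lS lt nlt.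
have hTm n : preord (T n) /\ algmax (T n) by have [] := hT n.
have TS n x : T n x -> T n.+1 x by have [_ _ _ h _] := hT n; apply: h.
have Tall z : exists n, acl (T n) z.
  have [n az] := level_all spanB bb_inj z; exists n; apply: acl_mono az => b.
  by have [_ _ h _ _] := hT n; apply: h.
have [S SU] := rcstruct_of_chain ii hTm TS Tall.
have Bpos (b : numK S) : B b -> 0 < b.
  move=> Bb; have [n Tb] : exists n, T n b.
    have [n lb] : exists n, level B bb n b.
      have [[x [m bm]]|no] := EM (exists x m, b = bb x m).
        by exists m; split=> // y l; rewrite bm => /bb_inj[_ <-]; lia.
      by exists 0%N; split=> // x m bm; case: no; exists x, m.
    by exists n; have [_ _ h _ _] := hT n; apply: h.
  rewrite lt_neqAle; apply/andP; split.
    apply/eqP => b0; have [h0 _ _ _] := subfield_acl (fun x : K => B x /\ x <> b).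
    exact: (iB b Bb (eq_ind 0 _ h0 b b0)).
  by apply/numK_geP; rewrite subr0; apply/SU; exists n.
have tsmall n (p : numK S) : acl (level B bb n) p -> 0 < p -> (t n : numK S) < p.
  move=> ap p0; have hS := rc_preord S.
  have lT b : level B bb n b -> T n b by have [_ _ h _ _] := hT n; apply: h.
  have [x [y [px py e]]] := acl_re_im (hTm n) ii (acl_mono lT ap).
  have pS u : psub (T n) u -> psub (rc_T S) u.
    by move=> [v [v' [Tv Tv' ->]]]; exists v, v'; split=> //; apply/SU; exists n.
  have Sp : rc_T S p by have /ltW/numK_geP := p0; rewrite subr0.
  have [F0 F1 Fs Fi] := subfield_psub hS.
  (* Positive elements of [numK S] are real. With a nonzero [y] the element [i] would be real too,
     and -1 would be in the cone. *)
  have y0 : y = 0.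
    apply/eqP; apply: contrapT => /negP y0; apply: (po_N1 hS).
    rewrite -ii; apply: psub_sq => //.
    have -> : i = (p - x) * y^-1 by rewrite e addrC addKr mulfK.
    have [h1 _] := Fs p x (po_psub hS Sp) (pS _ px).
    by have [_] := Fs _ _ h1 (Fi _ (pS _ py) y0).
  have {px}px : psub (T n) p by rewrite e y0 mulr0 addr0.
  (* Positivity in the union must be brought down to T_n, where the chain compares [p] with [t n];
     totality of T_n does this. *)
  have Tp : T n p.
    have [h1 h2] := hTm n; have [//|TN] := algmax_total h1 h2 px.
    case/negP: (lt0r_neq0 p0); apply/eqP.
    exact: po_anti hS Sp (proj2 (SU _) (ex_intro _ n TN)).
  rewrite lt_neqAle; apply/andP; split.
    apply/eqP => tp; apply: (iB (t n) (Bbb _ _)); move: ap; rewrite -tp.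
    by apply: acl_mono => b lb; split; [case: lb|move=> bt; apply: (nlt n); rewrite -bt].
  apply/numK_geP; apply/SU; exists n.+1; have [_ _ _ _ h] := hT n; apply: h => //.
  exact: lt0r_neq0 p0.
have [E [E0 Ec Eax Econt]] := @exponential_of_tower (numK S) char0 B bb iB spanB Bbb bb_inj Bpos tsmall.
pose sg : {rmorphism numK S -> numK S} := @Num.conj (numK S).
exists E, sg; split.
- exact: E0.
- have sgK : forall x : K, sg (sg x) = x := @conjCK (numK S).
  split; first by exists sg.
  split; first exact: sgK.
  exists ('i : numK S); apply/eqP => e.
  have := @conjCi (numK S); rewrite e => /eqP; rewrite -addr_eq0 -mulr2n mulrn_eq0 /=.
  by rewrite (negbTE (neq0Ci _)).
- by move=> x; apply/esym/Ec.
- exact: Eax.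
- exact: Econt.
Qed.
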